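(* Let $K$ be a field. The following conditions are equivalent: 1) $K$ is a large field; 2) $K$ is existentially closed in every function field $F$ in one variable over $K$ which admits a $K$-rational place; 3) $K$ is existentially closed in the henselization $K(t)^h$ of the rational function field $K(t)$ with respect to the $t$-adic valuation; 4) $K$ is existentially closed in the field $K((t))$ of formal Laurent series; 5) $K$ is existentially closed in every extension field which admits a discrete $K$-rational place.
   Context: A field $K$ is large if for every smooth curve over $K$ the set of $K$-rational points is infinite if it is non-empty; equivalently, for every function field $F|K$ in one variable the set of rational places is infinite if it is non-empty. A function field in one variable over $K$ is a finitely generated extension of $K$ of transcendence degree $1$. A place $P$ of an extension field $L$ of $K$ is $K$-rational if it is trivial on $K$ and its residue field $LP$ equals $K$; it is discrete if its value group is isomorphic to $\mathbb Z$. $K$ is existentially closed in an extension field $L$ if for all $m,n\in\mathbb N$ and all polynomials $f_1,\ldots,f_n,g\in K[X_1,\ldots,X_m]$, whenever $f_1,\ldots,f_n$ have a common zero in $L^m$ which is not a zero of $g$, they also have a common zero in $K^m$ which is not a zero of $g$. *)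

(* Defs.v *)
From HB Require Import structures.
From mathcomp Require Import all_boot all_order all_algebra.
From mathcomp Require Import boolp classical_sets functions fsbigop cardinality.
From mathcomp Require Import mpoly.
From mathcomp Require Import zify.

Set Implicit Arguments.
Unset Strict Implicit.
Unset Printing Implicit Defensive.

Import Order.TTheory GRing.Theory Num.Theory.
Local Open Scope classical_set_scope.
Local Open Scope ring_scope.

(* An extension field L of K is given by an embedding [iota : K -> L]. *)

Definition existentially_closed (K L : fieldType) (iota : {rmorphism K -> L}) :
    Prop :=
  forall (m n : nat) (f : 'I_n -> {mpoly K[m]}) (g : {mpoly K[m]}),
    (exists x : 'I_m -> L,
       (forall i, (map_mpoly iota (f i)).@[x] = 0)
       /\ (map_mpoly iota g).@[x] <> 0) ->
    exists x : 'I_m -> K, (forall i, (f i).@[x] = 0) /\ g.@[x] <> 0.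

Definition is_subfield (L : fieldType) (S : set L) : Prop :=
  divring_closed (mem S).

(* The field K(A) generated by A over K. *)
Definition gen_subfield (K L : fieldType) (iota : {rmorphism K -> L})
    (A : set L) : set L :=
  smallest (@is_subfield L) (range iota `|` A).

Definition algebraic_over_set (L : fieldType) (S : set L) (y : L) : Prop :=
  exists p : {poly L}, [/\ p != 0, (forall i, S p`_i) & root p y].

Definition finitely_generated (K L : fieldType) (iota : {rmorphism K -> L}) :
    Prop :=
  exists s : seq L, gen_subfield iota [set` s] = setT.

(* There is a transcendence basis consisting of a single element. *)
Definition trdeg1 (K L : fieldType) (iota : {rmorphism K -> L}) : Prop :=
  exists x : L, ~ algebraicOver iota x
    /\ forall y : L, algebraic_over_set (gen_subfield iota [set x]) y.

Definition function_field1 (K F : fieldType) (iota : {rmorphism K -> F}) :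
    Prop :=
  finitely_generated iota /\ trdeg1 iota.

(* A place of L with values in k, the value [None] standing for infinity: a
   ring homomorphism to k on the valuation ring [set x | P x <> None], such
   that the inverse of an element outside the valuation ring goes to 0. *)
Definition is_place (L k : fieldType) (P : L -> option k) : Prop :=
  [/\ P 1 = Some 1,
      (forall x y a b, P x = Some a -> P y = Some b -> P (x - y) = Some (a - b)),
      (forall x y a b, P x = Some a -> P y = Some b -> P (x * y) = Some (a * b))
    & (forall x, P x = None -> P x^-1 = Some 0)].

(* If a place is trivial on K and its residue field is (the image of) K, then
   composing it with the inverse of the isomorphism from K to the residue field
   gives an equivalent place with values in K that is the identity on K.
   Conversely such places are K-rational, and two of them are equivalent iff
   they are equal as functions.  So the functions below are exactly the
   K-rational places up to equivalence. *)
Definition rational_place (K L : fieldType) (iota : {rmorphism K -> L})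
    (P : L -> option K) : Prop :=
  is_place P /\ forall a : K, P (iota a) = Some a.

(* [v] induces an isomorphism of ordered groups from the value group
   (nonzero elements of L modulo units of the valuation ring) to int. *)
Definition discrete_place (L k : fieldType) (P : L -> option k) : Prop :=
  exists v : L -> int,
    [/\ (forall x y, x != 0 -> y != 0 -> v (x * y) = v x + v y),
        (forall n : int, exists2 x, x != 0 & v x = n)
      & (forall x, x != 0 -> (P x <> None <-> 0 <= v x))].

(* Largeness in terms of function fields: the curves are the smooth projective
   models and their rational points the rational places. *)
Definition large_field (K : fieldType) : Prop :=
  forall (F : fieldType) (iota : {rmorphism K -> F}),
    function_field1 iota ->
    [set P | rational_place iota P] !=set0 ->
    infinite_set [set P | rational_place iota P].

(* A valued field is a field together with its valuation ring. *)
Definition valuation_ring (L : fieldType) (O : set L) : Prop :=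
  subring_closed (mem O) /\ forall x, O x \/ O x^-1.

Definition max_ideal (L : fieldType) (O : set L) : set L :=
  [set x | O x /\ ~ exists2 y, O y & x * y = 1].

Definition henselian (L : fieldType) (O : set L) : Prop :=
  valuation_ring O /\
  forall (f : {poly L}) (a : L),
    f \is monic -> (forall i, O f`_i) -> O a ->
    max_ideal O f.[a] -> ~ max_ideal O f^`().[a] ->
    exists b : L, [/\ O b, root f b & max_ideal O (b - a)].

(* [j] embeds the valued field (L, OL) in the valued field (M, OM). *)
Definition valued_embedding (L M : fieldType) (OL : set L) (OM : set M)
    (j : {rmorphism L -> M}) : Prop :=
  forall x, OL x <-> OM (j x).

(* (H, OH) is a henselian extension of (L, OL) that has a unique valuation
   preserving embedding over L in every henselian extension of (L, OL); it is
   thus determined up to a unique valuation preserving isomorphism over L. *)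
Definition is_henselization (L H : fieldType) (OL : set L) (OH : set H)
    (j : {rmorphism L -> H}) : Prop :=
  [/\ henselian OH, valued_embedding OL OH j
    & forall (M : fieldType) (OM : set M) (i : {rmorphism L -> M}),
        henselian OM -> valued_embedding OL OM i ->
        (exists h : {rmorphism H -> M},
           valued_embedding OH OM h /\ forall x, h (j x) = i x)
        /\ (forall h h' : {rmorphism H -> M},
              valued_embedding OH OM h -> (forall x, h (j x) = i x) ->
              valued_embedding OH OM h' -> (forall x, h' (j x) = i x) ->
              forall y, h y = h' y)].

Definition ratfun (K : fieldType) : fieldType := {fraction {poly K}}.

Definition ratfunC (K : fieldType) : {rmorphism K -> ratfun K} :=
  @tofrac {poly K} \o polyC.

(* The elements of K(t) of nonnegative t-adic valuation form the localization
   of K[t] at the prime ideal (t). *)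
Definition tadic_ring (K : fieldType) : set (ratfun K) :=
  [set x | exists p q : {poly K}, q.[0] != 0 /\ x = tofrac p / tofrac q].

(* [laurent_coef x k] is the coefficient of t^k. *)
Record laurent (K : fieldType) : Type := Laurent {
  laurent_coef :> int -> K;
  laurent_bounded :
    exists N : int, forall k : int, k < N -> laurent_coef k = 0 }.

Section Laurent.
Variable K : fieldType.
Implicit Types x y z : laurent K.

HB.instance Definition _ := gen_eqMixin (laurent K).
HB.instance Definition _ := gen_choiceMixin (laurent K).

Lemma laurentP x y : (forall k, x k = y k) -> x = y.
Proof.
case: x y => [x hx] [y hy] /= /funext exy; subst y.
by congr Laurent; apply: Prop_irrelevance.
Qed.

Fact laurent_zero_subproof :
  exists N : int, forall k : int, k < N -> (fun=> 0 : K) k = 0.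
Proof. by exists 0. Qed.
Definition laurent_zero := Laurent laurent_zero_subproof.

Definition monomial_fun (n : int) (a : K) (k : int) : K :=
  if k == n then a else 0.
Fact monomial_subproof n a :
  exists N : int, forall k : int, k < N -> monomial_fun n a k = 0.
Proof. by exists n => k kn; rewrite /monomial_fun lt_eqF. Qed.
(* The series a * t^n. *)
Definition laurent_monomial n a := Laurent (monomial_subproof n a).

Fact laurent_opp_subproof x :
  exists N : int, forall k : int, k < N -> - x k = 0.
Proof.
by case: (laurent_bounded x) => N hN; exists N => k /hN ->; rewrite oppr0.
Qed.
Definition laurent_opp x := Laurent (laurent_opp_subproof x).

Fact laurent_add_subproof x y :
  exists N : int, forall k : int, k < N -> x k + y k = 0.
Proof.
case: (laurent_bounded x) (laurent_bounded y) => N hN [M hM].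
exists (Num.min N M) => k; rewrite lt_min => /andP[kN kM].
by rewrite hN // hM // addr0.
Qed.
Definition laurent_add x y := Laurent (laurent_add_subproof x y).

Fact laurent_addA : associative laurent_add.
Proof. by move=> x y z; apply: laurentP => k; apply: addrA. Qed.
Fact laurent_addC : commutative laurent_add.
Proof. by move=> x y; apply: laurentP => k; apply: addrC. Qed.
Fact laurent_add0 : left_id laurent_zero laurent_add.
Proof. by move=> x; apply: laurentP => k; apply: add0r. Qed.
Fact laurent_addN : left_inverse laurent_zero laurent_opp laurent_add.
Proof. by move=> x; apply: laurentP => k; apply: addNr. Qed.

HB.instance Definition _ := GRing.isZmodule.Build (laurent K)
  laurent_addA laurent_addC laurent_add0 laurent_addN.

(* A sum over all of int, which is legitimate since the summand has finite
   support. *)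
Definition laurent_mul_fun x y (k : int) : K :=
  \sum_(i \in [set: int]) x i * y (k - i).

Definition vanish_below (x : int -> K) (N : int) := forall k, k < N -> x k = 0.

Lemma laurent_mul_lt x y N M k : vanish_below x N -> vanish_below y M ->
  k < N + M -> laurent_mul_fun x y k = 0.
Proof.
move=> hx hy kNM; rewrite /laurent_mul_fun fsbig1 // => i _.
have [iN|Ni] := ltP i N; first by rewrite hx // mul0r.
by rewrite hy ?mulr0 //; lia.
Qed.

Definition trunc_poly m (x : int -> K) (N : int) : {poly K} :=
  \poly_(i < m) x (N + i%:Z).

Lemma laurent_mul_ge x y N M (n m : nat) : vanish_below x N ->
    vanish_below y M -> (n < m)%N ->
  laurent_mul_fun x y (N + M + n%:Z) = (trunc_poly m x N * trunc_poly m y M)`_n.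
Proof.
move=> hx hy nm; rewrite /laurent_mul_fun coefM.
pose r := [seq N + (nat_of_ord i)%:Z | i <- enum 'I_n.+1].
have r_uniq : uniq r.
  by rewrite map_inj_uniq ?enum_uniq // => i j /addrI [] /val_inj.
rewrite -(@fsbig_widen _ _ _ _ [set` r] setT) //=; last first.
  move=> i [_ /= ir]; have [iN|Ni] := ltP i N; first by rewrite hx // mul0r.
  have [ilt|ige] := ltP n%:Z (i - N); first by rewrite hy ?mulr0 //; lia.
  case: ir; apply/mapP.
  have lt_in : (`|i - N| < n.+1)%N by lia.
  by exists (Ordinal lt_in); rewrite ?mem_enum //=; lia.
rewrite -fsbig_seq // big_map big_enum /=; apply: eq_bigr => i _.
have := ltn_ord i; rewrite ltnS => le_in.
rewrite !coef_poly !ifT; [|lia..].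
by congr (_ * y _); lia.
Qed.

Fact laurent_mul_subproof x y :
  exists N : int, forall k : int, k < N -> laurent_mul_fun x y k = 0.
Proof.
case: (laurent_bounded x) (laurent_bounded y) => N hN [M hM].
by exists (N + M) => k; apply: laurent_mul_lt.
Qed.
Definition laurent_mul x y := Laurent (laurent_mul_subproof x y).

Definition laurent_one := laurent_monomial 0 1.

Lemma laurent_ind_ge (N : int) (x y : laurent K) :
  vanish_below x N -> vanish_below y N ->
  (forall n : nat, x (N + n%:Z) = y (N + n%:Z)) -> x = y.
Proof.
move=> hx hy h; apply: laurentP => k.
have [kN|Nk] := ltP k N; first by rewrite hx // hy.
by rewrite (_ : k = N + (`|k - N|%N)%:Z) //; lia.
Qed.

Lemma vanish_mul x y N M : vanish_below x N -> vanish_below y M ->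
  vanish_below (laurent_mul x y) (N + M).
Proof. by move=> hx hy k; apply: laurent_mul_lt. Qed.

Fact laurent_mulC : commutative laurent_mul.
Proof.
move=> x y; case: (laurent_bounded x) (laurent_bounded y) => N hN [M hM].
apply: (@laurent_ind_ge (N + M)); first exact: vanish_mul.
  by rewrite addrC; apply: vanish_mul.
move=> n; rewrite /= (@laurent_mul_ge _ _ N M n n.+1) // (addrC N).
by rewrite (@laurent_mul_ge _ _ M N n n.+1) // mulrC.
Qed.

Lemma eq_coefM (p q q' : {poly K}) n :
  (forall j, (j <= n)%N -> q`_j = q'`_j) -> (p * q)`_n = (p * q')`_n.
Proof.
by move=> h; rewrite !coefM; apply: eq_bigr => i _; rewrite h // leq_subr.
Qed.

Lemma trunc_polyM x y N M m j : vanish_below x N -> vanish_below y M ->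
  (j < m)%N ->
  (trunc_poly m (laurent_mul x y) (N + M))`_j
    = (trunc_poly m x N * trunc_poly m y M)`_j.
Proof. by move=> hx hy jm; rewrite coef_poly jm; apply: laurent_mul_ge. Qed.

Fact laurent_mulA : associative laurent_mul.
Proof.
move=> x y z.
case: (laurent_bounded x) (laurent_bounded y) (laurent_bounded z).
move=> N hN [M hM] [Q hQ].
have hxy := vanish_mul hN hM; have hyz := vanish_mul hM hQ.
apply: (@laurent_ind_ge (N + (M + Q))); first exact: vanish_mul.
  by rewrite addrA; apply: vanish_mul.
move=> n; rewrite /= (@laurent_mul_ge x _ N (M + Q) n n.+1) // addrA.
rewrite (@laurent_mul_ge _ z (N + M) Q n n.+1) //.
rewrite (eq_coefM _ (fun j (jn : (j <= n)%N) => @trunc_polyM y z M Q n.+1 j hM hQ jn)).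
rewrite [RHS](congr1 (fun p : {poly K} => p`_n) (mulrC _ _)).
rewrite (eq_coefM _ (fun j (jn : (j <= n)%N) => @trunc_polyM x y N M n.+1 j hN hM jn)).
by congr (_`_n); rewrite mulrA mulrC.
Qed.

Fact laurent_mul1 : left_id laurent_one laurent_mul.
Proof.
move=> x; case: (laurent_bounded x) => N hN.
have h1 : vanish_below laurent_one 0.
  by move=> k k0; rewrite /= /monomial_fun lt_eqF.
apply: (@laurent_ind_ge (0 + N)); first exact: vanish_mul.
  by rewrite add0r.
move=> n; rewrite /= (@laurent_mul_ge _ x 0 N n n.+1) //.
rewrite (_ : trunc_poly _ _ 0 = 1).
  by rewrite mul1r coef_poly ltnSn add0r.
apply/polyP => i; rewrite coef_poly coef1 /= /monomial_fun add0r.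
by case: i => [|i] //=; case: ifP.
Qed.

Fact laurent_mulDl : left_distributive laurent_mul laurent_add.
Proof.
move=> x y z.
case: (laurent_bounded x) (laurent_bounded y) (laurent_bounded z).
move=> N hN [M hM] [Q hQ]; pose R := Num.min N M.
have hx : vanish_below x R by move=> k; rewrite lt_min => /andP[/hN].
have hy : vanish_below y R by move=> k; rewrite lt_min => /andP[_ /hM].
have hxy : vanish_below (laurent_add x y) R.
  by move=> k kR; rewrite /= hx // hy // addr0.
have hxz := vanish_mul hx hQ; have hyz := vanish_mul hy hQ.
apply: (@laurent_ind_ge (R + Q)); first exact: vanish_mul.
  by move=> k kR; apply: etrans (congr2 +%R (hxz k kR) (hyz k kR)) (addr0 _).
move=> n; rewrite /= !(@laurent_mul_ge _ z R Q n n.+1) //.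
rewrite -coefD -mulrDl; congr (nth 0 (polyseq (_ * _)) n).
by apply/polyP => i; rewrite coefD !coef_poly; case: ifP; rewrite ?addr0.
Qed.

Fact laurent_oner_neq0 : laurent_one != laurent_zero.
Proof.
apply/eqP => /(congr1 (fun x : laurent K => x 0)) /=.
by rewrite /monomial_fun eqxx; apply/eqP; rewrite oner_eq0.
Qed.

HB.instance Definition _ := GRing.Zmodule_isComNzRing.Build (laurent K)
  laurent_mulA laurent_mulC laurent_mul1 laurent_mulDl laurent_oner_neq0.

Lemma power_series_inverse (u : nat -> K) : u 0%N != 0 ->
  exists v : nat -> K,
    forall n, \sum_(i < n.+1) u i * v (n - i)%N = (n == 0%N)%:R.
Proof.
move=> u0; pose fix g n : seq K := match n with
  | 0%N => [:: (u 0%N)^-1]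
  | m.+1 => rcons (g m)
      (- (u 0%N)^-1 * \sum_(i < m.+1) u i.+1 * nth 0 (g m) (m - i)%N)
  end.
have size_g n : size (g n) = n.+1 by elim: n => //= n IHn; rewrite size_rcons IHn.
pose v n := nth 0 (g n) n.
have vE m n : (n <= m)%N -> nth 0 (g m) n = v n.
  elim: m => [|m IHm]; first by rewrite leqn0 => /eqP->.
  rewrite leq_eqVlt => /predU1P[->//|lt_nm].
  by rewrite /= nth_rcons size_g lt_nm IHm.
exists v => -[|n]; first by rewrite big_ord1 /v /= mulfV.
rewrite big_ord_recl /= subn0 {1}/v /= nth_rcons size_g ltnn eqxx.
rewrite mulNr mulrN mulrA mulfV // mul1r.
apply/eqP; rewrite addrC subr_eq0; apply/eqP/eq_bigr => i _.
by rewrite vE ?leq_subr //= /bump /= add1n subSS.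
Qed.

Lemma laurent_inverse (x : laurent K) : x != 0 -> exists y, y * x = 1.
Proof.
move=> x0; case: (laurent_bounded x) => N hN.
have [n xn] : exists n : nat, x (N + n%:Z) != 0.
  apply: contrapT => h; case/eqP: x0; apply: (@laurent_ind_ge N) => // n.
  by apply: contrapT => /eqP xn; apply: h; exists n.
case: (ex_minnP (ex_intro (fun n : nat => x (N + n%:Z) != 0) n xn)).
move=> {xn}n xn min_n; pose M := N + n%:Z.
have hM : vanish_below x M.
  move=> k kM; have [kN|Nk] := ltP k N; first exact: hN.
  have kE : k = N + (`|k - N|%N)%:Z by lia.
  apply/eqP/negP => /negP xk; rewrite kE in xk.
  by have := min_n _ xk; rewrite /M in kM; lia.
have [v hv] : exists v : nat -> K,
    forall m, \sum_(i < m.+1) x (M + i%:Z) * v (m - i)%N = (m == 0%N)%:R.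
  by apply: (@power_series_inverse (fun i => x (M + i%:Z))); rewrite addr0.
pose yf (k : int) : K := if k < - M then 0 else v (absz (k + M)).
have hyf : vanish_below yf (- M) by move=> k kM; rewrite /yf kM.
pose y := Laurent (ex_intro (fun N => vanish_below yf N) _ hyf).
have hy : vanish_below y (- M) by exact: hyf.
exists y; rewrite mulrC; apply: (@laurent_ind_ge (M + - M)).
- exact: vanish_mul.
- by move=> k; rewrite subrr => k0; rewrite /= /monomial_fun lt_eqF.
move=> m; rewrite [LHS](@laurent_mul_ge x y M (- M) m m.+1) // coefM.
rewrite [RHS]/= /monomial_fun subrr add0r.
transitivity ((m == 0%N)%:R : K); last by case: m => [|m]; rewrite ?eqxx.
rewrite -(hv m); apply: eq_bigr => i _.
have := ltn_ord i; rewrite ltnS => le_im.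
rewrite !coef_poly !ifT; [|lia..]; congr (_ * _).
rewrite /= /yf ifF; last by apply/negbTE; rewrite -leNgt; lia.
by congr v; lia.
Qed.

Definition laurent_inv (x : laurent K) : laurent K :=
  xget 0 [set y | y * x = 1].

Fact laurent_mulVf (x : laurent K) : x != 0 -> laurent_inv x * x = 1.
Proof.
by move=> /laurent_inverse ex; apply: (@xgetPex _ 0 [set y | y * x = 1]).
Qed.

Fact laurent_inv0 : laurent_inv 0 = 0.
Proof.
apply: xgetPN => y /=; rewrite mulr0 => /esym/eqP.
by rewrite (negPf (oner_neq0 _)).
Qed.

HB.instance Definition _ := GRing.ComNzRing_isField.Build (laurent K)
  laurent_mulVf laurent_inv0.

Definition laurent_const (a : K) : laurent K := laurent_monomial 0 a.

Fact laurent_const_zmod : zmod_morphism laurent_const.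
Proof.
move=> a b; apply: laurentP => k; rewrite /= /monomial_fun.
by case: ifP => // _; rewrite subr0.
Qed.

Fact laurent_const_monoid : monoid_morphism laurent_const.
Proof.
split=> // a b.
have h c : vanish_below (laurent_const c) 0.
  by move=> k k0; rewrite /= /monomial_fun lt_eqF.
apply: (@laurent_ind_ge (0 + 0)); first exact: h.
  exact: vanish_mul.
move=> n; rewrite [RHS](@laurent_mul_ge _ _ 0 0 n n.+1) //.
have tC c : trunc_poly n.+1 (laurent_const c) 0 = c%:P.
  apply/polyP => i; rewrite coef_poly coefC /= /monomial_fun add0r.
  by case: i => [|i] //=; case: ifP.
by rewrite !tC -polyCM coefC /= /monomial_fun addr0 add0r; case: n {tC}.
Qed.

HB.instance Definition _ :=
  GRing.isZmodMorphism.Build K (laurent K) laurent_const laurent_const_zmod.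
HB.instance Definition _ :=
  GRing.isMonoidMorphism.Build K (laurent K) laurent_const laurent_const_monoid.

End Laurent.

(* Main.v *)
Require Import Defs.
From HB Require Import structures.
From mathcomp Require Import all_boot all_order all_algebra.
From mathcomp Require Import boolp classical_sets functions fsbigop cardinality.
From mathcomp Require Import mpoly.
From mathcomp Require Import ring zify.

(** The conditions are proved to imply each other cyclically.

    A large field [K] is existentially closed in a function field [F] with a
    rational place.  By largeness there are infinitely many rational places.  A
    nonzero element [u] of [F] vanishes at no more than [F : K(u)] of them, since
    elements separating these zeros are linearly independent over K(u)
    ([finitely_many_zeros]).  So at some rational place all the coordinates of a
    solution in [F] are finite and the value that must not vanish has a nonzero
    residue; the residues then form a solution in [K]
    ([large_existentially_closed]).

    The henselization of K(t) is realized inside K((t)), by the algebraic series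
    that have a counterpart, that is an element with the same rational
    approximations, in every henselian extension of K(t)
    ([hfield_henselization]).  Hence a solution in the henselization lies in a
    function field contained in K((t)), where the constant coefficient gives a
    rational place, and the second condition implies the third.

    The heart of the matter is a lifting theorem ([separable_liftable]).  Let [x]
    be a finite family in a separable extension of [K].  Away from the zeros of
    some [G] with [G(x)] not zero, the variety with generic point [x] is smooth,
    so over a henselian field an approximate point of it is close to a point.
    This is shown by induction on the number of coordinates, one coordinate being
    found from the others by Newton's form of Hensel's lemma
    ([henselian_newton]).  The extension K((t)) of [K] is separable
    ([laurent_separable]), so the theorem applies to a solution in K((t)): its
    truncations lie in K(t) and are approximate points, hence there is a
    solution in the henselization ([existentially_closed_laurent]).

    An extension with a discrete rational place embeds into K((t)) by expansion in
    powers of a uniformizer ([laurent_embedding]), so the fourth condition implies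
    the fifth.

    For the return to large fields, a rational place of a function field is
    discrete ([function_field_place_discrete]): the same linear independence as
    above bounds the number of values between 0 and the value of a given element.
    So [K] is existentially closed in a function field [F] with a rational place,
    and [F] embeds into K((t)).  Given finitely many rational places, choose [w]
    with a pole at each of them.  An affine model of [F] on which [w] is regular
    has a smooth K-point, and lifting a curve germ through that point to power
    series gives a rational place at which [w] is finite ([place_finite_at]).
    This place is not among the given ones, so their number is infinite. *)

Set Implicit Arguments.
Unset Strict Implicit.
Unset Printing Implicit Defensive.

Import Order.TTheory GRing.Theory Num.Theory.
Local Open Scope classical_set_scope.
Local Open Scope ring_scope.

Section ValuationRing.
Variables (L : fieldType) (O : set L).
Hypothesis hO : valuation_ring O.
Implicit Types x y d : L.

Lemma vr1 : O 1.
Proof. by case: hO => -[+ _ _] _; rewrite in_setE. Qed.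

Lemma vrB x y : O x -> O y -> O (x - y).
Proof.
by case: hO => -[_ /(_ x y) + _] _ Ox Oy; rewrite !in_setE; apply.
Qed.

Lemma vrM x y : O x -> O y -> O (x * y).
Proof.
by case: hO => -[_ _ /(_ x y) +] _ Ox Oy; rewrite !in_setE; apply.
Qed.

Lemma vr0 : O 0. Proof. by rewrite -(subrr 1); apply: vrB; apply: vr1. Qed.

Lemma vrN x : O x -> O (- x).
Proof. by move=> Ox; rewrite -sub0r; apply: vrB => //; apply: vr0. Qed.

Lemma vrD x y : O x -> O y -> O (x + y).
Proof. by move=> Ox /vrN Oy; rewrite -(opprK y); apply: vrB. Qed.

Lemma vrX x n : O x -> O (x ^+ n).
Proof.
by move=> Ox; elim: n => [|n IH]; rewrite ?exprS; [exact: vr1|exact: vrM].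
Qed.

Lemma vrMn x n : O x -> O (x *+ n).
Proof.
by move=> Ox; elim: n => [|n IH]; rewrite ?mulrS; [exact: vr0|exact: vrD].
Qed.

Lemma vr_sum (I : Type) (r : seq I) (P : pred I) (F : I -> L) :
  (forall i, P i -> O (F i)) -> O (\sum_(i <- r | P i) F i).
Proof.
by move=> h; elim/big_ind: _ => //; [exact: vr0|exact: vrD].
Qed.

Lemma vrV x : ~ O x -> O x^-1.
Proof. by case: (hO.2 x). Qed.

Lemma max_idealP x : max_ideal O x <-> O x /\ (x = 0 \/ ~ O x^-1).
Proof.
split=> -[Ox nx]; split=> //.
  have [->|x0] := eqVneq x 0; [by left|right => Ox1; apply: nx].
  by exists x^-1; rewrite ?divff.
case=> y Oy xy; case: nx => [x0|]; first by move: xy; rewrite x0 mul0r => /eqP; rewrite eq_sym oner_eq0.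
have x0 : x != 0 by apply: contra_eq_neq xy => ->; rewrite mul0r eq_sym oner_neq0.
by apply; rewrite -[x^-1]mulr1 -xy mulKf.
Qed.

Lemma max_idealO x : max_ideal O x -> O x. Proof. by case. Qed.

Lemma max_ideal0 : max_ideal O 0.
Proof. by apply/max_idealP; split; [exact: vr0|left]. Qed.

Lemma max_idealM x y : O x -> max_ideal O y -> max_ideal O (x * y).
Proof.
move=> Ox [Oy ny]; split; first exact: vrM.
by case=> z Oz xyz; apply: ny; exists (x * z); rewrite ?mulrA ?(mulrC y) //; exact: vrM.
Qed.

Lemma unit_vrV x : O x -> ~ max_ideal O x -> x != 0 /\ O x^-1.
Proof.
move=> Ox nx; split.
  by apply: contra_notN nx => /eqP ->; exact: max_ideal0.
by apply: contrapT => nxV; apply: nx; apply/max_idealP; split=> //; right.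
Qed.

Lemma max_idealB x y : max_ideal O x -> max_ideal O y -> max_ideal O (x - y).
Proof.
move=> mx my; have [Ox _] := mx; have [Oy _] := my.
have [->|x0] := eqVneq x 0.
  by rewrite sub0r -mulN1r; apply: max_idealM => //; apply/vrN/vr1.
have [->|y0] := eqVneq y 0; first by rewrite subr0.
have [h|h] := hO.2 (x / y).
  rewrite (_ : x - y = (x / y - 1) * y); last by rewrite mulrBl divfK // mul1r.
  by apply: max_idealM => //; apply: vrB => //; exact: vr1.
rewrite (_ : x - y = (1 - y / x) * x); last by rewrite mulrBl divfK // mul1r.
by apply: max_idealM => //; apply: vrB; rewrite -?[y / x]invf_div //; exact: vr1.
Qed.

Lemma max_idealN x : max_ideal O x -> max_ideal O (- x).
Proof. by move=> mx; rewrite -sub0r; apply: max_idealB => //; exact: max_ideal0. Qed.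

Lemma max_idealD x y : max_ideal O x -> max_ideal O y -> max_ideal O (x + y).
Proof. by move=> mx /max_idealN my; rewrite -(opprK y); apply: max_idealB. Qed.

Lemma max_ideal1 : ~ max_ideal O 1.
Proof. by case=> _; apply; exists 1; rewrite ?mulr1 //; exact: vr1. Qed.

Lemma max_ideal_unitB x y : max_ideal O (x - y) -> ~ max_ideal O y ->
  ~ max_ideal O x.
Proof. by move=> mxy my mx; apply: my; rewrite -(subKr x y); apply: max_idealB. Qed.

Lemma unitP x : O x -> O x^-1 -> x != 0 -> ~ max_ideal O x.
Proof. by move=> Ox Oxv x0 [_]; apply; exists x^-1; rewrite ?divff. Qed.

Lemma max_idealV x : ~ O x -> max_ideal O x^-1.
Proof. by move=> nx; apply/max_idealP; split; [exact: vrV|right; rewrite invrK]. Qed.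

(** This ideal measures closeness: [pideal d (x - y)] says that [x] and [y] agree
    to the precision [d]. *)
Definition pideal d : set L := [set x | exists2 r, O r & x = d * r].

Lemma pideal0 d : pideal d 0.
Proof. by exists 0; [exact: vr0|rewrite mulr0]. Qed.

Lemma pidealB d x y : pideal d x -> pideal d y -> pideal d (x - y).
Proof.
by move=> [r Or ->] [s Os ->]; exists (r - s); [exact: vrB|rewrite mulrBr].
Qed.

Lemma pidealN d x : pideal d x -> pideal d (- x).
Proof. by move=> [r Or ->]; exists (- r); [exact: vrN|rewrite mulrN]. Qed.

Lemma pidealD d x y : pideal d x -> pideal d y -> pideal d (x + y).
Proof.
by move=> [r Or ->] [s Os ->]; exists (r + s); [exact: vrD|rewrite mulrDr].
Qed.

Lemma pidealM d x y : O x -> pideal d y -> pideal d (x * y).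
Proof.
by move=> Ox [s Os ->]; exists (x * s); [exact: vrM|rewrite mulrCA].
Qed.

Lemma pidealMr d x y : O y -> pideal d x -> pideal d (x * y).
Proof. by rewrite mulrC; exact: pidealM. Qed.

Lemma pidealO d x : O d -> pideal d x -> O x.
Proof. by move=> Od [r Or ->]; apply: vrM. Qed.

Lemma pideal_max d x : max_ideal O d -> pideal d x -> max_ideal O x.
Proof. by move=> md [r Or ->]; rewrite mulrC; apply: max_idealM. Qed.

Lemma pidealW d e x : pideal d e -> pideal e x -> pideal d x.
Proof. by move=> [r Or ->] [s Os ->]; exists (r * s); [exact: vrM|rewrite mulrA]. Qed.

Lemma pideal_trans d x y z :
  pideal d (x - y) -> pideal d (y - z) -> pideal d (x - z).
Proof. by move=> xy yz; rewrite -(subrKA y); apply: pidealD. Qed.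

Lemma pideal1 x : pideal 1 x <-> O x.
Proof. by split=> [[r Or ->]|Ox]; [rewrite mul1r|exists x; rewrite ?mul1r]. Qed.

Lemma pidealE d x : d != 0 -> pideal d x <-> O (x / d).
Proof.
move=> d0; split=> [[r Or ->]|Ox]; first by rewrite mulrC mulKf.
by exists (x / d); rewrite // mulrC divfK.
Qed.

Definition pcoef (p : {poly L}) := forall i, O p`_i.

Lemma pcoefC c : O c -> pcoef c%:P.
Proof. by move=> Oc i; rewrite coefC; case: ifP => // _; exact: vr0. Qed.

Lemma pcoefD p q : pcoef p -> pcoef q -> pcoef (p + q).
Proof. by move=> hp hq i; rewrite coefD; apply: vrD. Qed.

Lemma pcoefM p q : pcoef p -> pcoef q -> pcoef (p * q).
Proof. by move=> hp hq i; rewrite coefM; apply: vr_sum => j _; apply: vrM. Qed.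

Lemma pcoefZ c p : O c -> pcoef p -> pcoef (c *: p).
Proof. by move=> hp hq i; rewrite coefZ; apply: vrM. Qed.

Lemma pcoefXn n : pcoef 'X^n.
Proof. by move=> i; rewrite coefXn; apply: vrMn; exact: vr1. Qed.

Lemma pcoef_sum (I : Type) (r : seq I) (P : pred I) (F : I -> {poly L}) :
  (forall i, P i -> pcoef (F i)) -> pcoef (\sum_(i <- r | P i) F i).
Proof.
by move=> h k; rewrite coef_sum; apply: vr_sum => i Pi; exact: h.
Qed.

Lemma pcoef_deriv p : pcoef p -> pcoef p^`().
Proof. by move=> hp i; rewrite coef_deriv; apply: vrMn. Qed.

Lemma pcoef_horner p x : pcoef p -> O x -> O p.[x].
Proof.
by move=> hp Ox; rewrite horner_coef; apply: vr_sum => i _; apply: vrM => //; exact: vrX.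
Qed.

Lemma taylor2 p a h : pcoef p -> O a -> O h ->
  exists2 r, O r & p.[a + h] = p.[a] + p^`().[a] * h + h ^+ 2 * r.
Proof.
move=> + Oa Oh; elim/poly_ind: p => [|p c IH] hp.
  by exists 0; [exact: vr0|rewrite deriv0 !horner0; ring].
have hp' : pcoef p by move=> i; have := hp i.+1; rewrite coefD coefMX coefC /= addr0.
have [r Or E] := IH hp'; exists (p^`().[a] + r * (a + h)).
  by apply: vrD; [apply: pcoef_horner => //; exact: pcoef_deriv|apply: vrM => //; exact: vrD].
by rewrite !derivE !hornerE E; ring.
Qed.

Lemma horner_pideal p d a b : pcoef p -> O a -> O b -> pideal d (a - b) ->
  pideal d (p.[a] - p.[b]).
Proof.
move=> hp Oa Ob ab; have Oh := vrB Oa Ob.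
have [r Or] := taylor2 hp Ob Oh; rewrite subrKC => ->.
rewrite (_ : _ - _ = (p^`().[b] + (a - b) * r) * (a - b)); last by ring.
by apply: pidealM => //; apply: vrD; [apply: pcoef_horner => //; exact: pcoef_deriv|exact: vrM].
Qed.

End ValuationRing.

(** Newton's form of Hensel's lemma.  Substituting [a + D c / Z] for the
    unknown turns [f] into a monic polynomial in [Z] which is congruent to
    [Z^(m+1) (Z + 1)], so that [-1] is a simple root of its reduction. *)
Lemma henselian_newton (L : fieldType) (O : set L) : henselian O ->
  forall (f : {poly L}) (a c : L), pcoef O f -> O a -> max_ideal O c ->
  f.[a] = f^`().[a] ^+ 2 * c ->
  exists b, [/\ O b, root f b & pideal O (f^`().[a] * c) (b - a)].
Proof.
move=> [hO hens] f a c hf Oa mc; set D := f^`().[a] => fa.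
have Oc := max_idealO mc.
have OD : O D by apply: (pcoef_horner hO) => //; exact: pcoef_deriv.
pose m := size f.
(* Taylor's formula gives f (a + D c / Z) = D^2 c Z^-(m+2) G(Z) for the
   polynomial G = Z^(m+1) (Z + 1) + c S defined here; e_i is the Taylor
   coefficient of order i + 2 with its factor D^2 taken out. *)
pose e i := f^`N(i.+2).[a] * D ^+ i.
have Oe i : O (e i).
  apply: (vrM hO); last exact: vrX.
  by apply: (pcoef_horner hO) => // j; rewrite coef_nderivn; apply: vrMn.
pose S : {poly L} := \sum_(i < m) (e i * c ^+ i) *: 'X^(m - i).
have hS : pcoef O S.
  apply: (pcoef_sum hO) => i _; apply: (pcoefZ hO); last exact: pcoefXn.
  by apply: (vrM hO) => //; exact: vrX.
pose G : {poly L} := 'X^(m.+1) * ('X + 1%:P) + c *: S.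
have szS : (size S <= m.+1)%N.
  apply: leq_trans (size_sum _ _ _) _; apply/bigmax_leqP => i _.
  by apply: leq_trans (size_scale_leq _ _) _; rewrite size_polyXn ltnS leq_subr.
have monX : ('X^(m.+1) * ('X + 1%:P) : {poly L}) \is monic.
  by rewrite monicMl ?monicXn // -(opprK 1%:P) -polyCN monicXsubC.
have szX : size ('X^(m.+1) * ('X + 1%:P) : {poly L}) = m.+3.
  by rewrite mulrC size_mulXn ?size_XaddC ?addn2 // -size_poly_eq0 size_XaddC.
have monG : G \is monic.
  rewrite monicE lead_coefDl; first by rewrite -monicE.
  by rewrite szX; apply: leq_ltn_trans (size_scale_leq _ _) _; rewrite ltnS ltnW.
have hG : pcoef O G.
  apply: (pcoefD hO); last exact: pcoefZ.
  apply: (pcoefM hO); first exact: pcoefXn.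
  apply: (pcoefD hO); first exact: (pcoefXn hO 1).
  by apply: (pcoefC hO); exact: vr1.
have O1 : O (-1) by apply: (vrN hO); exact: vr1.
have G1 : max_ideal O G.[-1].
  rewrite /G !hornerE addNr mulr0 add0r mulrC.
  by apply: (max_idealM hO) => //; exact: pcoef_horner.
have G'1 : ~ max_ideal O G^`().[-1].
  apply: (@max_ideal_unitB _ _ hO _ ((-1) ^+ m.+1)).
    rewrite /G !derivE !hornerE addNr mulr0 add0r [_ - _]addrC addKr mulrC.
    by apply: (max_idealM hO) => //; apply: (pcoef_horner hO) => //; exact: pcoef_deriv.
  by apply: (unitP _); rewrite ?signr_eq0 ?invr_sign //; exact: vrX.
have [Z [OZ rZ mZ]] := hens G (-1) monG hG O1 G1 G'1.
have uZ : ~ max_ideal O Z.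
  apply: (max_ideal_unitB hO mZ); apply: (unitP O1); rewrite ?invrN1 //.
  by rewrite oppr_eq0 oner_eq0.
have [Z0 OZV] := unit_vrV hO OZ uZ.
exists (a + D * c / Z); split.
- by apply: (vrD hO) => //; apply: (vrM hO) => //; exact: vrM.
- have GE : f.[a + D * c / Z] = D ^+ 2 * c * Z ^- m.+2 * G.[Z].
    rewrite nderiv_taylor; last exact: mulrC.
    have -> : \sum_(i < size f) f^`N(i).[a] * (D * c / Z) ^+ i
            = \sum_(i < m.+2) f^`N(i).[a] * (D * c / Z) ^+ i.
      rewrite -[m.+2]addn2 big_split_ord /= [X in _ = _ + X]big1 ?addr0 // => i _.
      by rewrite nderivn_poly0 ?horner0 ?mul0r //= leq_addr.
    rewrite !big_ord_recl nderivn0 expr0 mulr1 fa poly.nderivn1 -/D expr1.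
    rewrite /G hornerD hornerM hornerXn hornerD hornerX hornerC hornerZ.
    rewrite /S horner_sum mulrDr !mulr_sumr addrA; congr (_ + _).
      rewrite [Z ^+ m.+2]exprS; field.
      by rewrite Z0 /= ?expf_neq0.
    apply: eq_bigr => i _; rewrite hornerZ hornerXn /bump /= /e.
    have -> : (Z ^- m.+2 = Z ^- (m - i) * Z ^- i.+2) by rewrite -invfM -exprD; congr (_ ^- _); have := ltn_ord i; lia.
    rewrite 2!exprMn exprVn; set z1 := Z ^+ i.+2; set z2 := Z ^+ (m - i).
    have z10 : z1 != 0 by rewrite expf_neq0.
    have z20 : z2 != 0 by rewrite expf_neq0.
    by rewrite [D ^+ i.+2]exprSr [D ^+ i.+1]exprSr [c ^+ i.+2]exprSr [c ^+ i.+1]exprSr; field; rewrite z10 z20.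
  by rewrite /root GE (rootP rZ) mulr0.
- by exists Z^-1 => //; rewrite addrAC subrr add0r.
Qed.

(** * Evaluating polynomials in several variables *)

Lemma mpoly_ring_ind (R : comNzRingType) n (P : {mpoly R[n]} -> Prop) :
  (forall c, P c%:MP) -> (forall i, P 'X_i) ->
  (forall p q, P p -> P q -> P (p + q)) ->
  (forall p q, P p -> P q -> P (p * q)) -> forall p, P p.
Proof.
move=> PC PX PD PM p; rewrite (mpolyE p).
have P0 : P 0 by rewrite -(mpolyC0 n R); apply: PC.
have P1 : P 1 by rewrite -(mpolyC1 n R); apply: PC.
elim/big_ind: _ => // m _; rewrite -mul_mpolyC; apply: (PM) => //.
rewrite mpolyXE_id; elim/big_ind: _ => // i _.
by elim: (m i) => [|k IH]; rewrite ?expr0 // exprS; apply: PM.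
Qed.

Section Evaluation.
Variables (K M : fieldType) (s : {rmorphism K -> M}) (n : nat).
Implicit Types (z : 'I_n -> M) (h : {mpoly K[n]}).

Definition mev z h : M := (map_mpoly s h).@[z].

Fact mev_zmod z : zmod_morphism (mev z).
Proof. by move=> p q; rewrite /mev !rmorphB. Qed.

Fact mev_monoid z : monoid_morphism (mev z).
Proof. by split=> [|p q]; rewrite /mev ?rmorph1 // !rmorphM. Qed.

HB.instance Definition _ z :=
  GRing.isZmodMorphism.Build {mpoly K[n]} M (mev z) (mev_zmod z).
HB.instance Definition _ z :=
  GRing.isMonoidMorphism.Build {mpoly K[n]} M (mev z) (mev_monoid z).

Lemma mevE z h : mev z h = (map_mpoly s h).@[z]. Proof. by []. Qed.

Lemma mevC z c : mev z c%:MP = s c.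
Proof. by rewrite /mev map_mpolyC mevalC. Qed.

Lemma mevXU z i : mev z 'X_i = z i.
Proof. by rewrite /mev map_mpolyX mevalXU. Qed.

Lemma mevD z : {morph mev z : p q / p + q}. Proof. exact: rmorphD. Qed.
Lemma mevB z : {morph mev z : p q / p - q}. Proof. exact: rmorphB. Qed.
Lemma mevM z : {morph mev z : p q / p * q}. Proof. exact: rmorphM. Qed.

End Evaluation.
Arguments mev {K M} s {n} z h.
(* Unification would otherwise unfold evaluations down to the sums over
   monomials that define them. *)
Opaque mev.

Lemma mev_comp (K M N : fieldType) (s : {rmorphism K -> M})
    (t : {rmorphism M -> N}) (u : {rmorphism K -> N}) n (z : 'I_n -> M) h :
  (forall c, t (s c) = u c) -> t (mev s z h) = mev u (t \o z) h.
Proof.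
move=> tu; elim/mpoly_ring_ind: h => [c|i|p q Hp Hq|p q Hp Hq].
- by rewrite !mevC.
- by rewrite !mevXU.
- by rewrite !mevD rmorphD /= Hp Hq.
- by rewrite !mevM rmorphM /= Hp Hq.
Qed.

Lemma mev_meval (K M : fieldType) (s : {rmorphism K -> M}) n (z : 'I_n -> K) h :
  mev s (s \o z) h = s h.@[z].
Proof.
elim/mpoly_ring_ind: h => [c|i|p q Hp Hq|p q Hp Hq].
- by rewrite !mevC mevalC.
- by rewrite !mevXU mevalXU.
- by rewrite mevD mevalD rmorphD Hp Hq.
- by rewrite mevM mevalM rmorphM Hp Hq.
Qed.

Section EvalValued.
Variables (K M : fieldType) (O : set M) (s : {rmorphism K -> M}).
Hypotheses (hO : valuation_ring O) (sO : forall c, O (s c)).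

Lemma mev_O n (z : 'I_n -> M) h : (forall i, O (z i)) -> O (mev s z h).
Proof.
move=> Oz; elim/mpoly_ring_ind: h => [c|i|p q Hp Hq|p q Hp Hq].
- by rewrite mevC.
- by rewrite mevXU.
- by rewrite mevD; apply: vrD.
- by rewrite mevM; apply: vrM.
Qed.

Lemma mev_pideal d n (y z : 'I_n -> M) h :
  (forall i, O (y i)) -> (forall i, O (z i)) ->
  (forall i, pideal O d (y i - z i)) -> pideal O d (mev s y h - mev s z h).
Proof.
move=> Oy Oz yz; elim/mpoly_ring_ind: h => [c|i|p q Hp Hq|p q Hp Hq].
- by rewrite !mevC subrr; apply: pideal0.
- by rewrite !mevXU.
- by rewrite !mevD opprD addrACA; apply: pidealD.
- rewrite !mevM; move: (mev_O p Oz) (mev_O q Oy) Hp Hq; set a := mev s y p; set b := mev s z p.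
  set a' := mev s y q; set b' := mev s z q; move: a b a' b' => a b a' b' Ob Oa' Hp Hq.
  rewrite (_ : _ - _ = a' * (a - b) + b * (a' - b')); last by ring.
  by apply: (pidealD hO); apply: (pidealM hO).
Qed.

End EvalValued.

(** Division with remainder requires a distinguished variable: [msplit] and
    [mjoin] pass from polynomials in [n.+1] variables to polynomials in the
    [i]-th one over the polynomials in the other [n] and back. *)
Section Split.
Variables (K : fieldType) (n : nat) (i : 'I_n.+1).

Definition msplitC : {rmorphism K -> {poly {mpoly K[n]}}} :=
  polyC \o @mpolyC n K.

Definition msplit : {mpoly K[n.+1]} -> {poly {mpoly K[n]}} :=
  mmap msplitC (fun j => if unlift i j is Some k then ('X_k)%:P else 'X).

Lemma msplitD : {morph msplit : p q / p + q}.
Proof. exact: mmapD. Qed.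

Lemma msplitM : {morph msplit : p q / p * q}.
Proof. exact: (mmap_is_multiplicative _ _).1. Qed.

Lemma msplitCE c : msplit c%:MP = (c%:MP)%:P.
Proof. exact: mmapC. Qed.

Lemma msplit_lift k : msplit 'X_(lift i k) = ('X_k)%:P.
Proof. by rewrite /msplit mmapX mmap1U liftK. Qed.

Lemma msplit_var : msplit 'X_i = 'X.
Proof. by rewrite /msplit mmapX mmap1U unlift_none. Qed.

Definition mlift : {mpoly K[n]} -> {mpoly K[n.+1]} :=
  mmap (@mpolyC n.+1 K) (fun j => 'X_(lift i j)).

Lemma mliftD : {morph mlift : p q / p + q}.
Proof. exact: mmapD. Qed.

Lemma mliftM : {morph mlift : p q / p * q}.
Proof. exact: (mmap_is_multiplicative _ _).1. Qed.

Lemma mliftC c : mlift c%:MP = c%:MP.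
Proof. exact: mmapC. Qed.

Lemma mliftX j : mlift 'X_j = 'X_(lift i j).
Proof. by rewrite /mlift mmapX mmap1U. Qed.

Opaque msplit mlift.

Definition mjoin (p : {poly {mpoly K[n]}}) : {mpoly K[n.+1]} :=
  \sum_(k < size p) mlift p`_k * 'X_i ^+ k.

Lemma mjoinE p : mjoin p = \sum_(k < size p) mlift p`_k * 'X_i ^+ k.
Proof. by []. Qed.
Opaque mjoin.
Variables (M : fieldType) (s : {rmorphism K -> M}).

Definition others (z : 'I_n.+1 -> M) : 'I_n -> M := fun j => z (lift i j).

Definition pev (z : 'I_n.+1 -> M) (p : {poly {mpoly K[n]}}) : {poly M} :=
  map_poly (mev s (others z)) p.

Lemma pevD z : {morph pev z : p q / p + q}. Proof. exact: rmorphD. Qed.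
Lemma pevM z : {morph pev z : p q / p * q}. Proof. exact: rmorphM. Qed.

Lemma pevC z c : pev z c%:P = (mev s (others z) c)%:P.
Proof. exact: map_polyC. Qed.
Lemma pevX z : pev z 'X = 'X.
Proof. exact: map_polyX. Qed.
Lemma pev0 z : pev z 0 = 0.
Proof. exact: rmorph0. Qed.
Lemma pev1 z : pev z 1 = 1.
Proof. exact: rmorph1. Qed.
Lemma coef_pev z p k : (pev z p)`_k = mev s (others z) p`_k.
Proof. exact: coef_map. Qed.
Lemma size_pev z p : (size (pev z p) <= size p)%N.
Proof. exact: size_poly. Qed.
Lemma deriv_pev z p : (pev z p)^`() = pev z p^`().
Proof. exact: deriv_map. Qed.

Definition hev z p := (pev z p).[z i].
Lemma hevE z p : hev z p = (pev z p).[z i].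
Proof. by []. Qed.
Lemma hevC z c : hev z c%:P = mev s (others z) c.
Proof. by rewrite /hev pevC hornerC. Qed.
Lemma hevX z : hev z 'X = z i.
Proof. by rewrite /hev pevX hornerX. Qed.
Lemma hev0 z : hev z 0 = 0.
Proof. by rewrite /hev pev0 horner0. Qed.
Lemma hev1 z : hev z 1 = 1.
Proof. by rewrite /hev pev1 hornerC. Qed.
Lemma hevD z : {morph hev z : p q / p + q}.
Proof. by move=> p q; rewrite /hev pevD hornerD. Qed.
Lemma hevM z : {morph hev z : p q / p * q}.
Proof. by move=> p q; rewrite /hev pevM hornerM. Qed.
Opaque pev hev.

Lemma pev_msplit z h : hev z (msplit h) = mev s z h.
Proof.
elim/mpoly_ring_ind: h => [c|j|p q Hp Hq|p q Hp Hq].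
- by rewrite msplitCE hevC !mevC.
- rewrite mevXU; case: (unliftP i j) => [k ->|->].
    by rewrite msplit_lift hevC mevXU.
  by rewrite msplit_var hevX.
- by rewrite msplitD hevD mevD -Hp -Hq.
- by rewrite msplitM hevM mevM -Hp -Hq.
Qed.

Lemma mev_mlift z h : mev s z (mlift h) = mev s (others z) h.
Proof.
elim/mpoly_ring_ind: h => [c|j|a b Ha Hb|a b Ha Hb].
- by rewrite mliftC !mevC.
- by rewrite mliftX !mevXU.
- by rewrite mliftD !mevD -Ha -Hb.
- by rewrite mliftM !mevM -Ha -Hb.
Qed.

Lemma mev_mjoin z p : mev s z (mjoin p) = hev z p.
Proof.
rewrite mjoinE hevE rmorph_sum /= (horner_coef_wide _ (size_pev z p)).
apply: eq_bigr => k _; rewrite mevM coef_pev -mev_mlift; congr (_ * _).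
by rewrite rmorphXn; congr (_ ^+ _); exact: mevXU.
Qed.

Lemma pev_msplit_deriv z h : hev z (msplit h)^`() = mev s z h^`M(i).
Proof.
elim/mpoly_ring_ind: h => [c|j|p q Hp Hq|p q Hp Hq].
- by rewrite msplitCE derivC mderivC hev0 rmorph0.
- rewrite mderivX mnm1E; case: (unliftP i j) => [k ->|->].
    by rewrite msplit_lift derivC hev0 eq_sym (negPf (neq_lift _ _)) scale0r rmorph0.
  rewrite msplit_var derivX eqxx scale1r hev1.
  by rewrite (_ : (U_(i) - U_(i))%MM = 0%MM) ?mpolyX0 ?rmorph1 //; apply/mnmP=> l; rewrite mnmBE subnn mnm0E.
- by rewrite msplitD mderivD derivD hevD mevD -Hp -Hq.
- rewrite msplitM mderivM derivM.
  rewrite hevD 2!hevM mevD 2!mevM -Hp -Hq.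
  by rewrite -!pev_msplit.
Qed.

Lemma pev_division z (c : {mpoly K[n]}) (p b q r : {poly {mpoly K[n]}}) : c *: p = b * q + r ->
  mev s (others z) c * hev z p
    = hev z b * hev z q + hev z r.
Proof.
move=> /(congr1 (fun p => hev z p)) E; move: E.
by rewrite -mul_polyC hevM hevC hevD hevM.
Qed.

Lemma pev_division_deriv z (c : {mpoly K[n]}) (p b q r : {poly {mpoly K[n]}}) : c *: p = b * q + r ->
  mev s (others z) c * hev z p^`()
    = hev z b^`() * hev z q
      + hev z b * hev z q^`() + hev z r^`().
Proof.
move=> /(congr1 (fun p => hev z p^`())) E; move: E.
rewrite derivZ derivD derivM -mul_polyC.
by rewrite hevM hevC hevD hevD hevM hevM.
Qed.

End Split.

(** * Separable extensions and lifting of points *)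

(** MacLane's form of separability: linear independence over [K] is preserved
    by the Frobenius map. *)
Definition separable_ext (K L : fieldType) (iota : {rmorphism K -> L}) : Prop :=
  forall p, p \in [pchar K] -> forall n (y : 'I_n -> L) (c : 'I_n -> K),
  (exists i, c i != 0) -> \sum_i iota (c i) * y i ^+ p = 0 ->
  exists2 d : 'I_n -> K, exists i, d i != 0 & \sum_i iota (d i) * y i = 0.

Lemma msize_mderiv_lt (K : fieldType) n (h : {mpoly K[n]}) i :
  h^`M(i) != 0 -> (msize h^`M(i) < msize h)%N.
Proof.
rewrite -msupp_eq0 => h0.
have lt m : m \in msupp h^`M(i) -> ((mdeg m).+1 < msize h)%N.
  rewrite mcoeff_msupp mcoeff_deriv => hm.
  have : (m + U_(i))%MM \in msupp h.
    by rewrite mcoeff_msupp; apply: contraNneq hm => ->; rewrite mul0rn.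
  by move/msize_mdeg_lt; rewrite mdegD mdeg1 addn1.
case E : (msupp h^`M(i)) h0 => [|m0 r] // _.
rewrite -(@ltn_predK 0 (msize h)); last first.
  by apply: leq_ltn_trans (lt m0 _); rewrite // E mem_head.
rewrite ltnS msizeE; apply/bigmax_leqP_seq => m hm _.
by rewrite -ltnS (ltn_predK (lt _ hm)) lt.
Qed.

(** The relation of least degree between the elements of a dependent family has
    a partial derivative that does not vanish on it: otherwise it would be a
    polynomial in the [p]-th powers of the variables, and separability would
    give a relation of smaller degree. *)
Lemma separable_relation (K L : fieldType) (iota : {rmorphism K -> L}) m
    (x : 'I_m -> L) (h : {mpoly K[m]}) :
  separable_ext iota -> h != 0 -> mev iota x h = 0 ->
  exists h i, mev iota x h = 0 /\ mev iota x h^`M(i) != 0.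
Proof.
move=> sep; have [N] := ubnP (msize h); elim: N h => // N IH h hN h0 hx.
have [[i]|ndx] := pselect (exists i, mev iota x h^`M(i) != 0); first by exists h, i.
have {}ndx i : mev iota x h^`M(i) = 0.
  by apply: contrapT => /eqP di; apply: ndx; exists i.
have [[i di]|nd] := pselect (exists i, h^`M(i) != 0).
  by apply: (IH h^`M(i)) => //; apply: leq_trans (msize_mderiv_lt di) _.
have coef0 k i : k \in msupp h -> (k i)%:R = 0 :> K.
  move=> hk; case ki: (k i) => [|l] //.
  have d0 : h^`M(i) = 0 by apply: contrapT => /eqP ?; apply: nd; exists i.
  have := mcoeff_deriv i (k - U_(i))%MM h.
  rewrite d0 mcoeff0 submK; last first.
    by apply/mnm_lepP => j; rewrite mnm1E; case: eqP => // <-; rewrite ki.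
  move=> /esym; rewrite mnmBE mnm1E eqxx ki subn1 /= => /eqP.
  by rewrite -[_@_ _ *+ _]mulr_natr mulf_eq0 (negPf (_ : h@_k != 0)) -?mcoeff_msupp // => /eqP.
have [k0 hk0 k0n0] : exists2 k, k \in msupp h & k != 0%MM.
  apply: contrapT => nk; have hC : h = (h@_0%MM)%:MP.
    apply/mpolyP => k; rewrite mcoeffC; have [->|k0] := eqVneq k 0%MM.
      by rewrite mulr1.
    rewrite mulr0; apply/eqP; rewrite mcoeff_eq0; apply/negP => hk.
    by apply: nk; exists k.
  move: hx h0; rewrite hC mevC => /eqP; rewrite fmorph_eq0 => /eqP ->.
  by rewrite mpolyC0 eqxx.
have [i0 k0i] : exists i, k0 i != 0%N.
  apply: contrapT => ni; case/eqP: k0n0; apply/mnmP => i; rewrite mnm0E.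
  by apply/eqP; apply: contrapT => /negP ?; apply: ni; exists i.
have [p hp] : exists p, p \in [pchar K].
  by case: (natf0_pchar (R := K) (n := k0 i0)); rewrite ?lt0n ?coef0 // => p; exists p.
have p_gt1 : (1 < p)%N by apply: prime_gt1; exact: pcharf_prime hp.
pose dv (k : 'X_{1..m}) : 'X_{1..m} := [multinom (k i %/ p)%N | i < m].
have dvK k : k \in msupp h -> k = (dv k *+ p)%MM.
  move=> hk; apply/mnmP => i; rewrite mulmnE mnmE divnK //.
  by rewrite (dvdn_pcharf hp) coef0.
pose mon (j : 'I_(size (msupp h))) := nth 0%MM (msupp h) j.
have monh j : mon j \in msupp h by apply: mem_nth.
have [d [j dj0] sumd] : exists2 d : 'I_(size (msupp h)) -> K, exists j, d j != 0
    & \sum_j iota (d j) * mev iota x 'X_[dv (mon j)] = 0.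
  apply: (sep p hp _ _ (fun j => h@_(mon j))).
    have lt0 : (0 < size (msupp h))%N by rewrite lt0n size_eq0 msupp_eq0.
    by exists (Ordinal lt0); rewrite -mcoeff_msupp.
  rewrite -[RHS]hx [in RHS](mpolyE h) (big_nth 0%MM) big_mkord rmorph_sum /=.
  apply: eq_bigr => j _; rewrite -mul_mpolyC mevM mevC; congr (_ * _).
  by rewrite -rmorphXn mpolyXn -dvK.
pose h' := \sum_j d j *: 'X_[dv (mon j)] : {mpoly K[m]}.
have h'j : h'@_(dv (mon j)) = d j.
  rewrite /h' raddf_sum (bigD1 j) //= mcoeffZ mcoeffX eqxx mulr1 big1 ?addr0 // => l lj.
  rewrite mcoeffZ mcoeffX; case: eqP => [e|]; rewrite ?mulr0 //.
  case/eqP: lj; apply/val_inj/eqP; rewrite -(nth_uniq 0%MM (ltn_ord l) (ltn_ord j) (msupp_uniq h)).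
  by rewrite -/(mon l) -/(mon j) [mon l]dvK // [mon j]dvK // e.
have lt_h' : (msize h' < msize h)%N.
  have szh : (1 < msize h)%N.
    by apply: leq_ltn_trans _ (msize_mdeg_lt hk0); rewrite lt0n mdeg_eq0.
  rewrite -(@ltn_predK 0 (msize h)) ?(ltn_trans _ szh) // ltnS.
  apply: leq_trans (msize_sum _ _ _) _; apply/bigmax_leqP => l _.
  apply: leq_trans (msizeZ_le _ _) _; rewrite msizeX -ltnS (ltn_predK szh).
  have /msize_mdeg_lt := monh l; rewrite {1}[mon l]dvK // mdegMn.
  set D := mdeg _; case: (posnP D) => [->|D0]; first by move=> _; exact: szh.
  by move=> lt; apply: leq_ltn_trans lt; rewrite ltn_Pmulr.
apply: (IH h'); first exact: leq_trans lt_h' _.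
  by apply: contraNneq dj0 => e; rewrite -h'j e mcoeff0.
rewrite /h' rmorph_sum /= -[RHS]sumd; apply: eq_bigr => l _.
by rewrite -mul_mpolyC mevM mevC.
Qed.

Lemma pseudo_division (A : idomainType) (p q : {poly A}) : q != 0 ->
  exists k b r, lead_coef q ^+ k *: p = b * q + r /\ (size r < size q)%N.
Proof.
move=> q0; exists (Pdiv.IdomainDefs.scalp p q), (Pdiv.IdomainDefs.divp p q).
exists (Pdiv.IdomainDefs.modp p q); split; first exact: Pdiv.WeakIdomain.divp_eq.
by rewrite Pdiv.CommonIdomain.ltn_modp.
Qed.

Lemma mpseudo_division (K : fieldType) n (p q : {poly {mpoly K[n]}}) : q != 0 ->
  exists k (b r : {poly {mpoly K[n]}}),
    lead_coef q ^+ k *: p = b * q + r /\ (size r < size q)%N.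
Proof. exact: pseudo_division. Qed.

(** A family [x] with this property behaves like the generic point of a variety
    which is smooth over [K] away from the zeros of [G]: an approximate integral
    zero [a] of the equations [f] of [x] over a henselian field, the error being
    small compared to [G(a)], is close to a common zero of all the equations
    satisfied by [x].  The last clause provides a coordinate that need not be
    changed, unless all the [x_j] are algebraic over [K]. *)
Definition liftable (K L : fieldType) (iota : {rmorphism K -> L}) m
    (x : 'I_m -> L) : Prop :=
  exists n (f : 'I_n -> {mpoly K[m]}) (G : {mpoly K[m]}),
  [/\ forall i, mev iota x (f i) = 0, mev iota x G != 0 &
  forall (M : fieldType) (O : set M) (s : {rmorphism K -> M}),
    henselian O -> (forall c, O (s c)) ->
  forall (a : 'I_m -> M) (d : M), (forall j, O (a j)) -> mev s a G != 0 ->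
    max_ideal O d -> (forall i, pideal O (mev s a G * d) (mev s a (f i))) ->
  exists xi : 'I_m -> M,
    [/\ forall j, O (xi j), forall j, pideal O d (xi j - a j),
        forall h, mev iota x h = 0 -> mev s xi h = 0
      & (forall j, algebraicOver iota (x j)) \/ exists j, xi j = a j]].

(** The polynomial [q] plays the role of the minimal polynomial of [x_i] over the
    field generated by the other [x_j], its coefficients being polynomials in
    them. *)
Section LiftStep.
Variables (K L : fieldType) (iota : {rmorphism K -> L}) (m : nat).
Variables (x : 'I_m.+1 -> L) (i : 'I_m.+1) (q : {poly {mpoly K[m]}}).
Hypotheses (q0 : pev i iota x q != 0) (qx : hev i iota x q = 0).
Hypothesis q_min : forall r : {poly {mpoly K[m]}}, (size r < size q)%N ->
  hev i iota x r = 0 -> pev i iota x r = 0.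

(** Otherwise [q] without its leading term would be a smaller relation. *)
Lemma minimal_lead_neq0 : mev iota (others i x) (lead_coef q) != 0.
Proof.
have qn0 : q != 0 by apply: contraNneq q0 => ->; rewrite pev0.
apply: contraNneq q0 => l0; have qE : pev i iota x q = pev i iota x (take_poly (size q).-1 q).
  apply/polyP => k; rewrite (coef_pev _ _ _ q) (coef_pev _ _ _ (take_poly _ _)).
  rewrite coef_take_poly; case: ltnP => // le; rewrite rmorph0.
  move: le; rewrite leq_eqVlt => /predU1P[<-|lt]; first exact: l0.
  by rewrite nth_default ?rmorph0 // -(ltn_predK (_ : 0 < size q)%N) ?size_poly_gt0.
rewrite qE; apply/eqP/q_min; last by rewrite hevE -qE -hevE.
apply: leq_ltn_trans (size_take_poly _ _) _.
by rewrite ltn_predL size_poly_gt0.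
Qed.

(** Pseudo-division of [h] by [q] leaves a remainder which is a smaller relation
    of [x_i], so its coefficients vanish at the other [x_j], and then also at the
    other [z_j]. *)
Lemma minimal_relation_transfer (M : fieldType) (s : {rmorphism K -> M})
    (z : 'I_m.+1 -> M) :
  (forall h, mev iota (others i x) h = 0 -> mev s (others i z) h = 0) ->
  mev s (others i z) (lead_coef q) != 0 -> hev i s z q = 0 ->
  forall h, mev iota x h = 0 -> mev s z h = 0.
Proof.
move=> tr l0 qz h hx; have qn0 : q != 0 by apply: contraNneq q0 => ->; rewrite pev0.
have [k [b [r [E lt]]]] := mpseudo_division (msplit i h) qn0.
have EM (N : fieldType) (u : {rmorphism K -> N}) y : mev u (others i y) (lead_coef q) ^+ k * mev u y h = hev i u y b * hev i u y q + hev i u y r.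
  by rewrite -(pev_division i u y E) pev_msplit rmorphXn.
have rx : pev i iota x r = 0.
  by apply: q_min lt _; have := EM _ iota x; rewrite hx qx !mulr0 add0r.
have rz : pev i s z r = 0.
  apply/polyP => l; rewrite coef0 coef_pev; apply: tr.
  by rewrite -coef_pev rx coef0.
have /eqP := EM _ s z; rewrite (hevE i s z r) rz qz mulr0 horner0 addr0 mulf_eq0.
by rewrite expf_eq0 (negPf l0) andbF /= => /eqP.
Qed.

(** In the pseudo-division of [h] by [q] the remainder vanishes, so that a double
    root of [q] would be a double root of [h]. *)
Lemma minimal_separable h : mev iota x h = 0 -> mev iota x h^`M(i) != 0 ->
  hev i iota x q^`() != 0.
Proof.
move=> hx; apply: contraNneq => q'x.
have qn0 : q != 0 by apply: contraNneq q0 => ->; rewrite pev0.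
have [k [b [r [E lt]]]] := mpseudo_division (msplit i h) qn0.
have rx : pev i iota x r = 0.
  apply: q_min lt _; have := pev_division i iota x E.
  by rewrite pev_msplit qx hx !mulr0 add0r => /esym.
have /eqP := pev_division_deriv i iota x E.
rewrite pev_msplit_deriv qx q'x (hevE i iota x r^`()) -(deriv_pev _ _ _ r) rx deriv0 horner0.
rewrite !mulr0 !addr0 mulf_eq0 rmorphXn expf_eq0 (negPf minimal_lead_neq0).
by rewrite andbF.
Qed.

(** The other coordinates are lifted first.  Moving them changes the value and
    the derivative of [q] at [a_i] only slightly, so that Newton's form of
    Hensel's lemma provides the [i]-th coordinate. *)
Lemma liftable_step : hev i iota x q^`() != 0 ->
  liftable iota (others i x) -> liftable iota x.
Proof.
move=> q'x [n [f [G [fx Gx lft]]]].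
pose l := lead_coef q; pose D := mjoin i q^`().
have evG (N : fieldType) (u : {rmorphism K -> N}) y :
    mev u y (mlift i G * (mlift i l * D ^+ 2))
      = mev u (others i y) G * (mev u (others i y) l * mev u y D ^+ 2).
  rewrite mevM mev_mlift; congr (_ * _).
  by rewrite mevM mev_mlift; congr (_ * _); rewrite rmorphXn.
exists n.+1, (fun k => if unlift ord0 k is Some k' then mlift i (f k') else mjoin i q).
exists (mlift i G * (mlift i l * D ^+ 2)); split.
- by move=> k; case: unlift => [k'|]; rewrite ?mev_mlift // mev_mjoin.
- rewrite evG mev_mjoin mulf_neq0 // mulf_neq0 ?expf_neq0 //.
  exact: minimal_lead_neq0.
move=> M O s hens sO a d Oa Ga0 md fa.
have hO := hens.1; have Od := max_idealO md.
move: Ga0 fa; rewrite evG.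
set G0 := mev s _ G; set l0 := mev s _ l; set D0 := mev s a D => Ga0 fa.
have [G00 l00 D00] : [/\ G0 != 0, l0 != 0 & D0 != 0].
  by move: Ga0; rewrite !mulf_eq0 !negb_or => /and4P[].
have OG0 : O G0 by apply: mev_O => // j; exact: Oa.
have Ol0 : O l0 by apply: mev_O => // j; exact: Oa.
have OD0 : O D0 by exact: mev_O.
(* Lifting the other coordinates to the precision l D^2 d keeps the leading
   coefficient nonzero, the derivative equal to D times a unit, and the value
   of q divisible by D^2 d. *)
pose d1 := l0 * D0 ^+ 2 * d.
have md1 : max_ideal O d1.
  by apply: max_idealM => //; apply: vrM => //; exact: vrX.
have [] := lft M O s hens sO (others i a) d1 _ G00 md1.
- by move=> j; exact: Oa.
- move=> k; have := fa (lift ord0 k); rewrite liftK mev_mlift.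
  by rewrite /d1 -!mulrA.
move=> xi0 [Oxi0 xi0a rel0 alt].
pose ext b := fun j => if unlift i j is Some k then xi0 k else b.
have ext_i b : ext b i = b by rewrite /ext unlift_none.
have ext_l b k : ext b (lift i k) = xi0 k by rewrite /ext liftK.
have oth b : others i (ext b) = xi0 by apply/funext => k; rewrite /others ext_l.
pose z := ext (a i).
have Oz j : O (z j) by rewrite /z /ext; case: unlift.
have za j : pideal O d1 (z j - a j).
  case: (unliftP i j) => [k ->|->]; first by rewrite /z ext_l; exact: xi0a.
  by rewrite /z ext_i subrr; exact: pideal0.
have mz h : pideal O d1 (mev s z h - mev s a h) by exact: mev_pideal.
have [r Or qz] : pideal O d1 (mev s z (mjoin i q)).
  have := fa ord0; rewrite unlift_none => qa.
  rewrite -(subrK (mev s a (mjoin i q)) (mev s z _)); apply: (pidealD hO) => //.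
  move: qa => [r Or ->]; exists (G0 * r); first exact: vrM.
  by rewrite /d1; ring.
have [r' Or' D'z] := mz D; rewrite -/D0 in D'z.
pose u := 1 + l0 * D0 * d * r'.
have Dz : mev s z D = D0 * u.
  by rewrite -(subrK D0 (mev s z D)) D'z /d1 /u; ring.
have Ou : O u.
  apply: (vrD hO); first exact: vr1.
  by apply: (vrM hO) => //; apply: (vrM hO) => //; exact: vrM.
have [u0 OuV] : u != 0 /\ O u^-1.
  apply: (unit_vrV hO) => //; apply: (@max_ideal_unitB _ _ hO _ 1).
    rewrite /u [_ - 1]addrC addKr mulrC; apply: max_idealM => //.
    by apply: max_idealM => //; exact: vrM.
  exact: max_ideal1.
(* The value of q is d1 r, the square of its derivative D u times this c. *)
pose c := d * l0 * r * u^-1 ^+ 2.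
have mc : max_ideal O c.
  rewrite /c -!mulrA mulrC; apply: max_idealM => //.
  by apply: (vrM hO) => //; apply: (vrM hO) => //; exact: vrX.
have zi : z i = a i by exact: ext_i.
have pO : pcoef O (pev i s z q).
  by move=> k; rewrite coef_pev /z oth; exact: mev_O.
have dq : (pev i s z q)^`().[a i] = D0 * u.
  by rewrite deriv_pev -zi -hevE -mev_mjoin.
have [|b [Ob rb ba]] := henselian_newton hens pO (Oa i) mc.
  rewrite dq -zi -hevE -mev_mjoin qz /d1 /c; field; exact: u0.
exists (ext b); split.
- by move=> j; rewrite /ext; case: unlift.
- move=> j; case: (unliftP i j) => [k ->|->].
    rewrite ext_l; apply: (pidealW hO _ (xi0a k)).
    by exists (l0 * D0 ^+ 2); rewrite /d1 1?mulrC //; apply: (vrM hO) => //; exact: vrX.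
  rewrite ext_i; apply: (pidealW hO _ ba); rewrite dq.
  exists (D0 * l0 * r * u^-1).
    by apply: (vrM hO) => //; apply: (vrM hO) => //; exact: vrM.
  by rewrite /c; field; exact: u0.
- apply: minimal_relation_transfer; rewrite ?oth //.
    have [r2 Or2 E] := mz (mlift i l); move: E; rewrite !mev_mlift /z oth -/l -/l0.
    move=> /(canRL (subrK _)) ->.
    rewrite (_ : _ + _ = l0 * (1 + D0 ^+ 2 * d * r2)); last by rewrite /d1; ring.
    rewrite mulf_neq0 //; apply: contra_not_neq (@max_ideal1 _ _ hO) => e.
    rewrite -[1](addrK (D0 ^+ 2 * d * r2)) e sub0r; apply: (max_idealN hO).
    rewrite mulrC mulrA; apply: max_idealM => //.
    by apply: (vrM hO) => //; exact: vrX.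
  rewrite hevE ext_i; have -> : pev i s (ext b) q = pev i s z q.
    by apply/polyP => k; rewrite !coef_pev /z !oth.
  exact/rootP.
- case: alt => [alg|[k xik]]; last by right; exists (lift i k); rewrite ext_l.
  left => j; case: (unliftP i j) => [k ->|->]; first exact: alg.
  apply/integral_algebraic; apply: (integral_root q0); first by apply/rootP; rewrite -hevE.
  apply/integral_poly => k; rewrite coef_pev.
  elim/mpoly_ring_ind: q`_k => [c'|k'|p1 p2 h1 h2|p1 p2 h1 h2].
  - by rewrite mevC; apply: integral_id.
  - by rewrite mevXU; apply/integral_algebraic/alg.
  - by rewrite mevD; apply: integral_add.
  - by rewrite mevM; apply: integral_mul.
Qed.

End LiftStep.

(** Every family in a separable extension is liftable: either it is
    algebraically independent, and then there is no equation, or one of its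
    members is separably algebraic over the others and is lifted by Newton's
    method from a lifting of the others. *)
Theorem separable_liftable (K L : fieldType) (iota : {rmorphism K -> L}) m
    (x : 'I_m -> L) : separable_ext iota -> liftable iota x.
Proof.
move=> sep; elim: m x => [|m IH] x; have [[h [hx h0]]|indep] :=
    pselect (exists h, mev iota x h = 0 /\ h != 0).
- by have [h' [[]]] := separable_relation sep h0 hx.
- exists 0, (fun i => 0), 1; split; rewrite ?rmorph1 ?oner_neq0 //; first by case.
  move=> M O s _ sO a d Oa _ _ _; exists a; split=> // [[]|h hx|]//; last by left; case.
  have [->|h0] := eqVneq h 0; first by rewrite rmorph0.
  by case: indep; exists h.
- have [h' [i [h'x dh']]] := separable_relation sep h0 hx.
  have ex : exists n, `[< exists q : {poly {mpoly K[m]}}, [/\ size q = n, pev i iota x q != 0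
      & hev i iota x q = 0] >].
    exists (size (msplit i h')); apply/asboolP; exists (msplit i h').
    rewrite pev_msplit; split=> //; apply: contraNneq dh' => e.
    by rewrite -pev_msplit_deriv hevE -deriv_pev e deriv0 horner0.
  case: (ex_minnP ex) => N /asboolP[q [szq q0 qx]] minN.
  have q_min (r : {poly {mpoly K[m]}}) : (size r < size q)%N -> hev i iota x r = 0 -> pev i iota x r = 0.
    rewrite szq => lt rx; apply: contrapT => /eqP r0; move: lt; rewrite ltnNge minN //.
    by apply/asboolP; exists r.
  apply: (liftable_step q0 qx q_min) => //.
  exact: (minimal_separable q0 qx q_min h'x dh').
- exists 0, (fun i => 0), 1; split; rewrite ?rmorph1 ?oner_neq0 //; first by case.
  move=> M O s hens sO a d Oa _ _ _; exists a; split=> // [j|h hx|].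
  + by rewrite subrr; apply: pideal0; exact: hens.1.
  + have [->|h0] := eqVneq h 0; first by rewrite rmorph0.
    by case: indep; exists h.
  + by right; exists ord0.
Qed.

(** * Evaluating rational functions at a transcendental element *)

Section FracLift.
Variables (A : idomainType) (F : fieldType) (phi : {rmorphism A -> F}).

Lemma frac_repr (x : {fraction A}) :
  exists nd : A * A, nd.2 != 0 /\ x = tofrac nd.1 / tofrac nd.2.
Proof.
elim/quotW: x => y; exists (\n_y, \d_y); split; first exact: denom_ratioP.
have d0 : tofrac \d_y != 0 by rewrite tofrac_eq0 denom_ratioP.
apply: (canRL (mulfK d0)).
rewrite !piE /= ; apply/eqmodP => /=; rewrite /FracField.equivf /FracField.mulf /=.
rewrite !numden_Ratio ?oner_neq0 ?mulf_neq0 ?denom_ratioP //=.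
  by rewrite !mulr1 mulrC.
all: exact: oner_neq0.
Qed.

Definition frac_lift (inj : injective phi) (x : {fraction A}) : F :=
  let nd := projT1 (cid (frac_repr x)) in phi nd.1 / phi nd.2.

Hypothesis inj : injective phi.

Lemma frac_liftE n d : d != 0 ->
  frac_lift inj (tofrac n / tofrac d) = phi n / phi d.
Proof.
move=> d0; rewrite /frac_lift; case: cid => -[n' d'] [/= d'0 E].
have phi0 a : a != 0 -> phi a != 0.
  by apply: contraNneq => e; apply/eqP/inj; rewrite e rmorph0.
apply/eqP; rewrite eqr_div ?phi0 // -!rmorphM; apply/eqP; congr (phi _).
apply/eqP; rewrite -tofrac_eq !tofracM -eqr_div ?tofrac_eq0 //.
by rewrite E.
Qed.

Fact frac_lift_zmod : zmod_morphism (frac_lift inj).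
Proof.
have phi0 a : a != 0 -> phi a != 0.
  by apply: contraNneq => e; apply/eqP/inj; rewrite e rmorph0.
move=> x y; have [[n d] [/= d0 ->]] := frac_repr x.
have [[n' d'] [/= d'0 ->]] := frac_repr y.
rewrite !frac_liftE // -!mulNr -rmorphN addf_div ?tofrac_eq0 //.
rewrite -!tofracM -tofracD frac_liftE ?mulf_neq0 //.
by rewrite -rmorphN addf_div ?phi0 // -!rmorphM -rmorphD.
Qed.

Fact frac_lift_monoid : monoid_morphism (frac_lift inj).
Proof.
split=> [|x y].
  have -> : (1 : {fraction A}) = tofrac 1 / tofrac 1 by rewrite tofrac1 divr1.
  by rewrite frac_liftE ?oner_neq0 // rmorph1 divr1.
have [[n d] [/= d0 ->]] := frac_repr x; have [[n' d'] [/= d'0 ->]] := frac_repr y.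
rewrite mulf_div -!tofracM !frac_liftE ?mulf_neq0 //.
by rewrite !rmorphM mulf_div.
Qed.

HB.instance Definition _ := GRing.isZmodMorphism.Build _ _ _ frac_lift_zmod.
HB.instance Definition _ := GRing.isMonoidMorphism.Build _ _ _ frac_lift_monoid.

Lemma frac_lift_tofrac a : frac_lift inj (tofrac a) = phi a.
Proof.
by rewrite -[tofrac a]divr1 -tofrac1 frac_liftE ?oner_neq0 // rmorph1 divr1.
Qed.

End FracLift.

Section RatfunEmbedding.
Variables (K F : fieldType) (iota : {rmorphism K -> F}).

Definition pval (u : F) : {rmorphism {poly K} -> F} :=
  horner_eval u \o map_poly iota.

Lemma pvalE u p : pval u p = (map_poly iota p).[u]. Proof. by []. Qed.

Lemma pvalX u : pval u 'X = u.
Proof. by rewrite pvalE map_polyX hornerX. Qed.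

Lemma pvalC u c : pval u c%:P = iota c.
Proof. by rewrite pvalE map_polyC hornerC. Qed.

Definition transcendental (u : F) := injective (pval u).

Lemma transcendentalP u :
  (forall p, pval u p = 0 -> p = 0) -> transcendental u.
Proof.
by move=> h p q e; apply/eqP; rewrite -subr_eq0; apply/eqP/h; rewrite rmorphB e subrr.
Qed.

Lemma transcendentalN u : ~ algebraicOver iota u <-> transcendental u.
Proof.
split=> [nalg|tr [p p0 /rootP e]].
  apply: transcendentalP => p pu; apply: contrapT => /eqP p0; apply: nalg.
  by exists p => //; apply/rootP.
by case/eqP: p0; apply: tr; rewrite rmorph0.
Qed.

Definition ratval u (tr : transcendental u) : {rmorphism ratfun K -> F} :=
  frac_lift tr.

Variables (u : F) (tr : transcendental u).

Lemma ratvalE p q : q != 0 -> ratval tr (tofrac p / tofrac q) = pval u p / pval u q.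
Proof. exact: frac_liftE. Qed.

Lemma ratval_tofrac p : ratval tr (tofrac p) = pval u p.
Proof. exact: frac_lift_tofrac. Qed.

Lemma ratvalC c : ratval tr (ratfunC K c) = iota c.
Proof. by rewrite ratval_tofrac pvalE map_polyC hornerC. Qed.

Lemma ratvalX : ratval tr (tofrac 'X) = u.
Proof. by rewrite ratval_tofrac pvalE map_polyX hornerX. Qed.

End RatfunEmbedding.

(** * The t-adic valuation of K(t) *)

Definition rt (K : fieldType) : ratfun K := tofrac 'X.

Lemma rt_neq0 (K : fieldType) : rt K != 0.
Proof. by rewrite tofrac_eq0 polyX_eq0. Qed.

Lemma rtXn (K : fieldType) n : rt K ^+ n = tofrac ('X^n : {poly K}).
Proof. by rewrite tofracXn. Qed.
Opaque rt.

Lemma tadic_poly (K : fieldType) (p : {poly K}) : tadic_ring (tofrac p).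
Proof. by exists p, 1; rewrite hornerC oner_neq0 tofrac1 divr1. Qed.

(** The two natural exponents stand for the integer [n - m], the order of [x] at
    the origin. *)
Lemma tadic_unit_decomp (K : fieldType) (x : ratfun K) : x != 0 ->
  exists (m n : nat) (p q : {poly K}), [/\ p.[0] != 0, q.[0] != 0
    & x * rt K ^+ m = tofrac p / tofrac q * rt K ^+ n].
Proof.
move=> x0; have [[a b] [/= b0 E]] := frac_repr x.
have a0 : a != 0 by apply: contraNneq x0 => a0; rewrite E a0 tofrac0 mul0r.
have dec (c : {poly K}) : c != 0 -> exists n (p : {poly K}), p.[0] != 0 /\ c = p * 'X^n.
  move=> c0; have [n [p]] := multiplicity_XsubC c 0.
  rewrite c0 subr0 => /= p0 ->; exists n, p; split=> //.
have [n [p [p0 aE]]] := dec a a0; have [m [q [q0 bE]]] := dec b b0.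
exists m, n, p, q; split=> //.
have nz (c : {poly K}) : c.[0] != 0 -> tofrac c != 0.
  by rewrite tofrac_eq0; apply: contraNneq => ->; rewrite horner0.
have t0 := rt_neq0 K.
rewrite E aE bE !tofracM -!rtXn.
have gen (F : fieldType) (P Q T S : F) : Q != 0 -> T != 0 ->
  P * S / (Q * T) * T = P / Q * S by move=> Q0 T0; field; rewrite Q0 T0.
by apply: gen; [exact: nz|exact: expf_neq0].
Qed.

Lemma tadicM (K : fieldType) (x y : ratfun K) :
  tadic_ring x -> tadic_ring y -> tadic_ring (x * y).
Proof.
move=> [p [q [q0 ->]]] [p' [q' [q'0 ->]]]; exists (p * p'), (q * q').
by rewrite hornerM mulf_neq0 // mulf_div !tofracM.
Qed.

Lemma tadic_unit (K : fieldType) (p q : {poly K}) : p.[0] != 0 -> q.[0] != 0 ->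
  tadic_ring (tofrac p / tofrac q) /\ tadic_ring (tofrac p / tofrac q)^-1.
Proof.
by move=> p0 q0; split; [exists p, q|exists q, p; rewrite invf_div].
Qed.

Lemma tadicNt (K : fieldType) (n : nat) : (0 < n)%N -> ~ tadic_ring ((rt K) ^- n).
Proof.
move=> n0 [p [q [q0 /eqP]]]; rewrite -div1r eqr_div ?expf_neq0 ?rt_neq0 //; last first.
  by rewrite tofrac_eq0; apply: contraNneq q0 => ->; rewrite horner0.
rewrite mul1r rtXn -tofracM tofrac_eq => /eqP/(congr1 (fun p => p.[0])).
by move/eqP; rewrite hornerM hornerXn expr0n gtn_eqF //= mulr0 (negPf q0).
Qed.

Lemma tadic_bounded (K : fieldType) (x : ratfun K) :
  exists m, tadic_ring (x * rt K ^+ m).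
Proof.
have [->|x0] := eqVneq x 0; first by exists 0; rewrite mul0r -tofrac0; exact: tadic_poly.
have [m [n [p [q [p0 q0 E]]]]] := tadic_unit_decomp x0; exists m; rewrite E.
by apply: tadicM; [exists p, q|rewrite rtXn; exact: tadic_poly].
Qed.

(** When [u] has positive value, the value at [u] of a polynomial is congruent to
    its constant term, hence a unit if this term is not zero.  Taking out powers
    of [u] one sees that [u] is transcendental over the field of constants, and
    that the valuation induced on [K(u)] is the [u]-adic one. *)
Section SmallElement.
Variables (K M : fieldType) (iota : {rmorphism K -> M}) (O : set M) (u : M).
Hypotheses (hO : valuation_ring O) (cO : forall c, O (iota c)).
Hypotheses (mu : max_ideal O u) (u0 : u != 0).

Lemma pval_const p : max_ideal O (pval iota u p - iota p.[0]).
Proof.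
elim/poly_ind: p => [|p c IH].
  by rewrite rmorph0 horner0 rmorph0 subrr; exact: max_ideal0.
rewrite rmorphD rmorphM pvalX pvalC hornerD hornerM hornerX mulr0 add0r hornerC.
rewrite addrK; apply: max_idealM => //.
have [h _] := IH; rewrite -(subrK (iota p.[0]) (pval iota u p)).
exact: (vrD hO).
Qed.

Lemma pval_O p : O (pval iota u p).
Proof.
by rewrite -(subrK (iota p.[0]) (pval iota u p)); apply: (vrD hO) => //; case: (pval_const p).
Qed.

Lemma pval_unit p : p.[0] != 0 -> pval iota u p != 0 /\ O (pval iota u p)^-1.
Proof.
move=> p0; apply: (unit_vrV hO); first exact: pval_O.
apply: (max_ideal_unitB hO (pval_const p)); apply: unitP => //.
  by rewrite -fmorphV.
by rewrite fmorph_eq0.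
Qed.

Lemma small_transcendental : transcendental iota u.
Proof.
apply: transcendentalP => p pu; apply: contrapT => /eqP p0.
have [n [q]] := multiplicity_XsubC p 0; rewrite p0 subr0 /= => q0 pE.
have [] := pval_unit (p := q); first exact: q0.
move=> /eqP[]; apply: (mulIf (expf_neq0 n u0)).
by rewrite mul0r -[RHS]pu pE rmorphM rmorphXn pvalX.
Qed.

Lemma small_expN n : (0 < n)%N -> ~ O (u ^- n).
Proof.
move=> n0 On; have [_ []] := mu; exists (u ^+ n.-1 * u ^- n).
  by apply: (vrM hO) => //; apply: (vrX hO); case: mu.
by rewrite mulrA -exprS prednK // divff // expf_neq0.
Qed.

Lemma ratval_rt (tr : transcendental iota u) : ratval tr (rt K) = u.
Proof. by rewrite -[rt K]expr1 rtXn expr1 ratvalX. Qed.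

Lemma small_tadic (tr : transcendental iota u) :
  valued_embedding (@tadic_ring K) O (ratval tr).
Proof.
have dir q : tadic_ring q -> O (ratval tr q).
  move=> [p [d [d0 ->]]]; rewrite fmorph_div /= !ratval_tofrac.
  by apply: (vrM hO); [exact: pval_O|exact: (pval_unit d0).2].
move=> r; split=> [|Or]; first exact: dir.
have [->|r0] := eqVneq r 0; first by rewrite -tofrac0; exact: tadic_poly.
have [m [n [p [q [p0 q0 E]]]]] := tadic_unit_decomp r0.
have [w wV] := tadic_unit p0 q0; move: w wV E; move: (tofrac p / tofrac q) => y w wV E.
have y0 : y != 0.
  have gen (F : fieldType) (a b T : F) : T != 0 -> a != 0 ->
      a * T ^+ m = b * T ^+ n -> b != 0.
    move=> T0 a0 E1; apply: contra_eq_neq E1 => ->.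
    by rewrite mul0r mulf_neq0 ?expf_neq0.
  exact: gen (rt_neq0 K) r0 E.
have [mn|nm] := leqP m n.
  have gen (F : fieldType) (a b T : F) : T != 0 -> a * T ^+ m = b * T ^+ n ->
      a = b * T ^+ (n - m).
    by move=> T0 E1; apply: (mulIf (expf_neq0 m T0)); rewrite E1 -mulrA -exprD subnK.
  rewrite (gen _ _ _ _ (rt_neq0 K) E).
  by apply: tadicM => //; rewrite rtXn; exact: tadic_poly.
exfalso; have /dir Oy := wV; apply: (@small_expN (m - n)); first by rewrite subn_gt0.
have := vrM hO Oy Or; rewrite -rmorphM /=.
have E' : y^-1 * r * rt K ^+ (m - n) = 1.
  have gen (F : fieldType) (a b T : F) : T != 0 -> b != 0 ->
      a * T ^+ m = b * T ^+ n -> b^-1 * a * T ^+ (m - n) = 1.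
    move=> T0 b0 E1; apply: (mulIf (expf_neq0 n T0)).
    by rewrite mul1r -!mulrA -exprD subnK 1?ltnW // E1 mulrA mulVf ?mul1r.
  exact: gen (rt_neq0 K) y0 E.
congr O; apply: (mulIf (expf_neq0 (m - n) u0)); rewrite mulVf ?expf_neq0 //.
by have := congr1 (ratval tr) E'; rewrite rmorphM rmorphXn rmorph1 (ratval_rt tr).
Qed.

End SmallElement.

(** * Formal Laurent series *)

Section LaurentTheory.
Variable K : fieldType.
Local Notation KT := (laurent K).
Implicit Types (x y : KT) (n m : int).

Lemma lcoefB x y n : (x - y) n = x n - y n. Proof. by []. Qed.
Lemma lcoefD x y n : (x + y) n = x n + y n. Proof. by []. Qed.
Lemma lcoef0 n : (0 : KT) n = 0. Proof. by []. Qed.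
Lemma lcoef1 n : (1 : KT) n = (n == 0)%:R.
Proof. by rewrite /= /monomial_fun; case: (n == 0). Qed.
Lemma lcoefC (c : K) n : laurent_const c n = if n == 0 then c else 0.
Proof. by []. Qed.
Lemma lcoef_sum (I : Type) (r : seq I) (P : pred I) (F : I -> KT) n :
  (\sum_(i <- r | P i) F i) n = \sum_(i <- r | P i) F i n.
Proof. by elim/big_rec2: _ => // i y1 y2 _ <-; rewrite lcoefD. Qed.

Lemma lcoef_monomial m (a : K) x n : (laurent_monomial m a * x) n = a * x (n - m).
Proof.
rewrite /= /laurent_mul_fun -(@fsbig_widen _ _ _ _ [set m] setT) //=.
  by rewrite fsbig_set1 /= /monomial_fun eqxx.
by move=> i [_ /eqP im]; rewrite /= /monomial_fun (negPf im) mul0r.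
Qed.

Definition lX : KT := laurent_monomial 1 1.

Lemma lcoef_mulXn x (k : nat) n : (x * lX ^+ k) n = x (n - k%:Z).
Proof.
elim: k n => [|k IH] n; first by rewrite mulr1 subr0.
by rewrite exprSr mulrA mulrC lcoef_monomial mul1r IH; congr (x _); lia.
Qed.

Lemma lX_neq0 : lX != 0.
Proof.
apply/eqP => /(congr1 (fun x : KT => x 1)) /=.
by rewrite /monomial_fun eqxx; apply/eqP; rewrite oner_eq0.
Qed.

Lemma lcoef_divXn x (k : nat) n : (x / lX ^+ k) n = x (n + k%:Z).
Proof.
have -> : x (n + k%:Z) = ((x / lX ^+ k) * lX ^+ k) (n + k%:Z).
  by rewrite divfK // expf_neq0 // lX_neq0.
by rewrite lcoef_mulXn addrK.
Qed.

Lemma lcoefM_lead x y m n : vanish_below x m -> vanish_below y n ->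
  (x * y) (m + n) = x m * y n.
Proof.
move=> hx hy; have := @laurent_mul_ge K x y m n 0 1 hx hy erefl.
rewrite addr0 => E; transitivity (laurent_mul_fun x y (m + n)) => //.
by rewrite E coefM big_ord1 subnn !coef_poly /= !addr0.
Qed.

Lemma laurent_order x : x != 0 -> exists2 m, vanish_below x m & x m != 0.
Proof.
move=> x0; case: (laurent_bounded x) => N hN.
have [k xk] : exists k : nat, x (N + k%:Z) != 0.
  apply: contrapT => h; case/eqP: x0; apply: (@laurent_ind_ge _ N) => // k.
  by apply: contrapT => /eqP xk; apply: h; exists k.
case: (ex_minnP (ex_intro (fun n : nat => x (N + n%:Z) != 0) k xk)).
move=> {xk}k xk min_k; exists (N + k%:Z) => // l lt.
have [/hN//|Nl] := ltP l N; apply: contrapT => /eqP xl.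
have := min_k `|l - N|%N; rewrite (_ : N + `|l - N|%N%:Z = l); last by lia.
by move=> /(_ xl); lia.
Qed.

Lemma vanishB x y n : vanish_below x n -> vanish_below y n -> vanish_below (x - y) n.
Proof. by move=> hx hy k kn; rewrite lcoefB hx // hy // subrr. Qed.

Lemma vanishW x m n : m <= n -> vanish_below x n -> vanish_below x m.
Proof. by move=> mn hx k km; apply: hx; apply: lt_le_trans mn. Qed.

Lemma vanishM x y m n : vanish_below x m -> vanish_below y n ->
  vanish_below (x * y) (m + n).
Proof. exact: vanish_mul. Qed.

Lemma vanish1 : vanish_below (1 : KT) 0.
Proof. by move=> k k0; rewrite lcoef1 lt_eqF. Qed.

Lemma vanish_const (c : K) : vanish_below (laurent_const c) 0.
Proof. by move=> k k0; rewrite lcoefC lt_eqF. Qed.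

Lemma orderV x m : vanish_below x m -> x m != 0 ->
  vanish_below (GRing.inv x) (- m) /\ (GRing.inv x) (- m) != 0.
Proof.
move=> hx xm; have x0 : x != 0 by apply: contraNneq xm => ->.
have [n hn xn] : exists2 n, vanish_below (GRing.inv x) n & (GRing.inv x) n != 0.
  by apply: laurent_order; rewrite invr_eq0.
have := lcoefM_lead hx hn; rewrite divff // lcoef1 => /esym/eqP.
have [e|_] := eqVneq (m + n) 0; last by rewrite mulf_eq0 (negPf xm) (negPf xn).
by rewrite (_ : - m = n) //; lia.
Qed.

Lemma vanish_lX : vanish_below lX 1.
Proof. by move=> k k1; rewrite /= /monomial_fun; case: eqP => // e; move: k1; rewrite e. Qed.

Definition laurentO : set KT := [set x | vanish_below x 0].

Lemma laurentO_valuation_ring : valuation_ring laurentO.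
Proof.
split; first split.
- by rewrite in_setE; exact: vanish1.
- by move=> x y; rewrite !in_setE; exact: vanishB.
- by move=> x y; rewrite !in_setE /laurentO /= => hx hy; rewrite -[0]addr0; exact: vanishM.
move=> x; have [->|x0] := eqVneq x 0; first by left.
have [m hm xm] := laurent_order x0.
have [m0|m0] := leP 0 m; first by left; exact: vanishW hm.
by right; have [+ _] := orderV hm xm; apply: vanishW; lia.
Qed.

Lemma laurent_max_ideal x : max_ideal laurentO x <-> vanish_below x 1.
Proof.
rewrite max_idealP; split.
  move=> [Ox h] k; have [k0 _|k0 k1] := ltP k 0; first exact: Ox.
  have -> : k = 0 by lia.
  apply: contrapT => /eqP x0; have [x00|] := h; first by rewrite x00 eqxx in x0.
  by have [+ _] := orderV Ox x0; rewrite oppr0.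
move=> hx; split; first exact: vanishW hx.
have [x0|x0] := eqVneq x 0; [by left|right => Oxv].
have /(_ 0 isT) := vanishM hx Oxv; rewrite divff // lcoef1 eqxx => /eqP.
by rewrite oner_eq0.
Qed.

Lemma laurent_pideal x (k : nat) : pideal laurentO (lX ^+ k) x <-> vanish_below x k%:Z.
Proof.
rewrite pidealE ?expf_neq0 ?lX_neq0 //; split=> h n nk.
  have := h (n - k%:Z); rewrite lcoef_divXn subrK; apply; lia.
by rewrite lcoef_divXn; apply: h; lia.
Qed.

(** The coefficient of [t^k] is the same in all terms of index above [k]. *)
Lemma laurent_complete (s : nat -> KT) :
  (forall n : nat, vanish_below (s n.+1 - s n) n%:Z) ->
  exists x, forall n : nat, vanish_below (x - s n) n%:Z.
Proof.
move=> hs.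
have coef_eq (n m : nat) k : (n <= m)%N -> k < n%:Z -> s m k = s n k.
  move=> + kn; elim: m => [|m IH]; first by rewrite leqn0 => /eqP ->.
  rewrite leq_eqVlt => /predU1P[->//|nm]; rewrite -IH //.
  have := hs m k; rewrite lcoefB => /(_ _)/eqP; rewrite subr_eq0 => h.
  by apply/eqP/h; lia.
case: (laurent_bounded (s 0%N)) => N hN.
pose f k := s `|k|.+1 k.
have hf : exists N : int, forall k : int, k < N -> f k = 0.
  exists (Num.min N 0) => k; rewrite lt_min => /andP[kN k0].
  by rewrite /f (@coef_eq 0%N) // hN.
exists (Laurent hf) => n k kn; rewrite lcoefB /= /f.
have [le|lt] := leqP n `|k|.+1; first by rewrite (coef_eq n) ?subrr.
by rewrite (coef_eq `|k|.+1 n) ?subrr //; lia.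
Qed.

Lemma laurent_eq0 x : (forall n : nat, vanish_below x n%:Z) -> x = 0.
Proof. by move=> h; apply: laurentP => k; rewrite (h `|k|.+1) //; lia. Qed.

(** Hensel's lemma: Newton's iteration converges. *)
Lemma laurent_henselian : henselian laurentO.
Proof.
have OX : laurentO lX by apply: vanishW vanish_lX.
have hO := laurentO_valuation_ring; split=> // f a _ hf Oa fa f'a.
have Of' : laurentO f^`().[a] by apply: (pcoef_horner hO) => //; exact: pcoef_deriv.
have [d0 Od] := unit_vrV hO Of' f'a; set d := _^-1 in Od.
pose s (n : nat) := iter n (fun b => b - d * f.[b]) a.
have h (n : nat) : [/\ laurentO (s n), pideal laurentO lX (s n - a)
    & pideal laurentO (lX ^+ n.+1) f.[s n]].
  have mX y : pideal laurentO lX y <-> max_ideal laurentO y.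
    by rewrite laurent_max_ideal -[lX]expr1 laurent_pideal.
  elim: n => [|n [Os sa fs]].
    by split=> //=; [rewrite subrr; exact: (pideal0 hO)|rewrite expr1; apply/mX].
  have sE : s n.+1 = s n + - (d * f.[s n]) by [].
  have Oh : laurentO (- (d * f.[s n])).
    by apply: (vrN hO); apply: (vrM hO) => //; exact: (pcoef_horner hO).
  split.
  - by rewrite sE; exact: (vrD hO).
  - rewrite sE addrAC; apply: (pidealD hO) => //; apply: (pidealN hO); apply: (pidealM hO) => //.
    by apply: (pidealW hO _ fs); exists (lX ^+ n); [exact: (vrX hO)|rewrite exprS].
  - have [r Or] := taylor2 hO hf Os Oh; rewrite -sE => ->.
    rewrite (_ : _ + _ + _ = (1 - d * f^`().[s n] + d ^+ 2 * r * f.[s n]) * f.[s n]); last by ring.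
    move: fs => [w Ow fs]; rewrite {2}fs exprS.
    set u := _ + _; suff [v Ov ->] : pideal laurentO lX u.
      by exists (v * w); [exact: (vrM hO)|rewrite exprS; ring].
    apply: (pidealD hO); last first.
      apply: (pidealM hO); first by apply: (vrM hO) => //; exact: (vrX hO).
      by rewrite fs; exists (lX ^+ n * w); [apply: (vrM hO) => //; exact: (vrX hO)|rewrite exprS; ring].
    have [v Ov E] := horner_pideal hO (pcoef_deriv hO hf) Os Oa sa.
    exists (- (d * v)); first by apply: (vrN hO); exact: (vrM hO).
    have -> : f^`().[s n] = f^`().[a] + lX * v by rewrite -E addrC subrK.
    by rewrite mulrDr mulVf // opprD addrA subrr; ring.
have cs (n : nat) : vanish_below (s n.+1 - s n) n%:Z.
  apply/laurent_pideal; rewrite (_ : s n.+1 = s n + - (d * f.[s n])) // addrAC subrr add0r.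
  apply: (pidealN hO); apply: (pidealM hO) => //.
  have [_ _ fs] := h n; apply: (pidealW hO _ fs); exists lX; rewrite ?exprSr //.
have [b hb] := laurent_complete cs.
have Ob : laurentO b.
  rewrite -(subrK (s 0%N) b); apply: (vrD hO); last by case: (h 0%N).
  exact: (hb 0%N).
exists b; split=> //.
- apply/rootP/laurent_eq0 => n; apply/laurent_pideal.
  have [Os _ fs] := h n; rewrite -(subrK f.[s n] f.[b]); apply: (pidealD hO).
    by apply: (horner_pideal hO) => //; apply/laurent_pideal.
  apply: (pidealW hO _ fs); exists lX; rewrite ?exprSr //.
- have [_ sa _] := h 1%N; rewrite -(subrKA (s 1%N)); apply: (max_idealD hO).
    by apply/laurent_max_ideal; exact: (hb 1%N).
  by apply/laurent_max_ideal/laurent_pideal.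
Qed.

Local Notation cst := (@laurent_const K).

Lemma lcoef_pval (p : {poly K}) k :
  (pval cst lX p) k = if k < 0 then 0 else p`_`|k|.
Proof.
elim/poly_ind: p k => [|p c IH] k; first by rewrite rmorph0 lcoef0 coef0 if_same.
rewrite rmorphD rmorphM lcoefD pvalX pvalC lcoefC -[X in _ * X]expr1 lcoef_mulXn IH.
rewrite coefD coefMX coefC; have [k0|k0] := ltP k 0.
  by rewrite ifT ?ifF ?addr0 //; lia.
have [->|kn] := eqVneq k 0; first by [].
rewrite ifF; last by lia.
rewrite addr0 ifF; last by lia.
rewrite ifF; last by lia.
by rewrite addr0; congr (p`_ _); lia.
Qed.

Lemma max_ideal_lX : max_ideal laurentO lX.
Proof. by apply/laurent_max_ideal; exact: vanish_lX. Qed.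

Lemma laurentO_const c : laurentO (cst c).
Proof. exact: vanish_const. Qed.

Lemma lX_transcendental : transcendental cst lX.
Proof.
exact: (small_transcendental laurentO_valuation_ring laurentO_const max_ideal_lX lX_neq0).
Qed.

Definition lrat : {rmorphism ratfun K -> KT} := ratval lX_transcendental.

Lemma lrat_rt : lrat (rt K) = lX.
Proof. exact: ratval_rt. Qed.

(** The truncations of a series are rational functions. *)
Lemma laurent_dense x (n : nat) : exists r, vanish_below (x - lrat r) n%:Z.
Proof.
case: (laurent_bounded x) => N hN; pose M := `|N|%N.
pose p := \poly_(i < n + M) (x (i%:Z - M%:Z)).
exists (tofrac p / rt K ^+ M) => k kn.
have -> : lrat (tofrac p / rt K ^+ M) = pval cst lX p / lX ^+ M.
  by rewrite fmorph_div rmorphXn /= lrat_rt; congr (_ / _); exact: ratval_tofrac.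
rewrite lcoefB lcoef_divXn lcoef_pval; case: ltP => [lt|le].
  by rewrite subr0 hN //; lia.
rewrite coef_poly ifT; last by lia.
by rewrite (_ : _ - _ = k) ?subrr //; lia.
Qed.

Lemma lrat_tadic : valued_embedding (@tadic_ring K) laurentO lrat.
Proof.
exact: (small_tadic laurentO_valuation_ring laurentO_const max_ideal_lX lX_neq0).
Qed.

Definition laurent_place x : option K :=
  if pselect (laurentO x) then Some (x 0) else None.

Lemma laurent_place_O x : laurentO x -> laurent_place x = Some (x 0).
Proof. by rewrite /laurent_place; case: pselect. Qed.

Lemma laurent_place_None x : laurent_place x = None -> ~ laurentO x.
Proof. by rewrite /laurent_place; case: pselect. Qed.

Lemma laurent_place_Some x c : laurent_place x = Some c -> laurentO x /\ x 0 = c.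
Proof. by rewrite /laurent_place; case: pselect => // Ox [<-]. Qed.

Lemma laurent_rational_place : rational_place cst laurent_place.
Proof.
have hO := laurentO_valuation_ring.
split; first split.
- by rewrite laurent_place_O ?lcoef1 ?eqxx //; exact: vanish1.
- move=> x y a b /laurent_place_Some[Ox <-] /laurent_place_Some[Oy <-].
  by rewrite laurent_place_O ?lcoefB //; exact: (vrB hO).
- move=> x y a b /laurent_place_Some[Ox <-] /laurent_place_Some[Oy <-].
  rewrite laurent_place_O; last exact: (vrM hO).
  by rewrite -(lcoefM_lead Ox Oy) addr0.
- move=> x /laurent_place_None nO; have mV := max_idealV hO nO.
  rewrite laurent_place_O; last by case: mV.
  by move/laurent_max_ideal: mV => /(_ 0 isT) ->.
- move=> a; rewrite laurent_place_O ?lcoefC //; exact: vanish_const.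
Qed.

(** The Frobenius map is additive, so [x^p] is the sum of the [p]-th powers of
    the terms of [x]; those of degree above [k] do not contribute to the
    coefficient of [t^(pk)]. *)
Lemma lcoef_frobenius p x (k : nat) : p \in [pchar K] -> laurentO x ->
  (x ^+ p) (p * k)%N%:Z = (x k%:Z) ^+ p.
Proof.
move=> pK Ox; have p_gt0 : (0 < p)%N := prime_gt0 (pcharf_prime pK).
have pKT : p \in [pchar KT] by rewrite (fmorph_pchar cst).
pose q := \sum_(j < k.+1) cst (x j%:Z) * lX ^+ j.
have qE l : q l%:Z = if (l < k.+1)%N then x l%:Z else 0.
  rewrite /q lcoef_sum; under eq_bigr do rewrite lcoef_mulXn lcoefC.
  case: ltnP => [lt|le].
    rewrite (bigD1 (Ordinal lt)) //= subrr eqxx big1 ?addr0 // => j.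
    rewrite -val_eqE /= => jl; rewrite ifF //; lia.
  by rewrite big1 // => j _; rewrite ifF //; have := ltn_ord j; lia.
have Oq : laurentO q.
  move=> l l0; rewrite /q lcoef_sum big1 // => j _.
  by rewrite lcoef_mulXn lcoefC ifF //; lia.
have [r Or xq] : pideal laurentO (lX ^+ k.+1) (x - q).
  apply/laurent_pideal => l lk; rewrite lcoefB; have [l0|l0] := ltP l 0.
    by rewrite Ox // Oq // subrr.
  rewrite (_ : l = `|l|%N); last by lia.
  by rewrite qE ifT ?subrr //; lia.
have -> : x ^+ p = (\sum_(j < k.+1) cst (x j%:Z ^+ p) * lX ^+ (p * j)) + r ^+ p * lX ^+ (p * k.+1).
  transitivity ((q + lX ^+ k.+1 * r) ^+ p); first by rewrite -xq addrC subrK.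
  rewrite -!(pFrobenius_autE pKT) rmorphD rmorphM /=; congr (_ + _).
    rewrite /q rmorph_sum /=; apply: eq_bigr => j _.
    have cX a : cst (a ^+ p) = cst a ^+ p by exact: rmorphXn.
    by rewrite rmorphM /= !pFrobenius_autE cX -exprM mulnC.
  by rewrite !pFrobenius_autE -exprM mulrC mulnC.
have Orp := vrX laurentO_valuation_ring p Or.
rewrite lcoefD lcoef_mulXn Orp ?addr0; last by lia.
rewrite lcoef_sum (bigD1 (Ordinal (ltnSn k))) // lcoef_mulXn subrr lcoefC eqxx.
rewrite big1 => [|j jk]; first exact: addr0.
rewrite lcoef_mulXn lcoefC ifF //.
by apply/eqP => e; case/eqP: jk; apply: val_inj => /=; nia.
Qed.

(** The rank of a matrix with finitely many rows is preserved by field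
    embeddings, even when it has infinitely many columns. *)
Lemma frobenius_dependent p (n : nat) (y : 'I_n -> nat -> K) (c : 'I_n -> K) :
  p \in [pchar K] -> (exists i, c i != 0) ->
  (forall k, \sum_i c i * y i k ^+ p = 0) ->
  exists2 d : 'I_n -> K, exists i, d i != 0 & forall k, \sum_i d i * y i k = 0.
Proof.
move=> pK [i0 ci0] hc.
(* The row relations between the first m columns decrease with m, and no longer
   change once the rank is maximal. *)
pose Y (m : nat) := \matrix_(i < n, k < m) y i k.
have ex : exists r, `[< exists m : nat, \rank (Y m) = r >].
  by exists (\rank (Y 0)); apply/asboolP; exists 0%N.
have bd r : `[< exists m : nat, \rank (Y m) = r >] -> (r <= n)%N.
  by move=> /asboolP[m <-]; exact: rank_leq_row.
case: (ex_maxnP ex bd) => r /asboolP[m Ym] maxr.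
have rn : (r < n)%N.
  rewrite ltn_neqAle bd ?andbT; last by apply/asboolP; exists m.
  apply/eqP => rn; have : row_free (map_mx (pFrobenius_aut pK) (Y m)).
    by rewrite /row_free mxrank_map Ym rn.
  move=> /row_free_inj/(_ (\row_i c i) 0).
  have -> : \row_i c i *m map_mx (pFrobenius_aut pK) (Y m) = 0.
    apply/rowP => k; rewrite !mxE -[RHS](hc k); apply: eq_bigr => i _.
    by rewrite !mxE pFrobenius_autE.
  rewrite mul0mx => /(_ erefl)/rowP/(_ i0); rewrite !mxE => e.
  by rewrite e eqxx in ci0.
have /matrix0Pn[j [i dij]] : kermx (Y m) != 0 by rewrite kermx_eq0 /row_free Ym neq_ltn rn.
pose d := row j (kermx (Y m)).
exists (fun i => d 0 i); first by exists i; rewrite mxE.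
have dY (m' : nat) : (m <= m')%N -> d *m Y m' = 0.
  move=> mm'; have sub : (kermx (Y m') <= kermx (Y m))%MS.
    apply/sub_kermxP; have -> : Y m = Y m' *m \matrix_(k < m', l < m) (k == l :> nat)%:R.
      apply/matrixP => a b; rewrite !mxE.
      have lt : (b < m')%N by apply: leq_trans mm'.
      rewrite (bigD1 (Ordinal lt)) //= !mxE eqxx mulr1 big1 ?addr0 // => l.
      by rewrite -val_eqE /= !mxE => /negPf ->; rewrite mulr0.
    by rewrite mulmxA mulmx_ker mul0mx.
  have eqr : \rank (Y m') = \rank (Y m).
    apply/eqP; rewrite eqn_leq Ym maxr /=; last by apply/asboolP; exists m'.
    have := mxrankS sub; rewrite !mxrank_ker Ym.
    by have := rank_leq_row (Y m'); lia.
  have /andP[_ sub'] : (kermx (Y m') == kermx (Y m))%MS.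
    by rewrite -(geq_leqif (mxrank_leqif_eq sub)) !mxrank_ker eqr.
  by apply/sub_kermxP; apply: submx_trans (row_sub _ _) sub'.
move=> k; have := dY (maxn m k.+1) (leq_maxl _ _).
have lt : (k < maxn m k.+1)%N by rewrite leq_max ltnSn orbT.
move=> /rowP/(_ (Ordinal lt)); rewrite !mxE => e; rewrite -[RHS]e.
by apply: eq_bigr => l _; rewrite !mxE.
Qed.

(** A linear relation between the [p]-th powers of power series is one between the
    [p]-th powers of their coefficients, degree by degree. *)
Lemma laurent_separable : separable_ext cst.
Proof.
move=> p pK n y c nzc sum0.
have p_gt0 : (0 < p)%N := prime_gt0 (pcharf_prime pK).
have [M hM] : exists M : nat, forall i, laurentO (y i * lX ^+ M).
  have /choice[N hN] i : exists N : nat, laurentO (y i * lX ^+ N).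
    case: (laurent_bounded (y i)) => N hN; exists `|N|%N => k k0.
    by rewrite lcoef_mulXn; apply: hN; lia.
  exists (\sum_i N i)%N => i; rewrite (bigD1 i) //= exprD mulrA.
  apply: (vrM laurentO_valuation_ring) => //; apply: (vrX laurentO_valuation_ring).
  exact: vanishW vanish_lX.
pose z i := y i * lX ^+ M.
have [|d nd hd] := @frobenius_dependent p n (fun i k => z i k%:Z) c pK nzc.
  move=> k; have E : 0 = (\sum_i cst (c i) * z i ^+ p) (p * k)%N%:Z.
    transitivity ((lX ^+ (M * p) * \sum_i cst (c i) * y i ^+ p) (p * k)%N%:Z).
      by rewrite sum0 mulr0.
    rewrite mulr_sumr; congr (laurent_coef _ _); apply: eq_bigr => i _.
    by rewrite /z exprMn exprM mulrC mulrA.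
  rewrite [RHS]E lcoef_sum; apply: eq_bigr => i _.
  rewrite lcoef_monomial subr0; congr (_ * _); apply/esym.
  exact: lcoef_frobenius pK (hM i).
exists d => //; apply: (@mulIf _ (lX ^+ M)); first by rewrite expf_neq0 // lX_neq0.
rewrite mul0r mulr_suml; apply: laurentP => k; rewrite lcoef_sum lcoef0.
have [k0|k0] := ltP k 0.
  by rewrite big1 // => i _; rewrite -mulrA lcoef_monomial subr0 hM ?mulr0.
rewrite (_ : k = `|k|%N); last by lia.
rewrite -[RHS](hd `|k|%N); apply: eq_bigr => i _.
by rewrite -mulrA lcoef_monomial subr0.
Qed.

End LaurentTheory.

(** * Subfields and field embeddings *)

Section SubFieldType.
Variables (L : fieldType) (S : set L) (hS : is_subfield S).

Definition subfield_pred of is_subfield S : {pred L} := fun x => `[< S x >].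

Fact subfield_divring : divring_closed (subfield_pred hS).
Proof. exact: hS. Qed.

HB.instance Definition _ :=
  GRing.isDivringClosed.Build L (subfield_pred hS) subfield_divring.

Record subfield_of :=
  SubfieldOf { subfield_val : L; _ : subfield_val \in subfield_pred hS }.

HB.instance Definition _ := [isSub for subfield_val].
HB.instance Definition _ := [Choice of subfield_of by <:].
HB.instance Definition _ := [SubChoice_isSubIntegralDomain of subfield_of by <:].
HB.instance Definition _ := [SubIntegralDomain_isSubField of subfield_of by <:].

Definition subfield_incl : {rmorphism subfield_of -> L} := \val.

Lemma subfield_incl_inj : injective subfield_incl.
Proof. exact: val_inj. Qed.

Lemma subfield_inclP x : S (subfield_incl x).
Proof. by case: x => x /=; rewrite /subfield_pred => /asboolP. Qed.

Lemma subfield_inclK x : S x -> exists y, subfield_incl y = x.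
Proof. by move=> /asboolP Sx; exists (SubfieldOf Sx). Qed.

End SubFieldType.

(** The embeddings needed below have values which are characterized by a property
    rather than given by a formula, so they are obtained from relations. *)
Lemma rel_rmorphism (A B : fieldType) (R : A -> B -> Prop) :
  (forall a, exists b, R a b) ->
  (forall a b b', R a b -> R a b' -> b = b') -> R 1 1 ->
  (forall a b a' b', R a b -> R a' b' -> R (a - a') (b - b')) ->
  (forall a b a' b', R a b -> R a' b' -> R (a * a') (b * b')) ->
  exists g : {rmorphism A -> B}, forall a, R a (g a).
Proof.
move=> /choice[f hf] fn R1 RB RM.
have fB : zmod_morphism f by move=> x y; apply: (fn (x - y)) => //; exact: RB.
have f1 : monoid_morphism f.
  split; first exact: (fn 1).
  by move=> x y; apply: (fn (x * y)) => //; exact: RM.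
pose g : {rmorphism A -> B} := HB.pack f (GRing.isZmodMorphism.Build A B f fB)
  (GRing.isMonoidMorphism.Build A B f f1).
by exists g.
Qed.

Lemma factor_embedding (A L : fieldType) (S : set L) (hS : is_subfield S)
    (phi : {rmorphism A -> L}) : (forall a, S (phi a)) ->
  exists psi : {rmorphism A -> subfield_of hS},
    forall a, subfield_incl hS (psi a) = phi a.
Proof.
move=> hphi; apply: (@rel_rmorphism _ _ (fun a b => subfield_incl hS b = phi a)).
- by move=> a; exact: subfield_inclK.
- by move=> a b b' <- /subfield_incl_inj.
- by rewrite !rmorph1.
- by move=> a b a' b' hb hb'; rewrite !rmorphB hb hb'.
- by move=> a b a' b' hb hb'; rewrite !rmorphM hb hb'.
Qed.

Lemma algebraic_root_poly (k F : fieldType) (j : {rmorphism k -> F})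
    (p : {poly F}) (y : F) : p != 0 -> (forall i, algebraicOver j p`_i) ->
  root p y -> algebraicOver j y.
Proof.
move=> p0 hp py; apply/integral_algebraic; apply: (integral_root p0 py).
by apply/integral_poly => i; apply/integral_algebraic/hp.
Qed.

(** Divide the equation of [y] by a power of the variable to make its constant
    term nonzero, and solve for this term. *)
Lemma algebraic_inv_poly (k F : fieldType) (j : {rmorphism k -> F}) (y : F) :
  algebraicOver j y -> y != 0 -> exists q : {poly k}, y^-1 = (map_poly j q).[y].
Proof.
move=> [p p0 /rootP py] y0.
have [n [r]] := multiplicity_XsubC p 0; rewrite p0 subr0 /= => r0 pE.
have ry : (map_poly j r).[y] = 0.
  apply: (mulIf (expf_neq0 n y0)); rewrite mul0r -[RHS]py pE.
  by rewrite rmorphM rmorphXn /= map_polyX hornerM hornerXn.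
have c0 : j r`_0 != 0 by rewrite fmorph_eq0 -horner_coef0.
pose q := \poly_(i < size r) r`_i.+1.
have rE : r = q * 'X + (r`_0)%:P.
  apply/polyP => -[|i]; rewrite coefD coefMX coefC /= ?add0r // addr0 coef_poly.
  by case: ltnP => // /leqW /(nth_default 0).
exists (- (r`_0)^-1 *: q).
rewrite linearZ /= hornerZ rmorphN fmorphV.
move: ry; rewrite {1}rE rmorphD rmorphM /= map_polyX map_polyC hornerD hornerMX hornerC.
move=> /eqP; rewrite addr_eq0 => /eqP e.
apply: (mulIf y0); rewrite mulVf // -mulrA e mulrN mulNr opprK mulVf //.
Qed.

(** * Comparing valued extensions of K(t) *)

Section Approx.
Variable K : fieldType.
Local Notation Kt := (ratfun K).
Local Notation tring := (@tadic_ring K).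

Lemma valued_max (L M : fieldType) (OL : set L) (OM : set M)
    (j : {rmorphism L -> M}) : valued_embedding OL OM j ->
  forall x, max_ideal OL x <-> max_ideal OM (j x).
Proof.
move=> h x; rewrite !max_idealP -fmorphV; split=> -[/h Ox alt]; split=> //.
  by case: alt => [->|nV]; [left; rewrite rmorph0|right=> /h].
by case: alt => [/eqP|nV]; [rewrite fmorph_eq0 => /eqP; left|right=> /h].
Qed.

Lemma valued_pideal (L M : fieldType) (OL : set L) (OM : set M)
    (j : {rmorphism L -> M}) : valued_embedding OL OM j ->
  forall d x, d != 0 -> pideal OL d x <-> pideal OM (j d) (j x).
Proof.
move=> h d x d0; rewrite !pidealE ?fmorph_eq0 // -fmorph_div; exact: h.
Qed.

(** Elements of two extensions neither of which is embedded in the other can be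
    compared through their approximations by rational functions. *)
Definition approx (M : fieldType) (O : set M) (i : {rmorphism Kt -> M})
    (M' : fieldType) (O' : set M') (i' : {rmorphism Kt -> M'}) (y : M) (y' : M') :=
  forall n, exists r, pideal O (i (rt K ^+ n)) (y - i r)
                   /\ pideal O' (i' (rt K ^+ n)) (y' - i' r).

Definition valued_ext (M : fieldType) (O : set M) (i : {rmorphism Kt -> M}) :=
  valuation_ring O /\ valued_embedding tring O i.

Section Bounds.
Variables (M : fieldType) (O : set M) (i : {rmorphism Kt -> M}).
Hypothesis hM : valued_ext O i.
Let hO := hM.1.

Lemma vext_tadic r : tring r -> O (i r).
Proof. by move=> /hM.2. Qed.

Lemma vext_rtX n : O (i (rt K ^+ n)).
Proof. by apply: vext_tadic; rewrite rtXn; exact: tadic_poly. Qed.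

Lemma vext_rtX_neq0 n : i (rt K ^+ n) != 0.
Proof. by rewrite fmorph_eq0 expf_neq0 // rt_neq0. Qed.

Lemma pideal_rtW m n x : (m <= n)%N ->
  pideal O (i (rt K ^+ n)) x -> pideal O (i (rt K ^+ m)) x.
Proof.
move=> mn; apply: (pidealW hO); exists (i (rt K ^+ (n - m))); first exact: vext_rtX.
by rewrite -rmorphM -exprD subnKC.
Qed.

Lemma vext_bounded r : exists k, O (i (rt K ^+ k) * i r).
Proof.
have [k hk] := tadic_bounded r; exists k; rewrite -rmorphM mulrC; exact: vext_tadic.
Qed.

Lemma max_rt : max_ideal O (i (rt K)).
Proof.
apply/(valued_max hM.2)/max_idealP; split.
  by rewrite -[rt K]expr1 rtXn; exact: tadic_poly.
by right; rewrite -[rt K]expr1; exact: tadicNt.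
Qed.

(** If [y] is not integral, its monic equation expresses it as a linear
    combination of nonpositive powers of [y], which are integral; its value is
    then at least the least value of the coefficients. *)
Lemma algebraic_bounded y : algebraicOver i y -> exists k, O (i (rt K ^+ k) * y).
Proof.
move=> /integral_algebraic[p pmon /rootP py].
have [Oy|nOy] := pselect (O y); first by exists 0; rewrite expr0 rmorph1 mul1r.
have y0 : y != 0 by apply: contra_not_neq nOy => ->; exact: (vr0 hO).
have OyV := vrV hO nOy.
have p1 : (1 < size p)%N.
  rewrite ltnNge; apply/negP => /size1_polyC pC; move: py pmon.
  rewrite pC map_polyC hornerC => /eqP; rewrite fmorph_eq0 => /eqP ->.
  by rewrite polyC0 monicE lead_coef0 eq_sym oner_eq0.
pose d := (size p).-2.
have szp : size p = d.+2 by rewrite /d; case: (size p) p1 => [|[]].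
have [k hk] : exists k, forall l, (l <= d)%N -> O (i (rt K ^+ k) * i p`_l).
  elim: d {szp} => [|d [k hk]].
    by have [k hk] := vext_bounded p`_0; exists k => l; rewrite leqn0 => /eqP ->.
  have [k' hk'] := vext_bounded p`_d.+1; exists (k + k')%N => l.
  rewrite exprD rmorphM leq_eqVlt => /predU1P[->|lt].
    by rewrite -mulrA; apply: (vrM hO) => //; exact: vext_rtX.
  by rewrite (mulrC (i _)) -mulrA; apply: (vrM hO); [exact: vext_rtX|exact: hk].
exists k.
have yE : y = - \sum_(l < d.+1) i p`_l * y^-1 ^+ (d - l).
  apply: (mulIf (expf_neq0 d y0)); rewrite mulNr mulr_suml.
  move: py; rewrite horner_coef size_map_poly szp big_ord_recr /=.
  have -> : (map_poly i p)`_d.+1 = 1.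
    by rewrite coef_map /=; have := monicP pmon; rewrite lead_coefE szp /= => ->; exact: rmorph1.
  rewrite mul1r addrC => /eqP; rewrite addr_eq0 exprS => /eqP ->.
  congr (- _); apply: eq_bigr => l _; rewrite coef_map /= -mulrA; congr (_ * _).
  have := ltn_ord l; rewrite ltnS => ld.
  have -> : y ^+ d = y ^+ l * y ^+ (d - l) by rewrite -exprD subnKC.
  by rewrite mulrCA exprVn mulVf ?mulr1 // expf_neq0.
rewrite yE mulrN; apply: (vrN hO); rewrite mulr_sumr; apply: (vr_sum hO) => l _.
rewrite mulrA; apply: (vrM hO); last exact: (vrX hO).
by apply: hk; rewrite -ltnS.
Qed.

(** Otherwise the inverse of [y], which is also algebraic, would be unbounded. *)
Lemma algebraic_small y : algebraicOver i y ->
  (forall n, pideal O (i (rt K ^+ n)) y) -> y = 0.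
Proof.
move=> alg small; apply: contrapT => /eqP y0.
have [k] := algebraic_bounded (algebraic_inv alg).
have [r Or yE] := small k.+1 => h.
have := vrM hO h Or; rewrite yE exprSr rmorphM.
have T0 := vext_rtX_neq0 k; have t0 : i (rt K) != 0 by rewrite fmorph_eq0 rt_neq0.
have r0 : r != 0 by apply: contraNneq y0 => r0; rewrite yE r0 mulr0.
have -> : i (rt K ^+ k) * (i (rt K ^+ k) * i (rt K) * r)^-1 * r = (i (rt K))^-1.
  by move: T0 t0; set A := i _; set B := i _ => A0 B0; field; rewrite A0 B0 r0.
move=> OtV; have [_ []] := max_rt.
by exists (i (rt K))^-1; rewrite ?divff.
Qed.

End Bounds.

Section ApproxTheory.
Variables (M : fieldType) (O : set M) (i : {rmorphism Kt -> M}).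
Variables (M' : fieldType) (O' : set M') (i' : {rmorphism Kt -> M'}).
Hypotheses (hM : valued_ext O i) (hM' : valued_ext O' i').
Let hO := hM.1. Let hO' := hM'.1.
Local Notation "x ~ y" := (approx O i O' i' x y) (at level 70).

Lemma approx_ratfun r : i r ~ i' r.
Proof.
by move=> n; exists r; rewrite !subrr; split; [exact: (pideal0 hO)|exact: (pideal0 hO')].
Qed.

Lemma approxB x x' y y' : x ~ x' -> y ~ y' -> x - y ~ x' - y'.
Proof.
move=> hx hy n; have [r [r1 r2]] := hx n; have [s [s1 s2]] := hy n.
exists (r - s); rewrite !rmorphB.
have e (V : fieldType) (a b c d : V) : a - b - (c - d) = (a - c) - (b - d) by ring.
by rewrite (e _ x) (e _ x'); split; [exact: (pidealB hO)|exact: (pidealB hO')].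
Qed.

Lemma approx_mod x x' n r : x ~ x' ->
  pideal O (i (rt K ^+ n)) (x - i r) <-> pideal O' (i' (rt K ^+ n)) (x' - i' r).
Proof.
move=> /(_ n)[s [s1 s2]].
have T0 : rt K ^+ n != 0 by rewrite expf_neq0 // rt_neq0.
have key : pideal O (i (rt K ^+ n)) (i s - i r) <-> pideal O' (i' (rt K ^+ n)) (i' s - i' r).
  by rewrite -!rmorphB -(valued_pideal hM.2) // -(valued_pideal hM'.2).
split=> h.
- apply: (pideal_trans hO' s2); apply/key.
  by apply: (pideal_trans hO _ h); rewrite -opprB; exact: (pidealN hO).
- apply: (pideal_trans hO s1); apply/key.
  by apply: (pideal_trans hO' _ h); rewrite -opprB; exact: (pidealN hO').
Qed.

Lemma approx_pideal x x' n : x ~ x' ->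
  pideal O (i (rt K ^+ n)) x <-> pideal O' (i' (rt K ^+ n)) x'.
Proof. by move=> /(approx_mod n 0); rewrite !rmorph0 !subr0. Qed.

Lemma approx_O x x' : x ~ x' -> O x <-> O' x'.
Proof.
by move=> /(approx_pideal 0); rewrite !expr0 !rmorph1 !pideal1.
Qed.

Lemma approx_bounded x x' : x ~ x' -> exists k, O (i (rt K ^+ k) * x).
Proof.
move=> /(_ 0)[r [+ _]]; rewrite expr0 rmorph1 pideal1 => Ox.
have [k hk] := vext_bounded hM r; exists k.
rewrite -(subrK (i r) x) mulrDr; apply: (vrD hO) => //; apply: (vrM hO) => //.
exact: vext_rtX.
Qed.

End ApproxTheory.

Lemma approx_sym (M : fieldType) (O : set M) i (M' : fieldType) (O' : set M') i' x x' :
  approx O i O' i' x x' -> approx O' i' O i x' x.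
Proof. by move=> h n; have [r []] := h n; exists r. Qed.

Section ApproxTheory2.
Variables (M : fieldType) (O : set M) (i : {rmorphism Kt -> M}).
Variables (M' : fieldType) (O' : set M') (i' : {rmorphism Kt -> M'}).
Hypotheses (hM : valued_ext O i) (hM' : valued_ext O' i').
Let hO := hM.1. Let hO' := hM'.1.
Local Notation "x ~ y" := (approx O i O' i' x y) (at level 70).

(** The bound on [x] and [y] makes the errors of their approximations small
    after multiplication. *)
Lemma approxM x x' y y' : x ~ x' -> y ~ y' -> x * y ~ x' * y'.
Proof.
move=> hx hy n.
have [k1 b1] := approx_bounded hM hx; have [k1' b1'] := approx_bounded hM' (approx_sym hx).
have [k2 b2] := approx_bounded hM hy; have [k2' b2'] := approx_bounded hM' (approx_sym hy).
pose k := (k1 + k1' + (k2 + k2'))%N.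
have [r [r1 r2]] := hx (n + k)%N; have [s [s1 s2]] := hy (n + k)%N.
have main (V : fieldType) (OV : set V) (j : {rmorphism Kt -> V}) (hV : valued_ext OV j)
    a b l1 l2 : OV (j (rt K ^+ l1) * a) -> OV (j (rt K ^+ l2) * b) ->
    (l1 <= k)%N -> (l2 <= k)%N ->
    pideal OV (j (rt K ^+ (n + k))) (a - j r) ->
    pideal OV (j (rt K ^+ (n + k))) (b - j s) ->
    pideal OV (j (rt K ^+ n)) (a * b - j (r * s)).
  move=> ba bb lk1 lk2 ar bs; have hOV := hV.1.
  have up l c : OV (j (rt K ^+ l) * c) -> (l <= k)%N -> OV (j (rt K ^+ k) * c).
    move=> h lk; rewrite -(subnK lk) exprD rmorphM -mulrA; apply: (vrM hOV) => //.
    exact: vext_rtX.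
  have bb' := up _ _ bb lk2.
  have br : OV (j (rt K ^+ k) * j r).
    rewrite (_ : j r = a - (a - j r)); last by ring.
    rewrite mulrBr; apply: (vrB hOV); first exact: up lk1.
    by apply: (vrM hOV); [exact: vext_rtX|exact: (pidealO hOV (vext_rtX hV _) ar)].
  have prod c e : OV (j (rt K ^+ k) * c) -> pideal OV (j (rt K ^+ (n + k))) e ->
      pideal OV (j (rt K ^+ n)) (c * e).
    move=> hc [f Of ->]; exists (j (rt K ^+ k) * c * f); first exact: (vrM hOV).
    by rewrite exprD rmorphM; ring.
  rewrite rmorphM (_ : _ - _ = b * (a - j r) + j r * (b - j s)); last by ring.
  by apply: (pidealD hOV); exact: prod.
exists (r * s); split.
- by apply: (main _ _ _ hM x y k1 k2) => //; rewrite /k; lia.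
- by apply: (main _ _ _ hM' x' y' k1' k2') => //; rewrite /k; lia.
Qed.

(** The difference of two elements with the same counterpart is infinitely small,
    which for an algebraic element means that it is zero. *)
Lemma approx_unique x y x' : algebraicOver i x -> algebraicOver i y ->
  x ~ x' -> y ~ x' -> x = y.
Proof.
move=> ax ay hx hy; apply/eqP; rewrite -subr_eq0; apply/eqP.
apply: (algebraic_small hM); first exact: algebraic_sub.
move=> n; have h := approxB hM hM' hx hy; rewrite subrr in h.
by apply/(approx_pideal hM hM' _ h); exact: (pideal0 hO').
Qed.

End ApproxTheory2.
End Approx.

(** * The henselization of K(t) *)

Section Henselization.
Variable K : fieldType.
Local Notation Kt := (ratfun K).
Local Notation KT := (laurent K).
Local Notation tring := (@tadic_ring K).
Local Notation OT := (@laurentO K).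
Local Notation jT := (@lrat K).

Lemma laurent_vext : valued_ext OT jT.
Proof. by split; [exact: laurentO_valuation_ring|exact: lrat_tadic]. Qed.

Lemma laurent_pideal_rt n (x : KT) :
  pideal OT (jT (rt K ^+ n)) x <-> vanish_below x n%:Z.
Proof. by rewrite rmorphXn /= lrat_rt; exact: laurent_pideal. Qed.

(** The henselization consists of the algebraic power series which have a
    counterpart in every henselian extension of K(t).  Uniqueness of the
    counterpart provides the universal property. *)
Definition hlz : set KT := [set h | algebraicOver jT h /\
  forall (M : fieldType) (O : set M) (i : {rmorphism Kt -> M}),
    henselian O -> valued_embedding tring O i ->
    exists2 y, algebraicOver i y & approx O i OT jT y h].

Lemma hlz_ratfun r : hlz (jT r).
Proof.
split; first exact: algebraic_id.
move=> M O i [hO _] hi; exists (i r); first exact: algebraic_id.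
by apply: approx_ratfun => //; exact: laurent_vext.
Qed.

Lemma hlzB x y : hlz x -> hlz y -> hlz (x - y).
Proof.
move=> [ax hx] [ay hy]; split; first exact: algebraic_sub.
move=> M O i hens hi; have [x' ax' xx'] := hx M O i hens hi.
have [y' ay' yy'] := hy M O i hens hi; exists (x' - y'); first exact: algebraic_sub.
by apply: approxB => //; [split=> //; case: hens|exact: laurent_vext].
Qed.

Lemma hlzM x y : hlz x -> hlz y -> hlz (x * y).
Proof.
move=> [ax hx] [ay hy]; split; first exact: algebraic_mul.
move=> M O i hens hi; have [x' ax' xx'] := hx M O i hens hi.
have [y' ay' yy'] := hy M O i hens hi; exists (x' * y'); first exact: algebraic_mul.
by apply: approxM => //; [split=> //; case: hens|exact: laurent_vext].
Qed.

Lemma hlzD x y : hlz x -> hlz y -> hlz (x + y).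
Proof.
move=> hx hy; rewrite -(opprK y); apply: hlzB => //; rewrite -sub0r.
by apply: hlzB => //; rewrite -(rmorph0 jT); exact: hlz_ratfun.
Qed.

Lemma hlzV x : hlz x -> hlz x^-1.
Proof.
move=> hx; have [->|x0] := eqVneq x 0.
  by rewrite invr0 -(rmorph0 jT); exact: hlz_ratfun.
have [q ->] := algebraic_inv_poly hx.1 x0.
elim/poly_ind: q => [|q c IH].
  by rewrite map_poly0 horner0 -(rmorph0 jT); exact: hlz_ratfun.
rewrite rmorphD rmorphM /= map_polyX map_polyC hornerD hornerMX hornerC.
by apply: hlzD; [exact: hlzM|exact: hlz_ratfun].
Qed.

Lemma hlz_subfield : is_subfield hlz.
Proof.
split.
- by rewrite in_setE -(rmorph1 jT); exact: hlz_ratfun.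
- by move=> x y; rewrite !in_setE; exact: hlzB.
- by move=> x y; rewrite !in_setE => hx hy; apply: hlzM => //; exact: hlzV.
Qed.

Definition hfield : fieldType := subfield_of hlz_subfield.

Definition hincl : {rmorphism hfield -> KT} := subfield_incl hlz_subfield.

Definition hring : set hfield := [set x | OT (hincl x)].

Lemma hringE x : hring x = OT (hincl x). Proof. by []. Qed.

Lemma hincl_valued : valued_embedding hring OT hincl.
Proof. by []. Qed.

Lemma hring_valuation_ring : valuation_ring hring.
Proof.
have hT := laurentO_valuation_ring K.
split; first split.
- by rewrite in_setE hringE rmorph1; exact: (vr1 hT).
- by move=> x y; rewrite !in_setE !hringE rmorphB; exact: (vrB hT).
- by move=> x y; rewrite !in_setE !hringE rmorphM; exact: (vrM hT).
- by move=> x; rewrite !hringE fmorphV; exact: hT.2.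
Qed.

Lemma hratfun_ex : exists psi : {rmorphism Kt -> hfield}, forall r, hincl (psi r) = jT r.
Proof. by apply: factor_embedding => r; exact: hlz_ratfun. Qed.

Definition hratfun : {rmorphism Kt -> hfield} := projT1 (cid hratfun_ex).

Lemma hratfunE r : hincl (hratfun r) = jT r.
Proof. by rewrite /hratfun; case: cid. Qed.

Lemma hratfun_valued : valued_embedding tring hring hratfun.
Proof. by move=> r; rewrite hringE hratfunE; exact: lrat_tadic. Qed.

Lemma hfield_vext : valued_ext hring hratfun.
Proof. by split; [exact: hring_valuation_ring|exact: hratfun_valued]. Qed.

Lemma hfield_algebraic (x : hfield) : algebraicOver jT (hincl x).
Proof. by case: (subfield_inclP x). Qed.

Lemma hpideal n (x : hfield) :
  pideal hring (hratfun (rt K ^+ n)) x <-> pideal OT (jT (rt K ^+ n)) (hincl x).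
Proof.
rewrite (valued_pideal hincl_valued); last exact: (vext_rtX_neq0 hratfun n).
by rewrite hratfunE.
Qed.

Lemma hfield_embedding (M : fieldType) (O : set M) (i : {rmorphism Kt -> M}) :
  henselian O -> valued_embedding tring O i ->
  exists g : {rmorphism hfield -> M},
    forall x, algebraicOver i (g x) /\ approx O i OT jT (g x) (hincl x).
Proof.
move=> hens hi; have vM : valued_ext O i by split=> //; case: hens.
have vT := laurent_vext.
apply: (@rel_rmorphism _ _ (fun x y => algebraicOver i y /\ approx O i OT jT y (hincl x))).
- by move=> x; have [_ /(_ M O i hens hi)[y]] := subfield_inclP x; exists y.
- by move=> x y y' [ay hy] [ay' hy']; apply: (approx_unique vM vT ay ay' hy hy').
- split; first exact: algebraic1.
  by rewrite rmorph1 -(rmorph1 i) -(rmorph1 jT); exact: (approx_ratfun vM vT).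
- move=> x y x' y' [ay hy] [ay' hy']; split; first exact: algebraic_sub.
  by rewrite rmorphB; exact: (approxB vM vT).
- move=> x y x' y' [ay hy] [ay' hy']; split; first exact: algebraic_mul.
  by rewrite rmorphM; exact: (approxM vM vT).
Qed.

(** A valuation preserving embedding over K(t) respects approximations, since
    K(t) is dense in K((t)). *)
Lemma hfield_embedding_approx (M : fieldType) (O : set M) (i : {rmorphism Kt -> M})
    (g : {rmorphism hfield -> M}) : valuation_ring O ->
  valued_embedding tring O i ->
  valued_embedding hring O g -> (forall r, g (hratfun r) = i r) ->
  forall x, algebraicOver i (g x) /\ approx O i OT jT (g x) (hincl x).
Proof.
move=> hO hi hg gi x; split.
  have [p p0 /rootP px] := hfield_algebraic x; exists p => //; apply/rootP.
  have px' : (map_poly hratfun p).[x] = 0.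
    apply: (@fmorph_inj _ _ hincl); rewrite rmorph0 -px -horner_map -map_poly_comp.
    by congr (_.[_]); apply: eq_map_poly => r; exact: hratfunE.
  rewrite -(rmorph0 g) -px' -horner_map -map_poly_comp.
  by congr (_.[_]); apply: eq_map_poly => r; rewrite /= gi.
move=> n; have [r hr] := laurent_dense (hincl x) n; exists r.
have hr' : pideal OT (jT (rt K ^+ n)) (hincl x - jT r) by apply/laurent_pideal_rt.
split=> //; rewrite -!gi -rmorphB.
apply/(valued_pideal hg); first exact: (vext_rtX_neq0 hratfun n).
by apply/hpideal; rewrite rmorphB hratfunE.
Qed.

(** Hensel's lemma in K((t)) provides a root [b]; that it belongs to the
    henselization means that it has a counterpart in every henselian extension
    [M].  This is the root [y] which Hensel's lemma provides in [M]: if a rational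
    function [r] is close to [b], then the value of the polynomial at [r] is
    small, and since the root is simple this makes [r] close to [y]. *)
Lemma hfield_henselian : henselian hring.
Proof.
split; first exact: hring_valuation_ring.
move=> f a fmon hf Oa fa f'a; have vT := laurent_vext.
have hOT := laurentO_valuation_ring K.
have mh x : max_ideal hring x <-> max_ideal OT (hincl x).
  exact: (valued_max hincl_valued).
pose f1 := map_poly hincl f.
have f1O : pcoef OT f1 by move=> k; rewrite coef_map; exact: hf.
have [] := (laurent_henselian K).2 f1 (hincl a).
- by rewrite map_monic.
- exact: f1O.
- exact: Oa.
- by rewrite horner_map; apply/mh.
- by rewrite deriv_map horner_map => /mh.
move=> b [Ob rb mba].
suff hb : hlz b.
  have [c cb] : exists c : hfield, hincl c = b by exact: subfield_inclK.
  exists c; split.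
  - by rewrite hringE cb.
  - by rewrite -(fmorph_root hincl) cb.
  - by apply/mh; rewrite rmorphB cb.
split.
  apply: (@algebraic_root_poly _ _ _ f1); rewrite ?monic_neq0 ?map_monic //.
  by move=> k; rewrite coef_map; exact: hfield_algebraic.
move=> M O i hens hi; have hO := hens.1; have vM : valued_ext O i by [].
have [g hg] := hfield_embedding hens hi.
have gO x : hring x <-> O (g x).
  by apply: iff_sym; exact: (approx_O vM vT (hg x).2).
have mg x : max_ideal hring x <-> max_ideal O (g x) by exact: (valued_max gO).
have gi r : g (hratfun r) = i r.
  apply: (approx_unique vM vT (hg _).1 (algebraic_id _ _) (hg _).2).
  by rewrite hratfunE; exact: (approx_ratfun vM vT).
pose f2 := map_poly g f.
have f2O : pcoef O f2 by move=> k; rewrite coef_map; apply/gO; exact: hf.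
have [] := hens.2 f2 (g a).
- by rewrite map_monic.
- exact: f2O.
- exact/gO.
- by rewrite horner_map; apply/mg.
- by rewrite deriv_map horner_map => /mg.
move=> y [Oy ry mya]; exists y.
  apply: (@algebraic_root_poly _ _ _ f2); rewrite ?monic_neq0 ?map_monic //.
  by move=> k; rewrite coef_map; exact: (hg _).1.
move=> n; have [r] := laurent_dense b n.+1.
move/laurent_pideal_rt => br; exists r; split; last exact: (pideal_rtW vT (leqnSn n) br).
apply: (pideal_rtW vM (leqnSn n)).
have mT : max_ideal OT (jT (rt K ^+ n.+1)).
  rewrite exprS rmorphM mulrC; apply: max_idealM => //; first exact: (vext_rtX vT).
  exact: (max_rt vT).
have mbr := pideal_max hOT mT br.
have Or : OT (jT r).
  by rewrite -(subKr b (jT r)); apply: (vrB hOT) => //; case: mbr.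
have Oir : O (i r) by rewrite -gi; apply/gO; rewrite hringE hratfunE.
have mra : max_ideal O (i r - g a).
  rewrite -gi -rmorphB; apply/mg/mh; rewrite rmorphB hratfunE -(subrKA b).
  by apply: (max_idealD hOT) => //; rewrite -opprB; exact: (max_idealN hOT).
have myr : max_ideal O (i r - y).
  by rewrite -(subrKA (g a)); apply: (max_idealD hO) => //; rewrite -opprB; exact: (max_idealN hO).
have fir : pideal O (i (rt K ^+ n.+1)) f2.[i r].
  rewrite -(gi r) horner_map -gi; apply/(valued_pideal gO).
    exact: (vext_rtX_neq0 hratfun n.+1).
  apply/hpideal; rewrite -horner_map hratfunE.
  have := horner_pideal hOT f1O Or Ob _; rewrite (rootP rb) subr0; apply.
  by rewrite -opprB; exact: (pidealN hOT).
have [s Os] := taylor2 hO f2O Oy (vrB hO Oir Oy); rewrite subrKC (rootP ry) add0r => E.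
set u := f2^`().[y] + (i r - y) * s.
have E' : f2.[i r] = (i r - y) * u by rewrite E /u; ring.
have Ou : O u.
  apply: (vrD hO); last by apply: (vrM hO) => //; case: myr.
  by apply: (pcoef_horner hO) => //; exact: (pcoef_deriv hO).
have [|u0 OuV] := unit_vrV hO Ou.
  apply: (@max_ideal_unitB _ _ hO _ f2^`().[g a]).
    rewrite /u addrAC; apply: (max_idealD hO); last by rewrite mulrC; exact: max_idealM.
    have [z Oz ->] := horner_pideal hO (pcoef_deriv hO f2O) Oy (proj1 (gO a) Oa)
       (ex_intro2 _ _ 1 (vr1 hO) (esym (mulr1 _))).
    by rewrite mulrC; exact: max_idealM.
  by rewrite deriv_map horner_map => /mg.
rewrite -opprB; apply: (pidealN hO).
have -> : i r - y = f2.[i r] * u^-1 by rewrite E' mulfK.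
exact: (pidealMr hO).
Qed.

(** Over K(t), an embedding has to send each element to its counterpart; it
    exists by definition of the field, and it is unique since counterparts are. *)
Theorem hfield_henselization : is_henselization tring hring hratfun.
Proof.
split; [exact: hfield_henselian|exact: hratfun_valued|].
move=> M O i hens hi; have vM : valued_ext O i by split=> //; case: hens.
have vT := laurent_vext; split.
  have [g hg] := hfield_embedding hens hi; exists g; split.
    by move=> x; apply: iff_sym; exact: (approx_O vM vT (hg x).2).
  move=> r; apply: (approx_unique vM vT (hg _).1 (algebraic_id _ _) (hg _).2).
  by rewrite hratfunE; exact: (approx_ratfun vM vT).
move=> h h' vh eh vh' eh' y.
have [a1 p1] := hfield_embedding_approx hens.1 hi vh eh y.
have [a2 p2] := hfield_embedding_approx hens.1 hi vh' eh' y.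
exact: (approx_unique vM vT a1 a2 p1 p2).
Qed.

End Henselization.

(** * The valuation ring of a rational place *)

Section Places.
Variables (K L : fieldType) (iota : {rmorphism K -> L}) (P : L -> option K).
Hypothesis hP : rational_place iota P.

Lemma placeB x y a b : P x = Some a -> P y = Some b -> P (x - y) = Some (a - b).
Proof. by case: hP => -[_ + _ _] _; apply. Qed.

Lemma placeM x y a b : P x = Some a -> P y = Some b -> P (x * y) = Some (a * b).
Proof. by case: hP => -[_ _ + _] _; apply. Qed.

Lemma place1 : P 1 = Some 1. Proof. by case: hP => -[]. Qed.

Lemma placeC c : P (iota c) = Some c. Proof. by case: hP. Qed.

Lemma placeV x : P x = None -> P x^-1 = Some 0.
Proof. by case: hP => -[_ _ _ +] _; apply. Qed.

Lemma place0 : P 0 = Some 0.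
Proof. by rewrite -(rmorph0 iota) placeC. Qed.

Lemma placeD x y a b : P x = Some a -> P y = Some b -> P (x + y) = Some (a + b).
Proof.
move=> Px Py; rewrite -(opprK y) -(opprK b); apply: placeB => //.
by rewrite -sub0r -[- b]sub0r; apply: placeB => //; exact: place0.
Qed.

Lemma placeX x a n : P x = Some a -> P (x ^+ n) = Some (a ^+ n).
Proof.
move=> Px; elim: n => [|n IH]; first exact: place1.
by rewrite !exprS; exact: placeM.
Qed.

Lemma place_prod (I : Type) (r : seq I) (Q : pred I) (F : I -> L) (f : I -> K) :
  (forall i, Q i -> P (F i) = Some (f i)) ->
  P (\prod_(i <- r | Q i) F i) = Some (\prod_(i <- r | Q i) f i).
Proof.
by move=> h; elim/big_rec2: _ => [|i a b Qi Pb]; [exact: place1|apply: placeM; rewrite ?h].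
Qed.

Lemma place_inv x a : P x = Some a -> a != 0 -> P x^-1 = Some a^-1.
Proof.
move=> Px a0; case PV: (P x^-1) => [b|].
  have x0 : x != 0.
    by apply: contraNneq a0 => x0; move: Px; rewrite x0 place0 => -[<-].
  have := placeM Px PV; rewrite divff // place1 => -[ab].
  by congr Some; apply: (mulfI a0); rewrite -ab divff.
by have := placeV PV; rewrite invrK Px => -[a00]; rewrite a00 eqxx in a0.
Qed.

Lemma place_pval y a p : P y = Some a -> P (pval iota y p) = Some p.[a].
Proof.
move=> Py; elim/poly_ind: p => [|p c IH]; first by rewrite rmorph0 horner0; exact: place0.
rewrite rmorphD rmorphM pvalX pvalC !hornerE.
by apply: placeD; [exact: placeM|exact: placeC].
Qed.

Definition place_ring : set L := [set x | P x <> None].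

Lemma place_ringP x : place_ring x <-> exists a, P x = Some a.
Proof.
split=> [|[a]]; rewrite /place_ring /=; last by move=> ->.
by case: (P x) => // a _; exists a.
Qed.

Lemma place_ringC c : place_ring (iota c).
Proof. by apply/place_ringP; exists c; exact: placeC. Qed.

Lemma place_valuation_ring : valuation_ring place_ring.
Proof.
split; first split.
- by rewrite in_setE; apply/place_ringP; exists 1; exact: place1.
- move=> x y; rewrite !in_setE => /place_ringP[a Pa] /place_ringP[b Pb].
  by apply/place_ringP; exists (a - b); exact: placeB.
- move=> x y; rewrite !in_setE => /place_ringP[a Pa] /place_ringP[b Pb].
  by apply/place_ringP; exists (a * b); exact: placeM.
- move=> x; case Px: (P x) => [a|]; first by left; rewrite /place_ring /= Px.
  by right; rewrite /place_ring /= placeV.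
Qed.

Lemma place_max x : max_ideal place_ring x <-> P x = Some 0.
Proof.
rewrite max_idealP; split=> [[/place_ringP[a Px] alt]|Px].
  have [<-//|a0] := eqVneq a 0.
  case: alt => [x0|[]]; first by rewrite x0 place0.
  by apply/place_ringP; exists a^-1; exact: place_inv.
split; first by apply/place_ringP; exists 0.
have [->|x0] := eqVneq x 0; [by left|right => /place_ringP[b Pb]].
have := placeM Px Pb; rewrite divff // place1 mul0r => -[/eqP].
by rewrite oner_eq0.
Qed.

Lemma place_residue x : place_ring x -> exists c, max_ideal place_ring (x - iota c).
Proof.
move=> /place_ringP[c Px]; exists c; apply/place_max.
by rewrite -(subrr c); apply: placeB => //; exact: placeC.
Qed.

End Places.

(** * Embedding a discretely valued extension into the Laurent series *)

(** Expanding in powers of a uniformizer: the elements of [L] are limits of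
    rational functions in it. *)
Lemma laurent_embedding (K L : fieldType) (iota : {rmorphism K -> L})
    (P : L -> option K) : rational_place iota P -> discrete_place P ->
  exists e : {rmorphism L -> laurent K}, forall c, e (iota c) = laurent_const c.
Proof.
move=> hP [v [vM vsurj vP]]; pose O := place_ring P.
have hO : valuation_ring O := place_valuation_ring hP.
have OP x : x != 0 -> O x <-> 0 <= v x by exact: vP.
have v1 : v 1 = 0 by have := vM 1 1 (oner_neq0 _) (oner_neq0 _); rewrite mulr1; lia.
have vV x : x != 0 -> v x^-1 = - v x.
  by move=> x0; have := vM x x^-1 x0; rewrite invr_eq0 divff // v1 => /(_ x0); lia.
have [u u0 vu] := vsurj 1.
have vX n : v (u ^+ n) = n%:Z.
  elim: n => [|n IH]; first by rewrite expr0 v1.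
  by rewrite exprS vM ?expf_neq0 // IH vu; lia.
have mu : max_ideal O u.
  apply/max_idealP; split; first by apply/OP => //; rewrite vu.
  by right => /OP; rewrite invr_eq0 => /(_ u0); rewrite vV // vu.
have mO x : max_ideal O x -> pideal O u x.
  move=> [Ox nx]; have [->|x0] := eqVneq x 0; first exact: pideal0.
  apply/pidealE => //; apply/OP; first by rewrite mulf_neq0 ?invr_eq0.
  rewrite vM ?invr_eq0 // vV // vu; have := (OP x x0).1 Ox.
  suff : v x != 0 by lia.
  apply/eqP => vx; apply: nx; exists x^-1; rewrite ?divff //.
  by apply/OP; rewrite ?invr_eq0 // vV // vx oppr0.
have cO c : O (iota c) by exact: (place_ringC hP).
have tr := small_transcendental hO cO mu u0.
pose i : {rmorphism ratfun K -> L} := ratval tr.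
have vi : valued_ext O i by split=> //; exact: (small_tadic hO cO mu u0).
have it n : i (rt K ^+ n) = u ^+ n by rewrite rmorphXn /= ratval_rt.
have denseO y n : O y -> exists r, pideal O (u ^+ n) (y - i r).
  move=> Oy; elim: n => [|n [r [w Ow E]]].
    by exists 0; rewrite rmorph0 subr0; apply/pideal1.
  have [c mwc] := place_residue hP Ow; exists (r + rt K ^+ n * ratfunC K c).
  have [z Oz wE] := mO _ mwc; exists z => //.
  rewrite rmorphD rmorphM it /= ratvalC opprD addrA E -mulrBr wE exprSr mulrA.
  by [].
have dense y n : exists r, pideal O (i (rt K ^+ n)) (y - i r).
  have [->|y0] := eqVneq y 0; first by exists 0; rewrite rmorph0 subrr; exact: pideal0.
  pose k := `|v y|%N.
  have Oyk : O (y * u ^+ k).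
    by apply/OP; rewrite ?mulf_neq0 ?expf_neq0 // vM ?expf_neq0 // vX /k; lia.
  have [r [w Ow E]] := denseO _ (n + k)%N Oyk; exists (r / rt K ^+ k); exists w => //.
  apply: (mulIf (expf_neq0 k u0)); rewrite mulrBl fmorph_div !it divfK ?expf_neq0 // E.
  by rewrite exprD mulrAC.
have vT := laurent_vext K.
have [e he] : exists e : {rmorphism L -> laurent K},
    forall y, approx O i (@laurentO K) (@lrat K) y (e y).
  apply: rel_rmorphism.
  - move=> y; have /choice[r hr] := dense y.
    have cs n : vanish_below (lrat K (r n.+1) - lrat K (r n)) n%:Z.
      rewrite -rmorphB; apply/laurent_pideal_rt.
      apply/(valued_pideal (@lrat_tadic K)); first by rewrite expf_neq0 // rt_neq0.
      apply/(valued_pideal vi.2); first by rewrite expf_neq0 // rt_neq0.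
      rewrite rmorphB -(subrKA y); apply: (pidealD hO) => //.
      rewrite -opprB; apply: (pidealN hO); exact: (pideal_rtW vi (leqnSn n)).
    have [x hx] := laurent_complete cs.
    by exists x => n; exists (r n); split=> //; exact/laurent_pideal_rt.
  - move=> y x x' hx hx'; apply/eqP; rewrite -subr_eq0; apply/eqP/laurent_eq0 => n.
    have := approxB vi vT hx hx'; rewrite subrr => /(approx_pideal vi vT n) h.
    by apply/laurent_pideal_rt/h; exact: (pideal0 hO).
  - by rewrite -(rmorph1 i) -(rmorph1 (@lrat K)); exact: approx_ratfun.
  - by move=> *; exact: (approxB vi vT).
  - by move=> *; exact: (approxM vi vT).
exists e => c; apply/eqP; rewrite -subr_eq0; apply/eqP/laurent_eq0 => n.
have ic : iota c = i (ratfunC K c) by rewrite /i ratvalC.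
have := approxB vi vT (he (iota c)) (approx_ratfun vi vT (ratfunC K c)).
rewrite -ic subrr /lrat ratvalC => /(approx_pideal vi vT n) h.
by apply/laurent_pideal_rt/h; exact: (pideal0 hO).
Qed.

(** * Generated subfields and function fields in one variable *)

Section SubfieldSets.
Variables (L : fieldType) (S : set L).
Hypothesis hS : is_subfield S.

Lemma subf1 : S 1. Proof. by case: hS; rewrite in_setE. Qed.
Lemma subfB x y : S x -> S y -> S (x - y).
Proof. by case: hS => _ /(_ x y) + _; rewrite !in_setE => h *; exact: h. Qed.
Lemma subf_div x y : S x -> S y -> S (x / y).
Proof. by case: hS => _ _ /(_ x y); rewrite !in_setE => h *; exact: h. Qed.
Lemma subf0 : S 0. Proof. by rewrite -(subrr 1); exact: (subfB subf1 subf1). Qed.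
Lemma subfN x : S x -> S (- x).
Proof. by move=> Sx; rewrite -sub0r; exact: (subfB subf0). Qed.
Lemma subfD x y : S x -> S y -> S (x + y).
Proof. by move=> Sx Sy; rewrite -(opprK y); apply: subfB => //; exact: subfN. Qed.
Lemma subfV x : S x -> S x^-1.
Proof. by move=> Sx; rewrite -div1r; exact: (subf_div subf1). Qed.
Lemma subfM x y : S x -> S y -> S (x * y).
Proof. by move=> Sx Sy; rewrite -(invrK y); apply: subf_div => //; exact: subfV. Qed.
End SubfieldSets.

Lemma is_subfieldI (L : fieldType) (S : set L) :
  S 1 -> (forall x y, S x -> S y -> S (x - y)) ->
  (forall x y, S x -> S y -> S (x / y)) -> is_subfield S.
Proof.
by move=> h1 hB hd; split; [rewrite in_setE|move=> x y|move=> x y];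
   rewrite ?in_setE //; [exact: hB|exact: hd].
Qed.

Lemma subfield_image (A L : fieldType) (phi : {rmorphism A -> L}) (S : set A) :
  is_subfield S -> is_subfield (phi @` S).
Proof.
move=> hS; apply: is_subfieldI => [|_ _ [x Sx <-] [y Sy <-]|_ _ [x Sx <-] [y Sy <-]].
- by exists 1; [exact: (subf1 hS)|rewrite rmorph1].
- by exists (x - y); [exact: (subfB hS)|rewrite rmorphB].
- by exists (x / y); [exact: (subf_div hS)|rewrite fmorph_div].
Qed.

Lemma subfield_algebraic (k F : fieldType) (j : {rmorphism k -> F}) :
  is_subfield [set y | algebraicOver j y].
Proof.
apply: is_subfieldI; first exact: algebraic1.
- by move=> x y; exact: algebraic_sub.
- by move=> x y; exact: algebraic_div.
Qed.

Section GenSubfield.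
Variables (K L : fieldType) (iota : {rmorphism K -> L}).

Lemma gen_subfield_min (A S : set L) : is_subfield S ->
  (forall c, S (iota c)) -> A `<=` S -> gen_subfield iota A `<=` S.
Proof. by move=> hS hc hA x; apply; split=> // y [[c _ <-]|/hA]. Qed.

Lemma gen_subfield_iota (A : set L) c : gen_subfield iota A (iota c).
Proof. by move=> S [_]; apply; left; exists c. Qed.

Lemma gen_subfield_sub (A : set L) x : A x -> gen_subfield iota A x.
Proof. by move=> Ax S [_]; apply; right. Qed.

Lemma gen_subfield_subfield (A : set L) : is_subfield (gen_subfield iota A).
Proof.
apply: is_subfieldI => [S [hS _]|x y hx hy S hS|x y hx hy S hS].
- exact: (subf1 hS).
- by apply: (subfB hS.1); [exact: hx|exact: hy].
- by apply: (subf_div hS.1); [exact: hx|exact: hy].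
Qed.

Section Simple.
Variables (u : L) (tr : transcendental iota u).

Lemma gen_subfield_ratval r : gen_subfield iota [set u] (ratval tr r).
Proof.
set G := gen_subfield _ _; have hG : is_subfield G := gen_subfield_subfield _.
have Gp p : G (pval iota u p).
  elim/poly_ind: p => [|p c IH]; first by rewrite rmorph0; exact: (subf0 hG).
  rewrite rmorphD rmorphM pvalX pvalC; apply: (subfD hG); last exact: gen_subfield_iota.
  by apply: (subfM hG) => //; exact: gen_subfield_sub.
have [[n d] [/= d0 ->]] := frac_repr r.
by rewrite fmorph_div !ratval_tofrac; exact: (subf_div hG).
Qed.

Lemma range_ratval x : gen_subfield iota [set u] x -> exists r, ratval tr r = x.
Proof.
have hR : is_subfield (range (ratval tr)).
  by apply: subfield_image; apply: is_subfieldI.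
move=> /(gen_subfield_min hR) h; have [|_ ->|r _ <-] := h; last by exists r.
- by move=> c; exists (ratfunC K c) => //; exact: ratvalC.
- by exists (rt K) => //; exact: ratval_rt.
Qed.

Lemma algebraic_over_gen : algebraicOver (ratval tr) u.
Proof. by have := algebraic_id (ratval tr) (rt K); rewrite ratval_rt. Qed.

Lemma algebraic_over_const c : algebraicOver (ratval tr) (iota c).
Proof. by have := algebraic_id (ratval tr) (ratfunC K c); rewrite ratvalC. Qed.

Lemma algebraic_over_setP y :
  algebraic_over_set (gen_subfield iota [set u]) y <-> algebraicOver (ratval tr) y.
Proof.
split=> [[p [p0 hp py]]|[p p0 py]].
  apply: (algebraic_root_poly p0 _ py) => i.
  by have [r <-] := range_ratval (hp i); exact: algebraic_id.
exists (map_poly (ratval tr) p); split=> //; first by rewrite map_poly_eq0.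
by move=> i; rewrite coef_map; exact: gen_subfield_ratval.
Qed.

End Simple.
End GenSubfield.

Lemma pval_comp (K L M : fieldType) (iota : {rmorphism K -> L}) (g : {rmorphism L -> M})
    (iota' : {rmorphism K -> M}) u p : (forall c, g (iota c) = iota' c) ->
  g (pval iota u p) = pval iota' (g u) p.
Proof.
move=> h; rewrite !pvalE -horner_map -map_poly_comp.
by congr (_.[_]); apply: eq_map_poly => c /=; rewrite h.
Qed.

Lemma ratval_comp (K L M : fieldType) (iota : {rmorphism K -> L}) (g : {rmorphism L -> M})
    (iota' : {rmorphism K -> M}) u v (tr : transcendental iota u)
    (tr' : transcendental iota' v) r : (forall c, g (iota c) = iota' c) -> g u = v ->
  g (ratval tr r) = ratval tr' r.
Proof.
move=> h uv; have [[n d] [/= d0 ->]] := frac_repr r.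
by rewrite !ratvalE // fmorph_div !(pval_comp _ _ h) uv.
Qed.

(** A solution of polynomial equations in an algebraic extension of K(u) already
    lives in a function field, the one generated by its coordinates and [u]. *)
Lemma function_field_of_algebraic (K L : fieldType) (iota : {rmorphism K -> L})
    (u : L) (tr : transcendental iota u) (s : seq L) :
  (forall y, y \in s -> algebraicOver (ratval tr) y) ->
  exists (F : fieldType) (iF : {rmorphism K -> F}) (e : {rmorphism F -> L}),
    [/\ function_field1 iF, forall c, e (iF c) = iota c
      & forall y, y \in s -> exists z, e z = y].
Proof.
move=> alg; set S := gen_subfield iota [set` u :: s].
have hS : is_subfield S := gen_subfield_subfield _ _.
pose F : fieldType := subfield_of hS; pose e : {rmorphism F -> L} := subfield_incl hS.
have [iF eF] : exists iF : {rmorphism K -> F}, forall c, e (iF c) = iota c.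
  by apply: factor_embedding => c; exact: gen_subfield_iota.
have eS x : S (e x) by exact: subfield_inclP.
have lift y : S y -> exists x, e x = y by exact: subfield_inclK.
have gen y : y \in u :: s -> S y by move=> ys; exact: gen_subfield_sub.
have algS y : S y -> algebraicOver (ratval tr) y.
  apply: (gen_subfield_min (subfield_algebraic _)) => [c|z] /=.
    exact: algebraic_over_const.
  by rewrite inE => /predU1P[->|/alg//]; exact: algebraic_over_gen.
exists F, iF, e; split=> //; last by move=> y ys; apply: lift; apply: gen; rewrite in_cons ys orbT.
split.
  have [s' es'] : exists s', map e s' = u :: s.
    elim: (u :: s) gen => [|y r IH] gen; first by exists [::].
    have [x ex] := lift y (gen y (mem_head _ _)).
    have [|r' er'] := IH; first by move=> z zr; apply: gen; rewrite in_cons zr orbT.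
    by exists (x :: r'); rewrite map_cons er'; congr (_ :: _).
  exists s'; apply/seteqP; split=> // x _.
  set T := gen_subfield iF _; have hT : is_subfield T := gen_subfield_subfield _ _.
  have [y Ty /(fmorph_inj e) <- //] : (e @` T) (e x).
  apply: (gen_subfield_min (subfield_image e hT)) (eS x).
    by move=> c; exists (iF c) => //; exact: gen_subfield_iota.
  move=> z /=; rewrite -es' => /mapP[w ws ->]; exists w => //.
  exact: gen_subfield_sub.
have [u' eu'] := lift u (gen u (mem_head _ _)).
have tr' : transcendental iF u'.
  apply: transcendentalP => p pu; apply: (tr p 0).
  by rewrite rmorph0 -eu' -(pval_comp _ _ eF) pu rmorph0.
exists u'; split; first exact/transcendentalN.
move=> y; apply/(algebraic_over_setP tr').
have [p p0 /rootP py] := algS _ (eS y); exists p => //; apply/rootP.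
apply: (fmorph_inj e); rewrite rmorph0 -py -horner_map -map_poly_comp.
by congr (_.[_]); apply: eq_map_poly => r; exact: (ratval_comp tr' tr r eF eu').
Qed.

Lemma clear_denominators (A : idomainType) (p : {poly {fraction A}}) :
  exists d (q : {poly A}), d != 0 /\ tofrac d *: p = map_poly (@tofrac A) q.
Proof.
elim/poly_ind: p => [|p c [d [q [d0 E]]]].
  by exists 1, 0; rewrite oner_neq0 scaler0 rmorph0.
have [[n e] [/= e0 ->]] := frac_repr c.
exists (d * e), (e *: (q * 'X) + (d * n)%:P); split; first by rewrite mulf_neq0.
have e0' : tofrac e != 0 by rewrite tofrac_eq0.
have mX : map_poly (@tofrac A) (q * 'X) = (tofrac d *: p) * 'X.
  by rewrite E rmorphM /= map_polyX.
rewrite rmorphD /= map_polyC /= map_polyZ mX scalerDr.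
rewrite tofracM [tofrac d * _]mulrC -scalerA -scalerAl; congr (_ + _).
by rewrite -mul_polyC -polyCM tofracM; congr (_%:P); rewrite (mulrC (tofrac e)) -mulrA (mulrC (tofrac e)) divfK.
Qed.

Section Exchange.
Variables (K F : fieldType) (iota : {rmorphism K -> F}).

(** Once denominators are cleared, an equation of [y] over K(x) is a polynomial
    relation between [x] and [y], which can be read the other way round. *)
Lemma algebraic_exchange x y (trx : transcendental iota x) (trY : transcendental iota y) :
  algebraicOver (ratval trx) y -> algebraicOver (ratval trY) x.
Proof.
move=> [p p0 /rootP py].
have [d [Q [d0 E]]] := clear_denominators p.
have Q0 : Q != 0.
  apply: contraNneq p0 => Q0; move/eqP: E; rewrite Q0 rmorph0 scaler_eq0.
  by rewrite tofrac_eq0 (negPf d0).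
pose ev2 (R : {poly {poly K}}) a b := (map_poly (map_poly iota) R).[a%:P].[b].
have ev2E R a b : ev2 R a b = (map_poly (pval iota b) R).[a].
  rewrite (_ : map_poly (pval iota b) R = map_poly (horner_eval b) (map_poly (map_poly iota) R)); last first.
    by rewrite -map_poly_comp; apply: eq_map_poly.
  by rewrite -{2}[a](hornerC a b) -[a%:P.[b]]/(horner_eval b a%:P) horner_map.
have Qxy : ev2 Q y x = 0.
  rewrite ev2E; transitivity (ratval trx (tofrac d) * (map_poly (ratval trx) p).[y]).
    rewrite -hornerZ -map_polyZ E -map_poly_comp; congr (_.[_]).
    by apply: eq_map_poly => r /=; rewrite ratval_tofrac.
  by rewrite py mulr0.
exists (map_poly (@tofrac _) (polyXY.swapXY Q)).
  by rewrite map_poly_eq0_id0 ?polyXY.swapXY_eq0 // tofrac_eq0 lead_coef_eq0 polyXY.swapXY_eq0.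
apply/rootP; rewrite -map_poly_comp -[RHS]Qxy.
transitivity (ev2 (polyXY.swapXY Q) x y).
  by rewrite ev2E; congr (_.[_]); apply: eq_map_poly => r /=; rewrite ratval_tofrac.
by rewrite /ev2 -polyXY.swapXY_map polyXY.horner2_swapXY.
Qed.

End Exchange.

Lemma function_field_algebraic (K F : fieldType) (iota : {rmorphism K -> F})
    u (tr : transcendental iota u) : function_field1 iota ->
  forall y, algebraicOver (ratval tr) y.
Proof.
move=> [_ [x [/transcendentalN trx algx]]].
have {}algx y : algebraicOver (ratval trx) y by apply/algebraic_over_setP.
have algu := algebraic_exchange tr (algx u).
move=> y; have [p p0 py] := algx y.
apply: (@algebraic_root_poly _ _ _ (map_poly (ratval trx) p)); rewrite ?map_poly_eq0 //.
move=> i; rewrite coef_map /=.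
apply: (gen_subfield_min (subfield_algebraic (ratval tr)) _ _ (gen_subfield_ratval trx _)).
  by move=> c; exact: algebraic_over_const.
by move=> _ ->.
Qed.

(** * Finiteness of the degree over K(u) *)

Section FiniteDegree.
Variables (k F : fieldType) (j : {rmorphism k -> F}).

Definition subalgebra (V : set F) : Prop :=
  [/\ forall c, V (j c), forall x y, V x -> V y -> V (x - y)
    & forall x y, V x -> V y -> V (x * y)].

Definition finite_spanned (V : set F) : Prop :=
  exists (I : finType) (b : I -> F),
    forall z, V z -> exists c : I -> k, z = \sum_i j (c i) * b i.

Section Subalgebra.
Variables (V : set F).
Hypothesis hV : subalgebra V.

Lemma subalg0 : V 0.
Proof. by case: hV => h _ _; rewrite -(rmorph0 j). Qed.

Lemma subalgD x y : V x -> V y -> V (x + y).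
Proof.
case: hV => _ hB _ Vx Vy; rewrite -(opprK y); apply: (hB) => //.
by rewrite -sub0r; apply: (hB) => //; exact: subalg0.
Qed.

Lemma subalg_sum (I : Type) (r : seq I) (P : pred I) (G : I -> F) :
  (forall i, P i -> V (G i)) -> V (\sum_(i <- r | P i) G i).
Proof. by move=> h; elim/big_ind: _ => //; [exact: subalg0|exact: subalgD]. Qed.

Lemma subalg_horner q z : V z -> V (map_poly j q).[z].
Proof.
case: hV => hC _ hM Vz; elim/poly_ind: q => [|q c IH].
  by rewrite rmorph0 horner0; exact: subalg0.
rewrite rmorphD /= map_polyC rmorphM /= map_polyX hornerD hornerMX hornerC.
by apply: subalgD; [exact: (hM)|exact: hC].
Qed.

(** The powers of [x] are reduced modulo an equation of [x]. *)
Lemma adjoin_algebraic x : algebraicOver j x -> finite_spanned V ->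
  exists V', [/\ subalgebra V', finite_spanned V', V `<=` V' & V' x].
Proof.
case: hV => hC hB hM [p p0 /rootP px] [I [b hb]].
pose V' := [set z | exists2 q : {poly F}, (forall i, V q`_i) & z = q.[x]].
have VV' : V `<=` V'.
  move=> z Vz; exists z%:P; last by rewrite hornerC.
  by move=> i; rewrite coefC; case: ifP => // _; exact: subalg0.
exists V'; split=> //.
- split; first by move=> c; apply: VV'.
    move=> _ _ [q hq ->] [r hr ->]; exists (q - r); last by rewrite hornerD hornerN.
    by move=> i; rewrite coefB; exact: hB.
  move=> _ _ [q hq ->] [r hr ->]; exists (q * r); last by rewrite hornerM.
  by move=> i; rewrite coefM; apply: subalg_sum => l _; exact: hM.
- pose d := size p; exists (I * 'I_d)%type, (fun il : I * 'I_d => b il.1 * x ^+ il.2).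
  have red e : exists c : 'I_d -> k, x ^+ e = \sum_l j (c l) * x ^+ l.
    pose r := 'X^e %% p; exists (fun l => r`_l).
    have -> : x ^+ e = (map_poly j r).[x].
      have := congr1 (fun p => (map_poly j p).[x]) (divp_eq 'X^e p).
      rewrite rmorphXn /= map_polyX hornerXn => ->.
      by rewrite rmorphD rmorphM /= hornerD hornerM px mulr0 add0r.
    rewrite (@horner_coef_wide _ d).
      by apply: eq_bigr => l _; rewrite coef_map.
    by rewrite size_map_poly ltnW // ltn_modpN0.
  have /choice[c hc] := red.
  move=> _ [q hq ->].
  have coefV (l : 'I_d) : exists a : I -> k, \sum_(e < size q) q`_e * j (c e l) = \sum_i j (a i) * b i.
    by apply: hb; apply: subalg_sum => e _; exact: hM.
  have /choice[a ha] := coefV.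
  exists (fun il : I * 'I_d => a il.2 il.1); rewrite -(pair_bigA _ (fun i l => j (a l i) * (b i * x ^+ l))) /=.
  rewrite exchange_big /= horner_coef.
  transitivity (\sum_(e < size q) \sum_(l < d) q`_e * j (c e l) * x ^+ l).
    apply: eq_bigr => e _; rewrite hc mulr_sumr; apply: eq_bigr => l _.
    by rewrite mulrA.
  rewrite exchange_big; apply: eq_bigr => l _.
  by rewrite -mulr_suml ha mulr_suml; apply: eq_bigr => i _; rewrite mulrA.
- exists 'X; last by rewrite hornerX.
  move=> i; rewrite coefX; case: (i == 1%N); last exact: subalg0.
  by have := hC 1; rewrite rmorph1.
Qed.

End Subalgebra.

Lemma finite_spanned_adjoin (s : seq F) : (forall x, x \in s -> algebraicOver j x) ->
  exists V, [/\ subalgebra V, finite_spanned V & forall x, x \in s -> V x].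
Proof.
elim: s => [|x s IH] alg.
  exists (range j); split=> //.
    split; first by move=> c; exists c.
      by move=> _ _ [a _ <-] [b _ <-]; exists (a - b); rewrite ?rmorphB.
    by move=> _ _ [a _ <-] [b _ <-]; exists (a * b); rewrite ?rmorphM.
  exists unit, (fun=> 1) => _ [c _ <-]; exists (fun=> c).
  by rewrite big_const card_unit /= mulr1 addr0.
have [|V [hV fV sV]] := IH; first by move=> y ys; apply: alg; rewrite in_cons ys orbT.
have [V' [hV' fV' VV' V'x]] := adjoin_algebraic hV (alg x (mem_head _ _)) fV.
exists V'; split=> // y; rewrite in_cons => /predU1P[->//|ys].
by apply: VV'; exact: sV.
Qed.

Lemma finite_spanned_dependent : finite_spanned setT -> exists N, forall n (z : 'I_n -> F),
  (N < n)%N -> exists c : 'I_n -> k, (exists i, c i != 0) /\ \sum_i j (c i) * z i = 0.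
Proof.
move=> [I [b hb]]; exists #|I| => n z lt.
have /choice[C hC] : forall l, exists c : I -> k, z l = \sum_i j (c i) * b i.
  by move=> l; exact: hb.
pose A := \matrix_(l < n, m < #|I|) C l (enum_val m).
have kA : kermx A != 0.
  by rewrite kermx_eq0 /row_free neq_ltn (leq_ltn_trans (rank_leq_col A) lt).
have /matrix0Pn[r [i kri]] := kA.
exists (fun l => kermx A r l); split; first by exists i.
under eq_bigr do rewrite hC mulr_sumr.
rewrite exchange_big /= big1 // => m _.
have := mulmx_ker A => /matrixP/(_ r (enum_rank m)); rewrite !mxE => e.
transitivity (j (\sum_l kermx A r l * A l (enum_rank m)) * b m).
  rewrite rmorph_sum /= mulr_suml.
  have AE l : A l (enum_rank m) = C l m by rewrite mxE enum_rankK.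
  by apply: eq_bigr => l _; rewrite AE rmorphM mulrA.
by rewrite e rmorph0 mul0r.
Qed.

End FiniteDegree.

Lemma function_field_finite (K F : fieldType) (iota : {rmorphism K -> F})
    u (tr : transcendental iota u) :
  function_field1 iota -> finite_spanned (ratval tr) setT.
Proof.
move=> ff; have alg := function_field_algebraic tr ff.
have [[s gens] _] := ff.
have [V [hV fV sV]] := @finite_spanned_adjoin _ _ (ratval tr) s (fun x _ => alg x).
have [hC hB hM] := hV.
have fldV : is_subfield V.
  apply: is_subfieldI => //; first by have := hC 1; rewrite rmorph1.
  move=> x y Vx Vy; apply: (hM) => //.
  have [->|y0] := eqVneq y 0; first by rewrite invr0; exact: (subalg0 hV).
  have [q ->] := algebraic_inv_poly (alg y) y0.
  exact: (subalg_horner hV).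
suff -> : [set: F] = V by [].
apply/seteqP; split=> // x _; have : [set: F] x by [].
rewrite -gens; apply: gen_subfield_min => // c.
by have := hC (ratfunC K c); rewrite ratvalC.
Qed.

(** Linear dependence over K(u), normalized by clearing denominators and dividing
    by the common power of [u]: a relation of this form does not become trivial
    at a place where [u] vanishes. *)
Lemma polynomial_dependence (K F : fieldType) (iota : {rmorphism K -> F})
    u (tr : transcendental iota u) : function_field1 iota ->
  exists N, forall n (z : 'I_n -> F), (N < n)%N ->
  exists p : 'I_n -> {poly K}, (exists i, (p i).[0] != 0)
    /\ \sum_i pval iota u (p i) * z i = 0.
Proof.
move=> ff; have [N hN] := finite_spanned_dependent (function_field_finite tr ff).
exists N => n z /(hN _ z)[c [[i ci] sumc]].
have u0 : u != 0.
  apply/eqP => u0; have := tr 'X 0; rewrite rmorph0 pvalX => /(_ u0)/eqP.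
  by rewrite polyX_eq0.
have /choice[nd hnd] l := frac_repr (c l).
pose den l := \prod_(m | m != l) (nd m).2.
have [p [pi0 sump]] : exists p : 'I_n -> {poly K}, p i != 0 /\ \sum_l pval iota u (p l) * z l = 0.
  exists (fun l => (nd l).1 * den l); split.
    apply: mulf_neq0; last by apply/prodf_neq0 => m _; case: (hnd m).
    by apply: contraNneq ci => e; rewrite (hnd i).2 e tofrac0 mul0r.
  transitivity (pval iota u (\prod_m (nd m).2) * \sum_l ratval tr (c l) * z l).
    2: by rewrite sumc mulr0.
  rewrite mulr_sumr; apply: eq_bigr => l _; rewrite (hnd l).2 ratvalE ?(hnd l).1 // (bigD1 l) //= -/(den l).
  rewrite !rmorphM /=; have d0 : pval iota u (nd l).2 != 0.
    by apply: contraNneq (hnd l).1 => e; apply/eqP/tr; rewrite rmorph0.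
  by field.
move: {2}(size (p i)) (leqnn (size (p i))) => m; elim: m p pi0 sump => [|m IH] p pi0 sump le.
  by move: le; rewrite leqn0 size_poly_eq0 (negPf pi0).
have [ex|nex] := pselect (exists l, (p l).[0] != 0); first by exists p.
have /choice[q hq] l : exists q, p l = q * 'X.
  have : root (p l) 0 by apply/rootP; apply: contrapT => /eqP ?; apply: nex; exists l.
  by move=> /factor_theorem[q ->]; exists q; rewrite subr0.
have qi0 : q i != 0 by apply: contraNneq pi0 => e; rewrite hq e mul0r.
apply: (IH q qi0).
  apply: (mulIf u0); rewrite mul0r -[RHS]sump mulr_suml; apply: eq_bigr => l _.
  by rewrite hq rmorphM pvalX mulrAC.
by move: le; rewrite hq size_mulX.
Qed.

(** * Rational places of function fields *)

Section SeveralPlaces.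
Variables (K F : fieldType) (iota : {rmorphism K -> F}).

Lemma place_sum (P : F -> option K) (I : Type) (r : seq I) (Q : pred I)
    (G : I -> F) (g : I -> K) : rational_place iota P ->
  (forall i, Q i -> P (G i) = Some (g i)) ->
  P (\sum_(i <- r | Q i) G i) = Some (\sum_(i <- r | Q i) g i).
Proof.
move=> hP h; elim/big_rec2: _ => [|i a b Qi Pb]; first exact: (place0 hP).
by apply: (placeD hP) => //; exact: h.
Qed.

(** Suppose that [Q] is finite wherever [P] is.  Then an element with residue 0 at
    [Q] whose inverse is finite at [P] is zero; applied to [x - c], where [c] is
    the residue of [x] at [Q], this shows that [P] and [Q] agree. *)
Lemma places_separate (P Q : F -> option K) :
  rational_place iota P -> rational_place iota Q -> P <> Q ->
  exists a c, P a = Some c /\ Q a = None.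
Proof.
move=> hP hQ PQ; apply: contrapT => nex; apply: PQ.
have sub a c : P a = Some c -> exists d, Q a = Some d.
  by move=> Pa; case Qa: (Q a) => [d|]; [exists d|case: nex; exists a, c].
have noinv a d : Q a = Some 0 -> P a^-1 = Some d -> a = 0.
  move=> Qa /sub[e Qa']; apply: contrapT => /eqP a0.
  have := placeM hQ Qa Qa'; rewrite divff // (place1 hQ) mul0r => -[/eqP].
  by rewrite oner_eq0.
apply/funext => x; case Qx: (Q x) => [c|]; last first.
  by case Px: (P x) => [d|//]; have [e] := sub _ _ Px; rewrite Qx.
have Qxc : Q (x - iota c) = Some 0.
  by rewrite -(subrr c); apply: (placeB hQ) => //; exact: (placeC hQ).
suff Pxc : P (x - iota c) = Some 0.
  by rewrite -(subrK (iota c) x) -[c in RHS]add0r; apply: (placeD hP) => //; exact: (placeC hP).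
case Pxc: (P (x - iota c)) => [e|].
  have [->//|e0] := eqVneq e 0.
  have x0 := noinv _ _ Qxc (place_inv hP Pxc e0).
  by move: Pxc; rewrite x0 (place0 hP) => -[<-].
have x0 := noinv _ _ Qxc (placeV hP Pxc).
by move: Pxc; rewrite x0 (place0 hP).
Qed.

Variables (n : nat) (Ps : 'I_n -> F -> option K).
Hypothesis hPs : forall i, rational_place iota (Ps i).

(** Let [c_i] be the residue of [x] at those of the places at which it is
    finite, and let [Q] be the product of all [x - c_i] and [H = 1 + x^2 Q].
    Then [H] has residue 1 at these places, and at the poles of [x] it has a
    higher pole than [x Q]. *)
Lemma places_regularize x : exists Q H : F,
  [/\ (exists c : 'I_n -> K, Q = \prod_i (x - iota (c i))), H != 0 \/ n = 0%N,
      forall i, Ps i (x / H) = Some (odflt 0 (Ps i x))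
    & forall i, Ps i (Q / H) = Some 0].
Proof.
pose c i := odflt 0 (Ps i x); pose Q := \prod_i (x - iota (c i)).
pose H := 1 + x ^+ 2 * Q.
have Hfin i a : Ps i x = Some a -> Ps i Q = Some 0 /\ Ps i H = Some 1.
  move=> Px; have PQ : Ps i Q = Some 0.
    have PQ : Ps i Q = Some (\prod_j (a - c j)).
      by apply: (place_prod (hPs i)) => j _; apply: (placeB (hPs i)) => //; exact: (placeC (hPs i)).
    by rewrite PQ (bigD1 i) //= /c Px subrr mul0r.
  split=> //; rewrite /H -[1 in RHS]addr0 -(mulr0 (a ^+ 2)).
  apply: (placeD (hPs i)); first exact: (place1 (hPs i)).
  by apply: (placeM (hPs i)) => //; exact: (placeX (hPs i)).
(* At a pole of x everything is expressed in b = 1 / x, which has residue 0. *)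
pose b := x^-1; pose Q' := \prod_i (1 - iota (c i) * b).
have Hinf i : Ps i x = None -> [/\ x != 0, Ps i b = Some 0 & Ps i Q' = Some 1].
  move=> Px; have Pb := placeV (hPs i) Px; split=> //.
    by apply: contraPneq Px => ->; rewrite (place0 (hPs i)).
  have -> : 1 = \prod_(j < n) (1 - c j * 0) :> K by rewrite big1 // => j _; rewrite mulr0 subr0.
  apply: (place_prod (hPs i)) => j _; apply: (placeB (hPs i)); first exact: (place1 (hPs i)).
  by apply: (placeM (hPs i)) => //; exact: (placeC (hPs i)).
have QE : x != 0 -> Q = x ^+ n * Q'.
  move=> x0; rewrite /Q /Q' -[n in x ^+ n]card_ord -prodr_const -big_split /=.
  by apply: eq_bigr => j _; rewrite mulrBr mulr1 mulrCA divff // mulr1.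
have HE : x != 0 -> H = x ^+ n.+2 * (b ^+ n.+2 + Q').
  move=> x0; rewrite /H QE // mulrDr -exprMn divff // expr1n; congr (_ + _).
  by rewrite mulrA -exprD.
pose D := b ^+ n.+2 + Q'.
have PD i : Ps i x = None -> Ps i D = Some 1.
  move=> /Hinf[_ Pb PQ']; rewrite -[1]add0r -[0 in RHS](expr0n _ n.+2).
  by apply: (placeD (hPs i)) => //; exact: (placeX (hPs i)).
have H0 (i : 'I_n) : H != 0.
  case Px: (Ps i x) => [a|].
    apply/eqP => H0; have [_] := Hfin i a Px; rewrite H0 (place0 (hPs i)) => -[/eqP].
    by rewrite eq_sym oner_eq0.
  have [x0 _ _] := Hinf i Px; rewrite HE // mulf_neq0 ?expf_neq0 //.
  apply/eqP => D0; have := PD i Px; rewrite /D D0 (place0 (hPs i)) => -[/eqP].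
  by rewrite eq_sym oner_eq0.
exists Q, H; split; first by exists c.
- by case: (posnP n) => [|n0]; [right|left; exact: (H0 (Ordinal n0))].
- move=> i; case Px: (Ps i x) => [a|] /=.
    have [_ PH] := Hfin i a Px; rewrite -[a]divr1; apply: (placeM (hPs i)) => //.
    by apply: (place_inv (hPs i)) => //; rewrite oner_neq0.
  have [x0 Pb PQ'] := Hinf i Px; have PDi := PD i Px.
  have D0 : D != 0 by have := H0 i; rewrite HE // mulf_eq0 negb_or => /andP[].
  have -> : x / H = b ^+ n.+1 * D^-1.
    rewrite HE // invfM mulrA; congr (_ / _); rewrite exprS invfM mulrA divff // mul1r.
    by rewrite exprVn.
  rewrite -(mul0r 1^-1) -[0 in RHS](expr0n _ n.+1); apply: (placeM (hPs i)).
    exact: (placeX (hPs i)).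
  by apply: (place_inv (hPs i)) => //; rewrite oner_neq0.
- move=> i; case Px: (Ps i x) => [a|] /=.
    have [PQ PH] := Hfin i a Px; rewrite -(mul0r 1^-1); apply: (placeM (hPs i)) => //.
    by apply: (place_inv (hPs i)) => //; rewrite oner_neq0.
  have [x0 Pb PQ'] := Hinf i Px; have PDi := PD i Px.
  have D0 : D != 0 by have := H0 i; rewrite HE // mulf_eq0 negb_or => /andP[].
  have -> : Q / H = b ^+ 2 * Q' / D.
    rewrite HE // QE // invfM mulrA; congr (_ / _).
    rewrite mulrAC; congr (_ * _).
    by rewrite -addn2 exprD invfM mulrA divff ?expf_neq0 // mul1r exprVn.
  rewrite -(mul0r 1^-1) -[0 in RHS](mul0r 1) -[0 in RHS](expr0n _ 2).
  apply: (placeM (hPs i)); first by apply: (placeM (hPs i)) => //; exact: (placeX (hPs i)).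
  by apply: (place_inv (hPs i)) => //; rewrite oner_neq0.
Qed.

Hypothesis injP : injective Ps.

(** For two of the places there is an element with residue 1 at the first and a
    pole at the second.  Regularized, it keeps the residue 1 and the pole turns
    into a zero; the [z_j] are products of such elements. *)
Lemma places_approximation : exists z : 'I_n -> F,
  forall i j, Ps i (z j) = Some (j == i)%:R.
Proof.
have sep (j l : 'I_n) : j != l -> exists b (f : 'I_n -> K),
    [/\ forall i, Ps i b = Some (f i), f j = 1 & f l = 0].
  move=> jl; have [a [c [Pa Qa]]] : exists a c, Ps j a = Some c /\ Ps l a = None.
    apply: places_separate => //.
    by move/injP => e; rewrite e eqxx in jl.
  pose x := a - iota c + 1.
  have Px : Ps j x = Some 1.
    rewrite -[1]add0r -(subrr c); apply: (placeD (hPs j)); last exact: (place1 (hPs j)).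
    by apply: (placeB (hPs j)) => //; exact: (placeC (hPs j)).
  have Qx : Ps l x = None.
    case Qx: (Ps l x) => [d|//].
    have := placeD (hPs l) Qx (placeC (hPs l) (c - 1)).
    by rewrite /x rmorphB rmorph1 (_ : _ + _ = a) ?Qa //; ring.
  have [Q [H [_ _ PH _]]] := places_regularize x.
  by exists (x / H), (fun i => odflt 0 (Ps i x)); rewrite Px Qx.
have /choice[b hb] : forall jl : 'I_n * 'I_n, exists b, jl.1 != jl.2 ->
    exists f : 'I_n -> K, [/\ forall i, Ps i b = Some (f i), f jl.1 = 1 & f jl.2 = 0].
  move=> [j l]; have [e|jl] := eqVneq j l; first by exists 0.
  by have [b [f hf]] := sep j l jl; exists b => _; exists f.
exists (fun j => \prod_(l | l != j) b (j, l)) => i j.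
have [<-|ji] := eqVneq j i.
  rewrite (_ : true%:R = \prod_(l < n | l != j) 1); last by rewrite big1.
  apply: (place_prod (hPs j)) => l lj; have [|f [h fj _]] := hb (j, l); first by rewrite eq_sym.
  by rewrite h -fj.
have /choice[f hf] : forall l, exists f, l != j -> Ps i (b (j, l)) = Some f /\ (l = i -> f = 0).
  move=> l; have [->|lj] := eqVneq l j; first by exists 0.
  have [|f [h _ fl]] := hb (j, l); first by rewrite eq_sym.
  by exists (f i) => _; split=> // <-.
have -> : (false%:R : K) = \prod_(l < n | l != j) f l.
  have ij : i != j by rewrite eq_sym.
  by have [_ e] := hf i ij; rewrite (bigD1 i) //= e // mul0r.
by apply: (place_prod (hPs i)) => l lj; case: (hf l lj).
Qed.

End SeveralPlaces.

Lemma place_zero_transcendental (K F : fieldType) (iota : {rmorphism K -> F})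
    (P : F -> option K) u : rational_place iota P -> P u = Some 0 -> u != 0 ->
  transcendental iota u.
Proof.
move=> hP Pu u0; apply: (small_transcendental (place_valuation_ring hP)) => //.
  by move=> c; exact: (place_ringC hP).
by apply/(place_max hP).
Qed.

(** Elements [z_j] with residue 1 at one and 0 at the others of several zeros of
    [u] are linearly independent over K(u), so there are at most [F : K(u)]
    zeros. *)
Lemma finitely_many_zeros (K F : fieldType) (iota : {rmorphism K -> F}) u :
  function_field1 iota -> u != 0 ->
  finite_set [set P | rational_place iota P /\ P u = Some 0].
Proof.
move=> ff u0; apply: contrapT.
move=> /infiniteP/pcard_leP/injfunPex[f Af finj].
have hf i : rational_place iota (f i) /\ f i u = Some 0 by exact: Af.
have tr := place_zero_transcendental (hf 0%N).1 (hf 0%N).2 u0.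
have [N hN] := polynomial_dependence tr ff.
pose Ps (i : 'I_N.+1) := f i.
have hPs i : rational_place iota (Ps i) := (hf i).1.
have injPs : injective Ps by move=> i j /finj e; apply/val_inj/e; rewrite inE.
have [z hz] := places_approximation hPs injPs.
have [p [[i pi0] sump]] := hN _ z (ltnSn N).
have : Ps i (\sum_l pval iota u (p l) * z l) = Some (\sum_l (p l).[0] * (l == i)%:R).
  apply: (@place_sum K F iota (Ps i) _ _ _ (fun l => pval iota u (p l) * z l)
    (fun l => (p l).[0] * (l == i)%:R) (hPs i)) => l _; apply: (placeM (hPs i)); last exact: hz.
  by apply: (place_pval (hPs i)); exact: (hf i).2.
rewrite sump (place0 (hPs i)) (bigD1 i) //= eqxx mulr1 big1 ?addr0 => [[e]|l /negPf ->].
  by rewrite -e eqxx in pi0.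
by rewrite mulr0.
Qed.

Section Discreteness.
Variables (K F : fieldType) (iota : {rmorphism K -> F}) (P : F -> option K).
Hypotheses (ff : function_field1 iota) (hP : rational_place iota P).
Let O := place_ring P.
Let hO : valuation_ring O := place_valuation_ring hP.
Let cO c : O (iota c). Proof. exact: (place_ringC hP). Qed.

Lemma place_zero_exists : exists u, u != 0 /\ P u = Some 0.
Proof.
have [_ [x [nalg _]]] := ff.
have xc c : x != iota c.
  by apply/eqP => e; apply: nalg; rewrite e; exact: algebraic_id.
case Px: (P x) => [c|].
  exists (x - iota c); rewrite subr_eq0 xc -(subrr c); split=> //.
  by apply: (placeB hP) => //; exact: (placeC hP).
exists x^-1; rewrite invr_eq0 (placeV hP Px); split=> //.
by have := xc 0; rewrite rmorph0.
Qed.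

(** The values of the [w_i] increase strictly and remain below that of [u].  In a
    linear relation over K[u] consider the first coefficient with a nonzero
    constant term: its summand has a value smaller than all the others, since a
    later one has a larger [w_i] and an earlier one is divisible by [u]. *)
Lemma chain_bound u N : u != 0 -> P u = Some 0 ->
  (forall n (z : 'I_n -> F), (N < n)%N -> exists p : 'I_n -> {poly K},
     (exists i, (p i).[0] != 0) /\ \sum_i pval iota u (p i) * z i = 0) ->
  forall n (w : nat -> F), (forall i j, (i < j <= n)%N -> max_ideal O (w j / w i)) ->
    (forall i, (i <= n)%N -> [/\ w i != 0, O (w i) & max_ideal O (u / w i)]) ->
  (n < N)%N.
Proof.
move=> u0 Pu dep n w inc hw; rewrite ltnNge; apply/negP => Nn.
have mu : max_ideal O u by apply/(place_max hP).
have [p [[i0 pi0] sump]] := dep n.+1 (fun i => w i) Nn.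
have [l pl minl] := @arg_minnP _ i0 (fun i => (p i).[0] != 0) (fun i => i : nat) pi0.
have ln : (l <= n)%N by rewrite -ltnS.
have [wl0 Owl mul] := hw l ln.
have [pl0 plV] := pval_unit hO cO mu pl.
have Op q : O (pval iota u q) by exact: (pval_O hO cO mu).
have small i : i != l -> max_ideal O (pval iota u (p i) * w i / w l).
  move=> il; have [lt|le] := ltnP l i.
    rewrite -mulrA; apply: max_idealM => //; apply: inc.
    by rewrite lt /= -ltnS.
  have lt : (i < l)%N by rewrite ltn_neqAle le andbT.
  have /eqP p0 : (p i).[0] == 0.
    by apply: contraT => /minl; rewrite leqNgt lt.
  have /factor_theorem[q pE] : root (p i) 0 by apply/rootP.
  have [_ Owi _] := hw i (leq_trans (ltnW lt) ln).
  rewrite pE subr0 rmorphM pvalX (_ : _ / _ = pval iota u q * w i * (u / w l)); last by ring.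
  by apply: max_idealM => //; exact: (vrM hO).
have : max_ideal O (pval iota u (p l)).
  have -> : pval iota u (p l) = - \sum_(i | i != l) pval iota u (p i) * w i / w l.
    apply: (mulIf wl0); rewrite mulNr mulr_suml.
    move: sump; rewrite (bigD1 l) //= => /eqP; rewrite addr_eq0 => /eqP ->; congr (- _).
    by apply: eq_bigr => i _; rewrite divfK.
  apply: (max_idealN hO); elim/big_ind: _ => //; first exact: (max_ideal0 hO).
  by move=> x y; exact: (max_idealD hO).
by move=> [_ []]; exists (pval iota u (p l))^-1; rewrite ?divff.
Qed.

(** Let [w_n] be the last element of a chain of maximal length between 0 and the
    value of some [u].  There is no value strictly between 0 and that of
    [u / w_n]: an element [z] with such a value would prolong the chain by
    [w_n z]. *)
Lemma place_uniformizer : exists u, [/\ u != 0, P u = Some 0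
  & forall z, max_ideal O z -> O (z / u)].
Proof.
have [u [u0 Pu]] := place_zero_exists.
have mu : max_ideal O u by apply/(place_max hP).
have [N dep] := polynomial_dependence (place_zero_transcendental hP Pu u0) ff.
pose chain n := exists w : nat -> F,
  (forall i j, (i < j <= n)%N -> max_ideal O (w j / w i)) /\
  (forall i, (i <= n)%N -> [/\ w i != 0, O (w i) & max_ideal O (u / w i)]).
have ex : exists n, `[< chain n >].
  exists 0%N; apply/asboolP; exists (fun=> 1); split; first by move=> i [|j]; rewrite ?andbF.
  by move=> i _; rewrite oner_neq0 divr1; split=> //; exact: (vr1 hO).
have bd n : `[< chain n >] -> (n <= N)%N.
  by move=> /asboolP[w [inc hw]]; apply: ltnW; exact: (chain_bound u0 Pu dep inc hw).
case: (ex_maxnP ex bd) => n /asboolP[w [inc hw]] maxn.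
have [wn0 Own mun] := hw n (leqnn n).
exists (u / w n); split; first by rewrite mulf_neq0 ?invr_eq0.
  by apply/(place_max hP).
move=> z mz; apply: contrapT => nO.
have z0 : z != 0 by apply: contra_not_neq nO => ->; rewrite mul0r; exact: (vr0 hO).
suff : chain n.+1 by move/asboolP/maxn; rewrite ltnn.
pose w' i := if (i <= n)%N then w i else w n * z.
have mV := max_idealV hO nO; rewrite invf_div in mV.
exists w'; split.
  move=> i j /andP[ij jn]; rewrite /w'; have [jn'|jn'] := leqP j n.
    rewrite ifT; first by apply: inc; rewrite ij.
    by apply: leq_trans jn'; exact: ltnW.
  rewrite ifT; last by rewrite -ltnS (leq_trans ij).
  have [->|ni] := eqVneq i n.
    by rewrite mulrAC divff // mul1r.
  rewrite mulrAC mulrC; apply: (max_idealM hO); first by case: mz.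
  by apply: inc; rewrite leqnn andbT ltn_neqAle ni -ltnS (leq_trans ij).
move=> i _; rewrite /w'; have [le|_] := leqP i n; first exact: hw.
split; first exact: mulf_neq0.
  by apply: (vrM hO) => //; case: mz.
by rewrite invfM mulrA.
Qed.

(** Every element is algebraic over K(u) for a uniformizer [u], so its value is
    bounded by multiples of the value of [u]; dividing by the largest possible
    power of [u] leaves a unit. *)
Lemma function_field_place_discrete : discrete_place P.
Proof.
have [u [u0 Pu unif]] := place_uniformizer.
have mu : max_ideal O u by apply/(place_max hP).
have tr := place_zero_transcendental hP Pu u0.
have alg := function_field_algebraic tr ff.
have vF : valued_ext O (ratval tr) by split=> //; exact: small_tadic.
have it n : ratval tr (rt K ^+ n) = u ^+ n by rewrite rmorphXn /= ratval_rt.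
have unitE z : O z -> ~ O (z / u) -> ~ max_ideal O z by move=> Oz nO /unif.
have dec z : z != 0 -> exists n : int, O (z / u ^ n) /\ O (u ^ n / z).
  move=> z0; have [k] := algebraic_bounded vF (alg z); rewrite it => Okz.
  have [k'] := algebraic_bounded vF (alg z^-1); rewrite it => Okz'.
  pose a := u ^+ k * z; have a0 : a != 0 by rewrite mulf_neq0 ?expf_neq0.
  have ex : exists l, `[< O (a / u ^+ l) >].
    by exists 0%N; apply/asboolP; rewrite expr0 divr1.
  have bd l : `[< O (a / u ^+ l) >] -> (l <= k + k')%N.
    move=> /asboolP h; rewrite leqNgt; apply/negP => lt.
    apply: (small_expN hO mu u0 (n := l - (k + k'))); first by rewrite subn_gt0.
    have := vrM hO h Okz'; congr O; rewrite /a -[in LHS](subnK (ltnW lt)) !exprD.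
    by field; rewrite z0 !expf_neq0.
  case: (ex_maxnP ex bd) => l /asboolP Oal maxl.
  have Oal' : ~ O (a / u ^+ l / u).
    move=> h; have : (l.+1 <= l)%N; last by rewrite ltnn.
    by apply: maxl; apply/asboolP; rewrite exprSr invfM mulrA.
  have [v0 OV] := unit_vrV hO Oal (unitE _ Oal Oal').
  exists (l%:Z - k%:Z).
  have -> : z / u ^ (l%:Z - k%:Z) = a / u ^+ l.
    rewrite expfzDr // -invr_expz -!exprnP /a; field.
    by rewrite !expf_neq0.
  have -> : u ^ (l%:Z - k%:Z) / z = (a / u ^+ l)^-1.
    rewrite expfzDr // -invr_expz -!exprnP /a; field.
    by rewrite z0 !expf_neq0.
  by [].
have OU n : O (u ^ n) -> 0 <= n.
  move=> h; rewrite leNgt; apply/negP => n0.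
  apply: (small_expN hO mu u0 (n := `|n|%N)); first by lia.
  by rewrite exprnP invr_expz (_ : - _ = n) //; lia.
have UO n : 0 <= n -> O (u ^ n).
  by case: n => // n _; rewrite -exprnP; apply: (vrX hO); case: mu.
have uz n : u ^ n != 0 by rewrite expfz_neq0.
have uniq z m n : z != 0 -> O (z / u ^ m) -> O (u ^ m / z) ->
    O (z / u ^ n) -> O (u ^ n / z) -> m = n.
  move=> z0 h1 h2 h3 h4.
  have half p q : O (z / u ^ p) -> O (u ^ q / z) -> 0 <= q - p.
    move=> hp hq; apply: OU; have := vrM hO hq hp; congr O.
    by rewrite expfzDr // -invr_expz mulrA divfK.
  by have := half _ _ h1 h4; have := half _ _ h3 h2; lia.
have /choice[v hv] : forall z, exists n : int, z != 0 -> O (z / u ^ n) /\ O (u ^ n / z).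
  move=> z; have [->|z0] := eqVneq z 0; first by exists 0.
  by have [n hn] := dec z z0; exists n.
exists v; split.
- move=> x y x0 y0; have xy0 : x * y != 0 by rewrite mulf_neq0.
  have [h1 h2] := hv _ xy0; have [h3 h4] := hv _ x0; have [h5 h6] := hv _ y0.
  apply: (uniq _ _ _ xy0 h1 h2); rewrite expfzDr //.
    by rewrite invfM mulrACA; exact: (vrM hO).
  by rewrite invfM mulrACA; exact: (vrM hO).
- move=> n; exists (u ^ n) => //; have [h1 h2] := hv _ (uz n).
  by apply: (uniq _ _ _ (uz n) h1 h2); rewrite divff //; exact: (vr1 hO).
- move=> x x0; have [h1 h2] := hv _ x0; split=> [Ox|/UO h].
    by apply: OU; have := vrM hO h2 Ox; rewrite divfK.
  by have := vrM hO h1 h; rewrite divfK.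
Qed.

End Discreteness.

(** * Existential closedness and large fields *)

Lemma rational_place_comp (K L M : fieldType) (iota : {rmorphism K -> L})
    (iota' : {rmorphism K -> M}) (g : {rmorphism L -> M}) (P : M -> option K) :
  (forall c, g (iota c) = iota' c) -> rational_place iota' P ->
  rational_place iota (P \o g).
Proof.
move=> gi hP; split; first split.
- by rewrite /= rmorph1; exact: (place1 hP).
- by move=> x y a b /= Px Py; rewrite rmorphB; exact: (placeB hP).
- by move=> x y a b /= Px Py; rewrite rmorphM; exact: (placeM hP).
- by move=> x /= Px; rewrite fmorphV; exact: (placeV hP).
- by move=> c; rewrite /= gi; exact: (placeC hP).
Qed.

Lemma place_mev (K L : fieldType) (iota : {rmorphism K -> L}) (P : L -> option K)
    m (x : 'I_m -> L) (a : 'I_m -> K) h : rational_place iota P ->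
  (forall i, P (x i) = Some (a i)) -> P (mev iota x h) = Some h.@[a].
Proof.
move=> hP hx; elim/mpoly_ring_ind: h => [c|i|p q Hp Hq|p q Hp Hq].
- by rewrite mevC mevalC; exact: (placeC hP).
- by rewrite mevXU mevalXU.
- by rewrite mevD mevalD; exact: (placeD hP).
- by rewrite mevM mevalM; exact: (placeM hP).
Qed.

Lemma existentially_closed_transfer (K L M : fieldType) (iota : {rmorphism K -> L})
    (iota' : {rmorphism K -> M}) (g : {rmorphism L -> M}) :
  (forall c, g (iota c) = iota' c) ->
  existentially_closed iota' -> existentially_closed iota.
Proof.
move=> gi ec m n f h [x [fx hx]]; apply: ec; exists (g \o x).
split=> [i|]; rewrite -mevE -(mev_comp _ _ gi) mevE; first by rewrite fx rmorph0.
by move/eqP; rewrite fmorph_eq0 => /eqP.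
Qed.

(** * Large fields are existentially closed in function fields *)

(** The residues of a solution at a rational place form a solution in [K],
    provided that the coordinates are finite and [g] does not vanish.  The places
    that violate this are zeros of [x_j^-1] or of [g(x)], so there are only
    finitely many of them. *)
Lemma large_existentially_closed (K F : fieldType) (iota : {rmorphism K -> F}) :
  large_field K -> function_field1 iota ->
  (exists P : F -> option K, rational_place iota P) -> existentially_closed iota.
Proof.
move=> large ff hP m n f g [x [fx gx]].
have inf := large F iota ff hP.
pose B j := if x j == 0 then set0 else [set P | rational_place iota P /\ P (x j)^-1 = Some 0].
pose C := [set P | rational_place iota P /\ P (mev iota x g) = Some 0].
have finB : finite_set (\bigcup_(j in [set: 'I_m]) B j).
  apply: bigcup_finite => // j _; rewrite /B; case: eqP => // /eqP xj.
  by apply: finitely_many_zeros => //; rewrite invr_eq0.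
have finC : finite_set C by apply: finitely_many_zeros => //; exact/eqP.
have [P [ratP nP]] : exists P, rational_place iota P /\ ~ (\bigcup_(j in [set: 'I_m]) B j `|` C) P.
  apply: contrapT => nex; apply: inf.
  apply: (@sub_finite_set _ _ (\bigcup_(j in [set: 'I_m]) B j `|` C)).
    by move=> P ratP; apply: contrapT => nP; apply: nex; exists P.
  by rewrite finite_setU.
have /choice[a ha] : forall j, exists c, P (x j) = Some c.
  move=> j; case Pxj: (P (x j)) => [c|]; first by exists c.
  case: nP; left; exists j => //; rewrite /B; case: eqP => [x0|_].
    by move: Pxj; rewrite x0 (place0 ratP).
  by split=> //; exact: (placeV ratP).
exists a; split=> [i|ga].
  have := place_mev (f i) ratP ha; rewrite mevE fx (place0 ratP) => -[<-] //.
by case: nP; right; split=> //; rewrite (place_mev g ratP ha) ga.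
Qed.

(** * Passing to the henselization *)

Lemma hincl_const (K : fieldType) c :
  hincl K ((@hratfun K \o ratfunC K) c) = laurent_const c.
Proof. by transitivity (lrat K (ratfunC K c)); [exact: hratfunE|exact: ratvalC]. Qed.

(** A solution in the henselization consists of algebraic power series and thus
    lies in a function field contained in K((t)), on which the place at the origin
    of K((t)) induces a rational place. *)
Lemma existentially_closed_hfield (K : fieldType) :
  (forall (F : fieldType) (iota : {rmorphism K -> F}), function_field1 iota ->
     (exists P : F -> option K, rational_place iota P) -> existentially_closed iota) ->
  existentially_closed (@hratfun K \o ratfunC K).
Proof.
move=> ecF m n f g [x [fx gx]].
pose y i : laurent K := hincl K (x i).
have [|F [iF [e [ff eF lift]]]] := @function_field_of_algebraic K _ _ _
    (@lX_transcendental K) [seq y i | i <- enum 'I_m].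
  by move=> _ /mapP[i _ ->]; exact: hfield_algebraic.
have /choice[z hz] i : exists z, e z = y i.
  by apply: lift; apply: map_f; rewrite mem_enum.
have ev h : e (mev iF z h) = hincl K (mev (@hratfun K \o ratfunC K) x h).
  rewrite (mev_comp _ _ eF) (mev_comp _ _ (@hincl_const K)) !mevE; congr (_.@[_]).
  by apply/funext => i; exact: hz.
apply: (ecF F iF ff).
  exists (@laurent_place K \o e); apply: (rational_place_comp eF).
  exact: laurent_rational_place.
exists z; split=> [i|].
  by apply: (fmorph_inj e); rewrite -mevE ev mevE fx !rmorph0.
move=> gz; apply: gx; apply: (fmorph_inj (@hincl K)).
by rewrite -mevE -ev mevE gz !rmorph0.
Qed.

(** * From the henselization to the Laurent series *)

(** Inverting the coordinates outside the valuation ring makes a point integral;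
    the equations follow after multiplication by a power of the inverted
    coordinates. *)
Section InvertCoordinates.
Variables (K : fieldType) (m : nat) (s : pred 'I_m).

Definition invert_at (M : fieldType) (z : 'I_m -> M) : 'I_m -> M :=
  fun j => if s j then (z j)^-1 else z j.

Definition inverted : {mpoly K[m]} := \prod_(j | s j) 'X_j.

Lemma invert_atK (M : fieldType) (z : 'I_m -> M) : invert_at (invert_at z) = z.
Proof. by apply/funext => j; rewrite /invert_at; case: (s j); rewrite ?invrK. Qed.

Lemma mev_inverted (M : fieldType) (t : {rmorphism K -> M}) z :
  mev t z inverted = \prod_(j | s j) z j.
Proof. by rewrite rmorph_prod; apply: eq_bigr => j _; exact: mevXU. Qed.

Lemma invert_denominators (h : {mpoly K[m]}) : exists D (h' : {mpoly K[m]}),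
  forall (M : fieldType) (t : {rmorphism K -> M}) (z : 'I_m -> M),
    mev t z inverted != 0 ->
    mev t (invert_at z) h * mev t z inverted ^+ D = mev t z h'.
Proof.
elim/mpoly_ring_ind: h => [c|j|p q [D1 [p' hp]] [D2 [q' hq]]|p q [D1 [p' hp]] [D2 [q' hq]]].
- by exists 0%N, c%:MP => M t z _; rewrite !mevC mulr1.
- case sj: (s j); last first.
    by exists 0%N, 'X_j => M t z _; rewrite !mevXU mulr1 /invert_at sj.
  exists 1%N, (\prod_(l | s l && (l != j)) 'X_l) => M t z.
  rewrite mevXU mev_inverted rmorph_prod (bigD1 j) //= mulf_eq0 negb_or => /andP[zj _].
  rewrite expr1 /invert_at sj mulKf //; apply: eq_bigr => l _; exact/esym/mevXU.
- exists (D1 + D2)%N, (p' * inverted ^+ D2 + q' * inverted ^+ D1) => M t z z0.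
  rewrite !mevD !mevM -hp // -hq // !rmorphXn exprD; ring.
- exists (D1 + D2)%N, (p' * q') => M t z z0.
  by rewrite !mevM -hp // -hq // exprD; ring.
Qed.

End InvertCoordinates.

(** The henselization contains the truncations of a solution [y] in K((t)).  They
    solve the equations approximately and, by separability, are close to a
    solution [xi] in the henselization.  Being close to [y] it also satisfies the
    inequalities. *)
Lemma existentially_closed_laurent (K : fieldType) :
  existentially_closed (@hratfun K \o ratfunC K) ->
  existentially_closed (@laurent_const K).
Proof.
move=> ecH m n f g [x [fx gx]].
pose cst := @laurent_const K; pose sH : {rmorphism K -> hfield K} := @hratfun K \o ratfunC K.
have hT := laurentO_valuation_ring K; have vT := laurent_vext K.
have hH := hring_valuation_ring K; have vH := hfield_vext K.
pose s : pred 'I_m := fun j => ~~ `[< laurentO (x j) >].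
pose y := invert_at s x.
have Oy j : laurentO (y j).
  rewrite /y /invert_at /s; case: (asboolP (laurentO (x j))) => //= nO.
  exact: (vrV hT).
have yx : invert_at s y = x by exact: invert_atK.
have y0 : mev cst y (inverted K s) != 0.
  rewrite mev_inverted; apply/prodf_neq0 => j sj; rewrite /y /invert_at sj invr_eq0.
  by apply: contraNneq sj => ->; apply/asboolP; exact: (vr0 hT).
have /choice[Df /choice[f' hf']] i := invert_denominators s (f i).
have [Dg [g' hg']] := invert_denominators s g.
have f'y i : mev cst y (f' i) = 0 by rewrite -hf' // yx mevE fx mul0r.
have g'y : mev cst y g' != 0.
  by rewrite -hg' // yx mulf_neq0 ?expf_neq0 //; apply/eqP.
have [n' [F [G [Fy Gy lft]]]] := separable_liftable y (@laurent_separable K).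
pose Gam := G * (g' * inverted K s).
have GamE (M : fieldType) (t : {rmorphism K -> M}) z :
    mev t z Gam = mev t z G * (mev t z g' * mev t z (inverted K s)).
  by rewrite mevM; congr (_ * _); exact: mevM.
have Gamy : mev cst y Gam != 0.
  by rewrite GamE; exact: mulf_neq0 Gy (mulf_neq0 g'y y0).
(* The order of Gam at y is less than N; the truncations are taken to the
   precision t^(2N + 1), which is G(a) d for d = t^(N + 1) t^N / G(a). *)
have [N hN] : exists N : nat, ~ pideal (@laurentO K) (lrat K (rt K ^+ N)) (mev cst y Gam).
  apply: contrapT => nex; case/eqP: Gamy; apply: laurent_eq0 => N.
  by apply/laurent_pideal_rt; apply: contrapT => h; apply: nex; exists N.
have /choice[r hr] j := laurent_dense (y j) (N + N.+1).
pose a j : hfield K := hratfun K (r j).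
have ya j : pideal (@laurentO K) (lrat K (rt K ^+ (N + N.+1))) (hincl K (a j) - y j).
  rewrite hratfunE -opprB; apply: (pidealN hT); exact/laurent_pideal_rt.
have Oa j : laurentO (hincl K (a j)).
  rewrite -(subrK (y j) (hincl K _)); apply: (vrD hT) => //.
  exact: (pidealO hT (vext_rtX vT _) (ya j)).
have evH (z : 'I_m -> hfield K) h : hincl K (mev sH z h) = mev cst (@hincl K \o z) h by apply: mev_comp => c; exact: hincl_const.
have cO c : laurentO (cst c) by exact: laurentO_const.
have aev h : pideal (@laurentO K) (lrat K (rt K ^+ (N + N.+1)))
    (hincl K (mev sH a h) - mev cst y h).
  by rewrite evH; apply: (mev_pideal hT cO).
pose Ga := mev sH a G; pose T k : hfield K := hratfun K (rt K ^+ k).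
have T0 k : T k != 0 by exact: (vext_rtX_neq0 (@hratfun K)).
have nGa : ~ pideal (@hring K) (T N) Ga.
  move=> /hpideal h; apply: hN; rewrite GamE mulrC -mevM.
  apply: (pidealM hT); first by apply: (mev_O hT cO).
  have := pidealB hT h (pideal_rtW vT (leq_addr _ _) (aev G)).
  by rewrite subKr.
have Ga0 : Ga != 0 by apply: contra_not_neq nGa => ->; exact: (pideal0 hH).
have mTG : max_ideal (@hring K) (T N / Ga).
  rewrite -invf_div; apply: (max_idealV hH) => h; apply: nGa.
  exact/(pidealE _ _ (T0 N)).
pose d := T N.+1 * (T N / Ga).
have md : max_ideal (@hring K) d by apply: (max_idealM hH) => //; exact: (vext_rtX vH).
have [||xi [Oxi xia rel _]] := lft _ _ sH (hfield_henselian K) _ a d Oa Ga0 md.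
- by move=> c; rewrite hringE [hincl K _]hincl_const.
- move=> i; rewrite -/Ga /d (_ : Ga * _ = T (N + N.+1)); last first.
    by rewrite /T exprD rmorphM mulrCA (mulrC Ga) divfK // mulrC.
  by apply/hpideal; have := aev (F i); rewrite Fy subr0.
have xiy j : pideal (@laurentO K) (lrat K (rt K ^+ N)) (hincl K (xi j) - y j).
  apply: (pideal_trans hT (y := hincl K (a j))); last exact: (pideal_rtW vT (leq_addr _ _) (ya j)).
  rewrite -rmorphB; apply/hpideal; apply: (pidealW hH _ (xia j)).
  exists (hratfun K (rt K) * (T N / Ga)).
    by apply: (vrM hH); [exact: (max_rt vH).1|case: mTG].
  by rewrite mulrA; congr (_ * _); rewrite /T exprSr; exact: rmorphM.
have Gamxi : mev sH xi Gam != 0.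
  apply: contra_not_neq hN => e.
  have := mev_pideal hT cO Gam (fun j => Oxi j) Oy xiy.
  rewrite -[mev _ _ Gam](evH xi) e rmorph0 sub0r => /(pidealN hT).
  by rewrite opprK.
move: Gamxi; rewrite GamE mulf_eq0 negb_or mulf_eq0 negb_or => /and3P[_ g'xi sxi].
apply: ecH; exists (invert_at s xi); split=> [i|].
  rewrite -mevE; apply: (mulIf (expf_neq0 (Df i) sxi)); rewrite mul0r hf' //.
  exact: rel.
rewrite -mevE => e; move: g'xi; rewrite -hg' //.
by rewrite -[mev _ (invert_at s xi) g]/(mev sH (invert_at s xi) g) e mul0r eqxx.
Qed.

(** * New rational places from rational points *)

Definition poly_in (K : fieldType) m (j : 'I_m) : {rmorphism {poly K} -> {mpoly K[m]}} :=
  horner_eval ('X_j : {mpoly K[m]}) \o map_poly (@mpolyC m K).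

Lemma mev_poly_in (K M : fieldType) (s : {rmorphism K -> M}) m (z : 'I_m -> M) j p :
  mev s z (poly_in K j p) = pval s (z j) p.
Proof.
elim/poly_ind: p => [|p c IH]; first by rewrite !rmorph0.
have -> : poly_in K j (p * 'X + c%:P) = poly_in K j p * 'X_j + c%:MP.
  rewrite rmorphD rmorphM; congr (_ * _ + _).
    by rewrite /= map_polyX /horner_eval hornerX.
  by rewrite /= map_polyC /horner_eval hornerC.
by rewrite mevD mevM IH mevXU mevC rmorphD rmorphM pvalX pvalC.
Qed.

(** In transcendence degree 1 a specialization [xi] of the generators [x] has no
    room for a kernel as soon as one of its values is transcendental, so it
    extends to an embedding of the function field. *)
Section Specialization.
Variables (K F M : fieldType) (iota : {rmorphism K -> F}) (s : {rmorphism K -> M}).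
Variables (m : nat) (x : 'I_m -> F) (xi : 'I_m -> M) (j : 'I_m).
Hypotheses (ff : function_field1 iota).
Hypothesis gens : forall S : set F, is_subfield S -> (forall c, S (iota c)) ->
  (forall i, S (x i)) -> forall y, S y.
Hypothesis spec : forall h, mev iota x h = 0 -> mev s xi h = 0.
Hypothesis trxi : transcendental s (xi j).

Lemma specialization_transcendental : transcendental iota (x j).
Proof.
apply: transcendentalP => p px; apply: trxi; rewrite rmorph0 -mev_poly_in.
by apply: spec; rewrite mev_poly_in.
Qed.

(** If [h(x)] is not zero, its inverse is algebraic over K(x_j), so [h(x)]
    divides a nonzero polynomial in [x_j]; this relation specializes. *)
Lemma specialization_neq0 h : mev iota x h != 0 -> mev s xi h != 0.
Proof.
move=> hx; have trx := specialization_transcendental.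
have [q qE] := algebraic_inv_poly (function_field_algebraic trx ff _) hx.
have [d [Q [d0 E]]] := clear_denominators q.
pose R := poly_in K j d - h * (map_poly (poly_in K j) Q).[h].
have evQ (N : fieldType) (t : {rmorphism K -> N}) z :
    mev t z (map_poly (poly_in K j) Q).[h] = (map_poly (pval t (z j)) Q).[mev t z h].
  rewrite -horner_map -map_poly_comp; congr (_.[_]); apply: eq_map_poly => p.
  exact: mev_poly_in.
have evR (N : fieldType) (t : {rmorphism K -> N}) z :
    mev t z R = pval t (z j) d - mev t z h * (map_poly (pval t (z j)) Q).[mev t z h].
  by rewrite mevB mevM evQ mev_poly_in.
have Rx : mev iota x R = 0.
  rewrite evR; apply/eqP; rewrite subr_eq0; apply/eqP.
  have : ratval trx (tofrac d) * (mev iota x h)^-1 = (map_poly (pval iota (x j)) Q).[mev iota x h].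
    rewrite qE -hornerZ -map_polyZ E -map_poly_comp; congr (_.[_]).
    by apply: eq_map_poly => r; exact: ratval_tofrac.
  by move=> <-; rewrite mulrC divfK // ratval_tofrac.
apply/eqP => hxi; have := spec Rx; rewrite evR hxi mul0r subr0 => dxi.
by case/eqP: d0; apply: trxi; rewrite dxi rmorph0.
Qed.

Lemma specialization_embedding : exists g : {rmorphism F -> M},
  (forall c, g (iota c) = s c) /\ forall i, g (x i) = xi i.
Proof.
pose rel y b := exists h1 h2, [/\ mev iota x h2 != 0,
  y = mev iota x h1 / mev iota x h2 & b = mev s xi h1 / mev s xi h2].
have rel_ev h : rel (mev iota x h) (mev s xi h).
  by exists h, 1; rewrite !rmorph1 !divr1 oner_neq0.
have relB a b a' b' : rel a b -> rel a' b' -> rel (a - a') (b - b').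
  move=> [h1 [h2 [n2 -> ->]]] [k1 [k2 [m2 -> ->]]].
  have n2' := specialization_neq0 n2; have m2' := specialization_neq0 m2.
  have evB (N : fieldType) (t : {rmorphism K -> N}) z :
      mev t z (h1 * k2 - k1 * h2) = mev t z h1 * mev t z k2 - mev t z k1 * mev t z h2.
    by rewrite mevB; congr (_ - _); exact: mevM.
  have evM (N : fieldType) (t : {rmorphism K -> N}) z :
      mev t z (h2 * k2) = mev t z h2 * mev t z k2 by exact: mevM.
  exists (h1 * k2 - k1 * h2), (h2 * k2); rewrite !evB !evM; split.
  - exact: mulf_neq0 n2 m2.
  - by rewrite -mulNr addf_div // mulNr.
  - by rewrite -mulNr addf_div // mulNr.
have relM a b a' b' : rel a b -> rel a' b' -> rel (a * a') (b * b').
  move=> [h1 [h2 [n2 -> ->]]] [k1 [k2 [m2 -> ->]]].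
  exists (h1 * k1), (h2 * k2); rewrite !mevM; split; first exact: mulf_neq0 n2 m2.
    exact: mulf_div.
  exact: mulf_div.
have relV a b : rel a b -> rel a^-1 b^-1.
  move=> [h1 [h2 [n2 -> ->]]]; have [e|n1] := eqVneq (mev iota x h1) 0.
    by rewrite e (spec e) !mul0r !invr0; have := rel_ev 0; rewrite !rmorph0.
  by exists h2, h1; rewrite !invf_div.
have rel_c c : rel (iota c) (s c) by have := rel_ev c%:MP; rewrite !mevC.
have rel_x i : rel (x i) (xi i) by have := rel_ev 'X_i; rewrite !mevXU.
have fn a b b' : rel a b -> rel a b' -> b = b'.
  move=> [h1 [h2 [n2 -> ->]]] [k1 [k2 [m2 e ->]]].
  have n2' := specialization_neq0 n2; have m2' := specialization_neq0 m2.
  apply/eqP; rewrite eqr_div // -subr_eq0 -!mevM -mevB; apply/eqP/spec.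
  by apply/eqP; rewrite mevB !mevM subr_eq0 -eqr_div // e.
have [g hg] : exists g : {rmorphism F -> M}, forall a, rel a (g a).
  apply: rel_rmorphism => //.
    apply: (gens (S := [set a | exists b, rel a b])).
    - apply: is_subfieldI => [|a a' [b h] [b' h']|a a' [b h] [b' h']].
      + by exists 1; have := rel_ev 1; rewrite !rmorph1.
      + by exists (b - b'); exact: relB.
      + by exists (b / b'); apply: relM => //; exact: relV.
    - by move=> c; exists (s c).
    - by move=> i; exists (xi i).
  by have := rel_ev 1; rewrite !rmorph1.
by exists g; split=> [c|i]; exact: fn (hg _) _.
Qed.

End Specialization.

(** The element [w] is regular on an affine model whose coordinates generate the
    function field and include [w].  By existential closedness this model has a
    smooth K-point [a], and the approximate point [a + t] is close to a point [xi]
    with coordinates in K[[t]].  One coordinate of [xi] is [a_j + t], which is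
    transcendental, so [xi] defines an embedding of the function field into K((t))
    which sends [w] to a power series; the place at the origin of K((t)) induces
    the required one. *)
Lemma place_finite_at (K F : fieldType) (iota : {rmorphism K -> F})
    (e : {rmorphism F -> laurent K}) (w : F) :
  function_field1 iota -> (forall c, e (iota c) = laurent_const c) ->
  existentially_closed iota ->
  exists P : F -> option K, rational_place iota P /\ P w <> None.
Proof.
move=> ff ei ec; have [[l gen] [x0 [nalg _]]] := ff.
pose cst := @laurent_const K; have hT := laurentO_valuation_ring K.
have cO c : laurentO (cst c) by exact: laurentO_const.
pose x (i : 'I_(size l).+1) := nth 0 (w :: l) i.
have xgen (S : set F) : is_subfield S -> (forall c, S (iota c)) ->
    (forall i, S (x i)) -> forall y, S y.
  move=> hS hc hx y; have : gen_subfield iota [set` l] y by rewrite gen.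
  apply: gen_subfield_min => // z /=; rewrite -[z \in l]/(z \in l) => zl.
  have lt : ((index z l).+1 < (size l).+1)%N by rewrite ltnS index_mem.
  by have := hx (Ordinal lt); rewrite /x /= nth_index.
have [n [f [G [fx Gx lft]]]] := separable_liftable (e \o x) (@laurent_separable K).
have evx h : e (mev iota x h) = mev cst (e \o x) h by exact: mev_comp.
have [a [fa Ga]] : exists a : 'I_(size l).+1 -> K, (forall i, (f i).@[a] = 0) /\ G.@[a] <> 0.
  apply: ec; exists x; split=> [i|].
    by apply: (fmorph_inj e); rewrite -mevE evx fx rmorph0.
  by rewrite -mevE => Gx0; move: Gx; rewrite -evx Gx0 rmorph0 eqxx.
pose a' j : laurent K := cst (a j) + lX K.
have mX := max_ideal_lX K.
have Oa' j : laurentO (a' j) by apply: (vrD hT) => //; case: mX.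
have ev_a h : pideal (@laurentO K) (lX K) (mev cst a' h - cst h.@[a]).
  have -> : cst h.@[a] = mev cst (cst \o a) h by exact/esym/mev_meval.
  apply: (mev_pideal hT cO) => // j; first exact: cO.
  have -> : a' j - (cst \o a) j = lX K by rewrite /a' addrAC subrr add0r.
  by exists 1; [exact: (vr1 hT)|rewrite mulr1].
have uG : mev cst a' G != 0 /\ laurentO (mev cst a' G)^-1.
  apply: (unit_vrV hT); first exact: (mev_O hT cO).
  apply: (max_ideal_unitB hT (pideal_max hT mX (ev_a G))).
  apply: unitP => //; first by rewrite -fmorphV; exact: cO.
  by rewrite fmorph_eq0; apply/eqP.
have [|xi [Oxi _ spec alt]] := lft _ _ cst (laurent_henselian K) cO a' (lX K) Oa' uG.1 mX.
  move=> i; have := ev_a (f i); rewrite fa [cst 0](rmorph0 (@laurent_const K)) subr0 => -[r Or ->].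
  exists (r / mev cst a' G); first by apply: (vrM hT) => //; exact: uG.2.
  by rewrite [_ * lX K]mulrC -mulrA; congr (_ * _); rewrite mulrC divfK // uG.1.
have spec' h : mev iota x h = 0 -> mev cst xi h = 0.
  by move=> hx; apply: spec; rewrite -evx hx rmorph0.
have [j xij] : exists j, xi j = a' j.
  case: alt => // alg; case: nalg.
  apply: (xgen _ (subfield_algebraic iota)) => [c|i] /=; first exact: algebraic_id.
  have [p p0 /rootP px] := alg i; exists p => //; apply/rootP.
  apply: (fmorph_inj e); rewrite rmorph0 -px -horner_map -map_poly_comp.
  by congr (_.[_]); apply: eq_map_poly => c; exact: ei.
have trxi : transcendental cst (xi j).
  apply/transcendentalN => alg; have /transcendentalN := @lX_transcendental K; apply.
  have -> : lX K = xi j - cst (a j) by rewrite xij /a' addrAC subrr add0r.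
  by apply: algebraic_sub => //; exact: algebraic_id.
have [g [gi gx]] := specialization_embedding ff xgen spec' trxi.
exists (@laurent_place K \o g); split.
  by apply: (rational_place_comp gi); exact: laurent_rational_place.
by rewrite /= -[w]/(x ord0) gx laurent_place_O.
Qed.

(** The quotient [Q / H] vanishes at all the places.  It is not zero when [x] is
    transcendental, and then its inverse is the required element. *)
Lemma places_common_pole (K F : fieldType) (iota : {rmorphism K -> F}) n
    (Ps : 'I_n -> F -> option K) :
  (forall i, rational_place iota (Ps i)) -> function_field1 iota ->
  exists w, forall i, Ps i w = None.
Proof.
move=> hPs [_ [x [nalg _]]].
have [Q [H [[c QE] H0 _ PQ]]] := places_regularize hPs x.
exists (Q / H)^-1 => i; case Pw: (Ps i _) => [d|//].
have z0 : Q / H != 0.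
  apply: mulf_neq0; last by rewrite invr_eq0; case: H0 => // n0; move: (i); rewrite n0 => -[].
  rewrite QE; apply/prodf_neq0 => j _; rewrite subr_eq0; apply/eqP => e.
  by apply: nalg; rewrite e; exact: algebraic_id.
have := placeM (hPs i) (PQ i) Pw; rewrite divff // (place1 (hPs i)) mul0r => -[/eqP].
by rewrite oner_eq0.
Qed.

(** A function field with a rational place embeds into K((t)), so for an element
    with poles at finitely many given places there is a rational place at which it
    is finite, which is therefore new. *)
Lemma existentially_closed_large (K : fieldType) :
  (forall (L : fieldType) (iota : {rmorphism K -> L}),
     (exists P : L -> option K, rational_place iota P /\ discrete_place P) ->
     existentially_closed iota) -> large_field K.
Proof.
move=> ec F iota ff [P0 hP0].
have dP0 := function_field_place_discrete ff hP0.
have [e ei] := laurent_embedding hP0 dP0.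
(* Places are functions: listing them requires the classical choice structure. *)
move=> /(@finite_seqP {classic (F -> option K)})[r hr].
pose Ps (i : 'I_(size r)) : F -> option K := nth P0 r i.
have hPs i : rational_place iota (Ps i).
  have : [set` r] (Ps i) by rewrite /= mem_nth.
  by rewrite -hr.
have [w hw] := places_common_pole hPs ff.
have [Q [hQ Qw]] := place_finite_at w ff ei (ec F iota (ex_intro _ P0 (conj hP0 dP0))).
have : [set` r] Q by rewrite -hr.
move=> /= Qr; have lt : (index (Q : {classic (F -> option K)}) r < size r)%N by rewrite index_mem.
by have := hw (Ordinal lt); rewrite /Ps /= nth_index.
Qed.

Theorem theorem15 (K : fieldType) :
  [<-> large_field K;

       forall (F : fieldType) (iota : {rmorphism K -> F}),
         function_field1 iota ->
         (exists P : F -> option K, rational_place iota P) ->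
         existentially_closed iota;

       forall (H : fieldType) (OH : set H) (j : {rmorphism ratfun K -> H}),
         is_henselization (@tadic_ring K) OH j ->
         existentially_closed (j \o ratfunC K);

       existentially_closed (@laurent_const K);

       forall (L : fieldType) (iota : {rmorphism K -> L}),
         (exists P : L -> option K, rational_place iota P /\ discrete_place P) ->
         existentially_closed iota].
Proof.
tfae.
- by move=> large F iota ff hP; exact: large_existentially_closed.
- move=> ecF H OH j [_ _ univ].
  have [[h [_ hj]] _] := univ _ _ _ (@hfield_henselian K) (@hratfun_valued K).
  apply: (existentially_closed_transfer (g := h) _ (existentially_closed_hfield ecF)).
  by move=> c; exact: hj.
- move=> ecH; apply: existentially_closed_laurent.
  exact: ecH (@hfield_henselization K).
- move=> ecT L iota [P [hP dP]]; have [e ei] := laurent_embedding hP dP.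
  exact: existentially_closed_transfer ei ecT.
- exact: existentially_closed_large.
Qed.
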